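(* Let $\kappa>0$, $\beta\in(0,1)$, $\delta>0$, $\sigma>0$. There exist positive constants $E_1,E_2,E_3,E_4,t_1$, depending only on $\kappa,\beta,\delta,\sigma$ (and in particular not on $d$), such that for every $d\in\mathbb{N}$, every reflected Brownian motion with parameters $(\mu,\Sigma,R)$ in $\mathbb{R}^d_+$ satisfying (BC1), (BC2), (BC3) with these values of $\kappa,\beta,\delta,\sigma$, every $\mathbf{x}\in\mathbb{R}^d_+$ and every $t\ge t_1\max\{\|\mathbf{x}\|_\infty,\log(2d)\}$, $$\mathbb{E}\left(\|X(t;\mathbf{x}) - X(t;\mathbf{X}(\infty))\|_1\right)\le 2\left(2\|\mathbf{x}\|_1 + E_1d^2\right)e^{-E_2t/\log(2d)} + \left(4\|\mathbf{x}\|_1 + E_1d^2\right)e^{-E_4t/2} + E_3d^2e^{-E_4t}.$$ In particular, the relaxation time satisfies $$t_{rel}(\mathbf{x})\le\max\Big\{E_2^{-1}\log\left[8\left(2\|\mathbf{x}\|_1 + E_1d^2\right)\right]\log(2d) + E_4^{-1}\left[2\log\left[8\left(4\|\mathbf{x}\|_1+E_1d^2\right)\right] + \log(8E_3d^2)\right],\ t_1\max\{\|\mathbf{x}\|_\infty,\log(2d)\}\Big\}.$$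
   Context: Let $\mathbb{R}^d_+ = [0,\infty)^d$; inequalities between vectors are coordinatewise. Let $B$ be a standard $d$-dimensional Brownian motion, $\mu\in\mathbb{R}^d$, $\mathbf{D},R\in\mathbb{R}^{d\times d}$, $\Sigma=\mathbf{D}\mathbf{D}^T$, $P := I - R^T$. Standing assumptions: (A1) $P$ is substochastic (nonnegative entries, row sums at most $1$) and transient ($P^n\to0$); (A2) $-R^{-1}\mu>0$; (A3) $\Sigma$ is positive definite. For $\mathbf{x}\in\mathbb{R}^d_+$, the reflected Brownian motion (RBM) $X(\cdot;\mathbf{x})$ is the unique continuous $\mathbb{R}^d_+$-valued process such that $X(t;\mathbf{x}) = \mathbf{x}+\mathbf{D}B(t)+\mu t+RL(t)$, where $L$ is continuous, (coordinatewise) non-decreasing, $L(0)=0$ and $\int_0^tX_i(s;\mathbf{x})\,dL_i(s)=0$ for all $t>0$, $1\le i\le d$. All processes $X(\cdot;\mathbf{x})$, $\mathbf{x}\in\mathbb{R}^d_+$, are driven by the same Brownian motion $B$ (synchronous coupling). Under the standing assumptions the RBM has a unique stationary probability distribution; $\mathbf{X}(\infty)$ denotes a random vector with this distribution, independent of $B$, and $X(\cdot;\mathbf{X}(\infty))$ is the RBM driven by $B$ started from $\mathbf{X}(\infty)$. The conditions, with constants $\kappa,\beta,\delta,\sigma$ not depending on $d$, are (with $\mathbf{1}$ the vector of ones and $\|u\|_\infty=\sup_i|u_i|$): (BC1) $P$ is substochastic and $\|\mathbf{1}^TP^n\|_\infty\le\kappa(1-\beta)^n$ for all $n\ge0$.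 (BC2) $R^{-1}\mu<-\delta\mathbf{1}$. (BC3) $\sigma_i := \sqrt{\Sigma_{ii}}$ satisfies $\sigma^{-1}\le\sigma_i\le\sigma$ for every $1\le i\le d$. Notation: $\|z\|_1=\sum_i|z_i|$; $\mathcal{L}(\cdot)$ denotes the law; $W_1(\mu,\nu)=\inf_\gamma\int\|\mathbf{x}-\mathbf{y}\|_1\,\gamma(d\mathbf{x},d\mathbf{y})$ over couplings $\gamma$ of probability measures $\mu,\nu$ on $\mathbb{R}^d_+$; the relaxation time is $t_{rel}(\mathbf{x}) := \inf\{t\ge0: W_1(\mathcal{L}(X(t;\mathbf{x})),\mathcal{L}(\mathbf{X}(\infty)))\le1/2\}$. *)

(* Defs.v *)
From HB Require Import structures.
From mathcomp Require Import all_boot all_order all_algebra.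
From mathcomp Require Import all_classical all_reals all_analysis.

Set Implicit Arguments.
Unset Strict Implicit.
Unset Printing Implicit Defensive.

Import Order.TTheory GRing.Theory Num.Theory.
Import numFieldNormedType.Exports.

Local Open Scope classical_set_scope.
Local Open Scope ring_scope.

(* Vectors of R^d are columns 'cV[R]_d; the library norm `|u| of a matrix is
   the maximum of the absolute values of its entries, i.e. the sup norm.
   Processes are indexed by R, and only their values at times t >= 0 are
   constrained. As R is the field of reals, the reflection matrix is named Rf,
   and the matrix P = I - R^T is written out as 1%:M - Rf^T. *)

(* The sigma-algebra generated by the entries; for entries in R these are the
   Borel sets of R^(m x n). *)
Definition measure_matrix_display : measure_display -> measure_display.
Proof. exact. Qed.

Section measurable_matrix.
Context {disp} {T : sigmaRingType disp} (m n : nat).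

Definition g_sigma_entries : set (set 'M[T]_(m, n)) :=
  <<s \bigcup_(ij in [set: 'I_m * 'I_n])
        preimage_set_system setT (fun M : 'M[T]_(m, n) => M ij.1 ij.2)
          measurable >>.

Let entries_set0 : g_sigma_entries set0.
Proof. exact: sigma_algebra0. Qed.

Let entries_setC A : g_sigma_entries A -> g_sigma_entries (~` A).
Proof. exact: sigma_algebraC. Qed.

Let entries_bigcup (F : (set 'M[T]_(m, n))^nat) :
  (forall i, g_sigma_entries (F i)) -> g_sigma_entries (\bigcup_i F i).
Proof. exact: sigma_algebra_bigcup. Qed.

HB.instance Definition _ :=
  @isMeasurable.Build (measure_matrix_display disp) 'M[T]_(m, n)
    g_sigma_entries entries_set0 entries_setC entries_bigcup.

End measurable_matrix.

Definition norm1 (R : realType) (d : nat) (z : 'cV[R]_d) : R :=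
  \sum_i `|z i 0|.

Definition orthant (R : realType) (d : nat) : set 'cV[R]_d :=
  [set z | forall i, 0 <= z i 0].
Arguments orthant {R d}.

Definition substochastic (R : realType) (d : nat) (P : 'M[R]_d) : Prop :=
  (forall i j, 0 <= P i j) /\ (forall i, \sum_j P i j <= 1).

Definition transient (R : realType) (d : nat) (P : 'M[R]_d) : Prop :=
  (fun n : nat => P ^+ n) @ \oo --> (0 : 'M[R]_d).

Definition positive_definite (R : realType) (d : nat) (S : 'M[R]_d) : Prop :=
  S^T = S /\ forall v : 'cV[R]_d, v != 0 -> 0 < (v^T *m S *m v) 0 0.

Record standing_assumptions (R : realType) (d : nat)
    (mu : 'cV[R]_d) (S Rf : 'M[R]_d) : Prop := {
  std_substochastic : substochastic (1%:M - Rf^T) ;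
  std_transient : transient (1%:M - Rf^T) ;
  std_drift : forall i, 0 < (- (invmx Rf *m mu)) i 0 ;
  std_posdef : positive_definite S }.

Record BC (R : realType) (kappa beta delta sigma : R) (d : nat)
    (mu : 'cV[R]_d) (S Rf : 'M[R]_d) : Prop := {
  BC1_substochastic : substochastic (1%:M - Rf^T) ;
  BC1_decay : forall n : nat,
    `|(const_mx 1 : 'rV[R]_d) *m (1%:M - Rf^T) ^+ n| <= kappa * (1 - beta) ^+ n ;
  BC2 : forall i, (invmx Rf *m mu) i 0 < - delta ;
  BC3 : forall i, sigma^-1 <= Num.sqrt (S i i) <= sigma }.

Section processes.
Context {disp : measure_display} {Omega : measurableType disp} {R : realType}.
Variable (P : probability Omega R).

Definition mutually_independent (I : finType) (Z : I -> Omega -> R) : Prop :=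
  forall A : I -> set R, (forall j, measurable (A j)) ->
    P (\bigcap_(j in [set: I]) (Z j @^-1` A j))
    = (\prod_j fine (P (Z j @^-1` A j)))%:E.

Record brownian_motion (d : nat) (B : R -> {RV P >-> 'cV[R]_d}) : Prop := {
  bm_start : {ae P, forall w, B 0 w = 0} ;
  bm_continuous :
    {ae P, forall w, {within `[0, +oo[, continuous (fun t => B t w)}} ;
  bm_gaussian : forall (s t : R) (i : 'I_d) (A : set R),
    0 <= s -> s < t -> measurable A ->
    P [set w | A ((B t w - B s w) i 0)] = normal_prob 0 (Num.sqrt (t - s)) A ;
  bm_independent : forall (n : nat) (t : nat -> R),
    0 <= t 0 -> (forall k, (k < n)%N -> t k < t k.+1) ->
    mutually_independent (fun (ki : 'I_n * 'I_d) w =>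
      (B (t ki.1.+1) w - B (t ki.1) w) ki.2 0) }.

Definition sigma_process (d : nat) (B : R -> {RV P >-> 'cV[R]_d}) :
    set (set Omega) :=
  <<s \bigcup_(t in [set t : R | 0 <= t])
        preimage_set_system setT (B t) measurable >>.

Definition independent_of_process (d : nat) (xi : {RV P >-> 'cV[R]_d})
    (B : R -> {RV P >-> 'cV[R]_d}) : Prop :=
  forall A C : set Omega,
    preimage_set_system setT xi measurable A -> sigma_process B C ->
    P (A `&` C) = (P A * P C)%E.

End processes.

(* [reflected_path Rf y x l]: the path x is y + Rf l, with regulator l. The
   Stieltjes measure dl_i is the library one, whose integrator is defined on
   the whole line: l_i is extended by l_i 0 to negative times. *)
Record reflected_path (R : realType) (d : nat) (Rf : 'M[R]_d)
    (y x l : R -> 'cV[R]_d) : Prop := {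
  rp_continuous : {within `[0, +oo[, continuous x} ;
  rp_orthant : forall t : R, 0 <= t -> orthant (x t) ;
  rp_decomp : forall t : R, 0 <= t -> x t = y t + Rf *m l t ;
  rp_regulator_continuous : {within `[0, +oo[, continuous l} ;
  rp_regulator_nondecreasing : forall (s t : R) i,
    0 <= s -> s <= t -> l s i 0 <= l t i 0 ;
  rp_regulator_start : l 0 = 0 ;
  rp_complementarity : forall i, exists2 F : cumulative R R,
    (forall s : R, F s = l (Num.max 0 s) i 0) &
    (forall t : R, 0 < t ->
      (\int[lebesgue_stieltjes_measure F]_(s in `[0%R, t]) (x s i 0)%:E = 0)%E) }.

(* [is_RBM D mu Rf B xi X]: X is the reflected Brownian motion with initial
   value xi driven by B. *)
Definition is_RBM (disp : measure_display) (Omega : measurableType disp)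
    (R : realType) (P : probability Omega R) (d : nat)
    (D : 'M[R]_d) (mu : 'cV[R]_d) (Rf : 'M[R]_d)
    (B : R -> {RV P >-> 'cV[R]_d}) (xi : Omega -> 'cV[R]_d)
    (X : R -> {RV P >-> 'cV[R]_d}) : Prop :=
  exists L : R -> {RV P >-> 'cV[R]_d},
    {ae P, forall w, reflected_path Rf
       (fun t => xi w + D *m B t w + t *: mu) (X^~ w) (L^~ w)}.

Definition has_law (disp : measure_display) (Omega : measurableType disp)
    (R : realType) (P : probability Omega R) (d : nat)
    (xi : {RV P >-> 'cV[R]_d}) (pi : probability 'cV[R]_d R) : Prop :=
  forall A, measurable A -> distribution P xi A = pi A.

Definition stationary_distribution (R : realType) (d : nat)
    (D : 'M[R]_d) (mu : 'cV[R]_d) (Rf : 'M[R]_d)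
    (pi : probability 'cV[R]_d R) : Prop :=
  pi orthant = 1%E /\
  forall (disp : measure_display) (Omega : measurableType disp)
    (P : probability Omega R) (B : R -> {RV P >-> 'cV[R]_d})
    (xi : {RV P >-> 'cV[R]_d}) (Y : R -> {RV P >-> 'cV[R]_d}),
    brownian_motion B -> independent_of_process xi B -> has_law xi pi ->
    is_RBM D mu Rf B xi Y -> forall t : R, 0 <= t -> has_law (Y t) pi.

Definition coupling (R : realType) (d : nat)
    (nu1 nu2 : probability 'cV[R]_d R) :
    set (probability ('cV[R]_d * 'cV[R]_d)%type R) :=
  [set g | forall A : set 'cV[R]_d, measurable A ->
    g (A `*` setT) = nu1 A /\ g (setT `*` A) = nu2 A].

Definition wasserstein1 (R : realType) (d : nat)
    (nu1 nu2 : probability 'cV[R]_d R) : \bar R :=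
  ereal_inf [set (\int[g]_z (norm1 (z.1 - z.2))%:E)%E | g in coupling nu1 nu2].

(* Extended-real valued: +oo when no time qualifies. *)
Definition relaxation_time (R : realType) (d : nat)
    (law : R -> probability 'cV[R]_d R) (pi : probability 'cV[R]_d R) :
    \bar R :=
  ereal_inf [set t%:E | t in
    [set t : R | 0 <= t /\ (wasserstein1 (law t) pi <= 2^-1%:E)%E]].

(* Main.v *)
Require Import Defs.
From HB Require Import structures.
From mathcomp Require Import all_boot all_order all_algebra.
From mathcomp Require Import ring lra.
From mathcomp Require Import all_classical all_reals all_analysis.
From mathcomp Require Import measurable_realfun.

Import Order.TTheory GRing.Theory Num.Theory.
Import numFieldNormedType.Exports.

Local Open Scope classical_set_scope.
Local Open Scope ring_scope.

Set Implicit Arguments.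
Unset Strict Implicit.
Unset Printing Implicit Defensive.

(** Write M = P^T = 1 - R and Q = R^-1 X, so that dQ = R^-1 (D dB + mu dt) + dL.

Two reflected paths X and Y driven by the same noise dominate a common path Z
which solves the same reflection equation from a smaller initial value.
The gap q = R^-1 (X - Z) is nonnegative and nonincreasing in time, and at the
end of a time block during which every coordinate of X hits 0 it is at most M
times its value at the beginning. Hence X - Z decays like |1^T P^m| in the
number m of such blocks.

By (BC1) there is a weight h, between 1 and a constant not depending on d, with
M h <= (1 - gam) h. Let V = max_i Q_i / h_i. When X_i = 0, Q_i = (M Q)_i is at most
(1 - gam) V h_i, and while X_i > 0, Q_i drifts downwards by (BC2); so a large V
decreases at a fixed rate, up to the oscillation of the noise. Over a block with
quiet noise and small V at its beginning, the drift forces every L_i to increase,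
that is, every coordinate to hit 0. The number of other blocks is thus controlled
by the initial value of V and by the noise. For blocks of length of order
log (2 d), chaining and the exponential moments of Brownian increments bound the
exponential moment of the noise cost of n blocks by 2^n. The same recursion,
together with stationarity, bounds an exponential moment of V for the stationary
process. *)

(** The difference X - Y has no sign, so nothing monotone can be attached to it directly; the gaps X
    - Z and Y - Z are nonnegative, and the triangle inequality adds them. Probability enters through
    one number [psi k] per block, a sum of exponentials of normalized dyadic increments of the
    noise. It plays two roles: [psi k < 1] certifies a quiet block, and the cost of any block
    satisfies exp(lam cost) <= 1 + K psi. A product of such affine factors over blocks expands into
    exponentials of linear forms in Brownian increments, whose expectations are explicit, so no
    conditioning on the past is involved. The stationary initial value and the noise are kept in
    separate summands, so that only individual expectations are needed. The length 128 log(2d) / p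
    of a block, with p independent of d, makes the union bound over d coordinates affordable. Beyond
    the time threshold the l1 norm of the initial point is at most d t; the factor t is absorbed by
    giving up half of an exponential rate, and sqrt(d) in place of d in the contraction bound leaves
    room for log(2d), so that everything fits in d^2. *)

Lemma mxD_E (V : nmodType) m n (A B : 'M[V]_(m, n)) i j :
  (A + B) i j = A i j + B i j.
Proof. by rewrite mxE. Qed.

Lemma mxB_E (V : zmodType) m n (A B : 'M[V]_(m, n)) i j :
  (A - B) i j = A i j - B i j.
Proof. by rewrite !mxE. Qed.

(** * Minimum principle for a nonnegative matrix contracting a positive weight *)

Section weighted_contraction.
Context (R : realType) (d : nat) (M : 'M[R]_d) (h : 'cV[R]_d) (c : R).
Hypothesis M_ge0 : forall i j, 0 <= M i j.
Hypothesis h_gt0 : forall i, 0 < h i 0.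
Hypothesis Mh : forall i, (M *m h) i 0 <= c * h i 0.
Hypothesis c_lt1 : c < 1.

Lemma mulmx_ge0 (w : 'cV[R]_d) :
  (forall i, 0 <= w i 0) -> forall i, 0 <= (M *m w) i 0.
Proof. by move=> w0 i; rewrite mxE sumr_ge0// => j _; rewrite mulr_ge0. Qed.

Lemma ler_mulmx (v w : 'cV[R]_d) : (forall i, v i 0 <= w i 0) ->
  forall i, (M *m v) i 0 <= (M *m w) i 0.
Proof. by move=> vw i; rewrite !mxE ler_sum// => j _; rewrite ler_wpM2l. Qed.

(** At an index minimizing [w i 0 / h i 0], a negative minimum [f i] would give
    [f i * (M h)_i <= f i * h_i], hence [h_i <= (M h)_i <= c * h_i], against [c < 1]. Invertibility
    of [1 - M], positivity of its inverse and bounds on it all come from this principle. *)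
Lemma supersolution_ge0 (w : 'cV[R]_d) :
  (forall i, (M *m w) i 0 <= w i 0) -> forall i, 0 <= w i 0.
Proof.
move=> Mw; apply/forallP; apply: contraT; rewrite negb_forall => /existsP[i0 wi0].
pose f i := w i 0 / h i 0.
pose i := [arg min_(i < i0) f i]%O.
have fmin j : f i <= f j by rewrite /i; case: arg_minP => // k _; apply.
have fi0 : f i < 0.
  by rewrite (le_lt_trans (fmin i0))// /f pmulr_llt0 ?invr_gt0// ltNge.
have hw j : h j 0 * f i <= w j 0.
  by rewrite mulrC -ler_pdivlMr// fmin.
have : f i * (M *m h) i 0 <= w i 0.
  apply: le_trans (Mw i); rewrite !mxE mulr_sumr ler_sum// => j _.
  by rewrite mulrCA ler_wpM2l// mulrC.
have -> : w i 0 = f i * h i 0 by rewrite /f divfK// gt_eqF.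
rewrite ler_nM2l// => /le_trans/(_ (Mh i)).
by rewrite -subr_ge0 -{2}[h i 0]mul1r -mulrBl pmulr_lge0// subr_ge0 leNgt c_lt1.
Qed.

(** A kernel vector and its opposite are both supersolutions, so both are nonnegative. *)
Lemma unitmx_1B : (1%:M - M) \in unitmx.
Proof.
rewrite -unitmx_tr -row_free_unit -kermx_eq0.
apply/rowV0P => v /sub_kermxP vM.
have Mv : M *m v^T = v^T.
  apply/eqP; rewrite eq_sym -subr_eq0 -{1}[v^T]mul1mx -mulmxBl.
  by rewrite -[1%:M - M]trmxK -trmx_mul vM trmx0.
have v0 i : 0 <= v^T i 0 by apply: supersolution_ge0 => j; rewrite Mv.
have v1 i : 0 <= (- v^T) i 0.
  by apply: supersolution_ge0 => j; rewrite mulmxN Mv.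
apply/rowP => i; rewrite mxE; apply/eqP; rewrite eq_le.
by have := v0 i; have := v1 i; rewrite !mxE oppr_ge0 => -> ->.
Qed.

Lemma invmx_1BK (y : 'cV[R]_d) :
  M *m (invmx (1%:M - M) *m y) = invmx (1%:M - M) *m y - y.
Proof.
have := mulKVmx unitmx_1B y; rewrite mulmxBl mul1mx.
by move: (invmx _ *m y) => q <-; rewrite opprB addrC subrK.
Qed.

Lemma invmx_1B_ge0 (y : 'cV[R]_d) : (forall i, 0 <= y i 0) ->
  forall i, 0 <= (invmx (1%:M - M) *m y) i 0.
Proof.
move=> y0; apply: supersolution_ge0 => i.
by rewrite invmx_1BK !mxE lerBlDr lerDl.
Qed.

Lemma invmx_1B_le (y : 'cV[R]_d) (K : R) : 0 <= K -> (forall i, 1 <= h i 0) ->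
  (forall i, y i 0 <= K) ->
  forall i, (invmx (1%:M - M) *m y) i 0 <= K / (1 - c) * h i 0.
Proof.
move=> K0 h1 yK i.
(* The barrier [K / (1 - c) *: h] works because [(1 - M) h >= (1 - c) h >= 1 - c]. *)
suff : 0 <= ((K / (1 - c)) *: h - invmx (1%:M - M) *m y) i 0.
  by rewrite !mxE subr_ge0.
apply: supersolution_ge0 => {}i.
rewrite mulmxBr invmx_1BK -scalemxAr.
have := Mh i; have := h1 i; have := yK i.
move: (M *m h) => Mh'; move: (invmx _ *m y) => q.
rewrite !mxE => yi hi Mhi.
have c1 : 0 < 1 - c by rewrite subr_gt0.
have e1 : K / (1 - c) * Mh' i 0 <= K / (1 - c) * (c * h i 0).
  by rewrite ler_wpM2l// divr_ge0// ltW.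
have e2 : K / (1 - c) * h i 0 - K / (1 - c) * (c * h i 0) = K * h i 0.
  by field; rewrite gt_eqF.
have : K <= K * h i 0 by rewrite ler_peMr.
lra.
Qed.

End weighted_contraction.

(** * Weights and l1 bounds from the decay of the powers of M *)

Section geometric_decay.
Context (R : realType) (d : nat) (M : 'M[R]_d) (kappa rho : R).
Hypothesis M_ge0 : forall i j, 0 <= M i j.
Hypothesis M_decay : forall n i,
  (M ^+ n *m const_mx 1 : 'cV_d) i 0 <= kappa * rho ^+ n.

Lemma exprmx_ge0 n i j : 0 <= (M ^+ n) i j.
Proof.
elim: n i j => [|n IH] i j.
  by rewrite expr0 mxE; case: eqVneq; rewrite ?ler01.
by rewrite exprS mxE sumr_ge0// => k _; rewrite mulr_ge0.
Qed.

(** The weight is the resolvent series of [M] at [c], applied to the vector of ones and truncated at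
    [n0]. Telescoping gives [M h = c (h - e 0 + e n0)], and [n0] is large enough for
    [e n0 <= 1 = e 0]; the term of index 0 alone gives [h >= 1]. *)
Lemma weight_exists (c : R) (n0 : nat) : 0 < c -> (0 < n0)%N ->
  kappa * (rho / c) ^+ n0 <= 1 ->
  exists h : 'cV[R]_d, [/\ forall i, 1 <= h i 0,
    forall i, h i 0 <= \sum_(n < n0) kappa * (rho / c) ^+ n &
    forall i, (M *m h) i 0 <= c * h i 0].
Proof.
move=> c0 n00 kn0.
pose e n : 'cV[R]_d := c ^- n *: (M ^+ n *m const_mx 1).
have e_le n i : e n i 0 <= kappa * (rho / c) ^+ n.
  rewrite mxE expr_div_n mulrA [leRHS]mulrC.
  by rewrite ler_wpM2l// invr_ge0 exprn_ge0// ltW.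
have e_ge0 n i : 0 <= e n i 0.
  rewrite mxE mulr_ge0// ?invr_ge0 ?exprn_ge0 ?(ltW c0)// mxE sumr_ge0// => j _.
  by rewrite mulr_ge0// ?exprmx_ge0// mxE.
have e0 i : e 0%N i 0 = 1 by rewrite /e !expr0 invr1 scale1r mul1mx mxE.
exists (\sum_(n < n0) e n); split => [i|i|i].
- rewrite summxE; case: n0 n00 {kn0} => // n0 _.
  by rewrite big_ord_recl /= e0 lerDl sumr_ge0// => n _.
- by rewrite summxE ler_sum// => n _.
- rewrite mulmx_sumr.
  have -> : \sum_(n < n0) M *m e n = c *: \sum_(n < n0) e n.+1.
    rewrite scaler_sumr; apply: eq_bigr => n _.
    rewrite /e (exprS M) -[M * _]/(M *m _) -scalemxAr scalerA mulmxA (exprS c) invfM mulrA.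
    by rewrite divff ?gt_eqF// mul1r.
  rewrite mxE ler_pM2l// !summxE.
  have : \sum_(n < n0) e n.+1 i 0 + e 0%N i 0 = \sum_(n < n0) e n i 0 + e n0 i 0.
    rewrite -(big_mkord predT (fun n => e n i 0)).
    rewrite -(big_mkord predT (fun n => e n.+1 i 0)).
    by rewrite -big_nat_recr//= big_nat_recl// addrC.
  have := le_trans (e_le n0 i) kn0.
  by rewrite e0; lra.
Qed.

(** [M_decay] controls row sums, whereas the l1 norm sees column sums: each entry is bounded by its
    row sum, and a column of [d] entries costs the factor [d]. *)
Lemma sum_exprmx_le_decay (x : 'cV[R]_d) m : 0 <= kappa * rho ^+ m ->
  (forall i, 0 <= x i 0) ->
  \sum_i (M ^+ m *m x) i 0 <= d%:R * (kappa * rho ^+ m) * \sum_i x i 0.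
Proof.
move=> kr x0.
have entry i j : (M ^+ m) i j <= kappa * rho ^+ m.
  apply: le_trans (M_decay m i); rewrite mxE (bigD1 j)//= mxE mulr1 lerDl.
  by rewrite sumr_ge0// => k _; rewrite mxE mulr1 exprmx_ge0.
rewrite -mulrA mulr_natl.
apply: (@le_trans _ _ (\sum_(i < d) (kappa * rho ^+ m) * \sum_i x i 0)).
  apply: ler_sum => i _; rewrite mxE mulr_sumr ler_sum// => j _.
  by rewrite ler_wpM2r.
by rewrite sumr_const card_ord.
Qed.

Lemma sum_exprmx_le (x : 'cV[R]_d) m : (forall j, \sum_i M i j <= 1) ->
  (forall i, 0 <= x i 0) -> \sum_i (M ^+ m *m x) i 0 <= \sum_i x i 0.
Proof.
move=> M1 x0; elim: m => [|m IH]; first by rewrite expr0 mul1mx.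
apply: le_trans IH; rewrite exprS -[_ * _]/(M *m _) -mulmxA.
have : forall i, 0 <= (M ^+ m *m x) i 0.
  by move=> i; rewrite mxE sumr_ge0// => j _; rewrite mulr_ge0// exprmx_ge0.
move: (M ^+ m *m x) => y y0.
under eq_bigr do rewrite mxE.
rewrite exchange_big/= ler_sum// => j _.
by rewrite -mulr_suml ler_piMl.
Qed.

End geometric_decay.

(** * One-dimensional Skorokhod reflection and its comparison principle *)

Section regulator.
Context (R : realType).

(** The explicit regulator of the one-dimensional Skorokhod problem with netput [y]. *)
Definition regulator (y : R -> R) (t : R) : R :=
  sup [set Num.max 0 (- y s) | s in `[0, t]].

Lemma regulator_le (y : R -> R) (t K : R) : 0 <= t -> 0 <= K ->
  (forall s, 0 <= s <= t -> - y s <= K) -> regulator y t <= K.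
Proof.
move=> t0 K0 yK; apply: ge_sup.
  by exists (Num.max 0 (- y 0)); exists 0 => //=; rewrite in_itv/= lexx.
by move=> z /= [s]; rewrite in_itv/= => s0t <-; rewrite ge_max K0 yK.
Qed.

Lemma le_regulator (y : R -> R) (t K s : R) :
  (forall s, 0 <= s <= t -> - y s <= K) -> 0 <= s <= t ->
  Num.max 0 (- y s) <= regulator y t.
Proof.
move=> yK s0t; apply: ub_le_sup; last by exists s => //=; rewrite in_itv.
exists (Num.max 0 K) => z /= [r]; rewrite in_itv/= => r0t <-.
by rewrite ge_max le_max lexx/= le_max yK// orbT.
Qed.

(* Adding a nonnegative nondecreasing input to the netput raises the reflected
   path and leaves the regulator with smaller increments. *)
Lemma regulator_comparison (T : R) (w x l a : R -> R) :
  (forall t : R, 0 <= t -> x t = w t + l t) ->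
  (forall t : R, 0 <= t -> 0 <= x t) ->
  (forall s t : R, 0 <= s -> s <= t -> l s <= l t) -> 0 <= l 0 ->
  (forall s t : R, 0 <= s -> s <= t -> l s < l t ->
    exists r, [/\ s <= r, r <= t, x r = 0 & l r = l t]) ->
  0 <= a 0 -> (forall s t : R, 0 <= s -> s <= t -> t <= T -> a s <= a t) ->
  let g := regulator (fun t => w t - a t) in
  [/\ forall t : R, 0 <= t -> t <= T -> 0 <= w t - a t + g t <= x t,
      forall t : R, 0 <= t -> t <= T -> 0 <= g t &
      forall s t : R, 0 <= s -> s <= t -> t <= T -> g s - l s <= g t - l t].
Proof.
move=> xE x0 lmono l0 hit a0 amono g.
have l_ge0 t : 0 <= t -> 0 <= l t by move=> t0; apply: le_trans l0 (lmono _ _ _ _).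
have a_ge0 t : 0 <= t -> t <= T -> 0 <= a t.
  by move=> t0 tT; apply: le_trans a0 (amono _ _ _ _ _).
have yle t : 0 <= t -> t <= T ->
    forall s, 0 <= s <= t -> - (w s - a s) <= l t + a t.
  move=> t0 tT s /andP[s0 st].
  by have := xE _ s0; have := x0 _ s0; have := lmono _ _ s0 st; have := amono _ _ s0 st tT; lra.
have yg t : 0 <= t -> t <= T ->
    forall s, 0 <= s <= t -> Num.max 0 (- (w s - a s)) <= g t.
  by move=> t0 tT s; apply: le_regulator; exact: yle.
have gle t : 0 <= t -> t <= T -> g t <= l t + a t.
  by move=> t0 tT; apply: regulator_le; rewrite ?addr_ge0 ?l_ge0 ?a_ge0//; exact: yle.
split => [t t0 tT|t t0 tT|s t s0 st tT].
- have := yg t t0 tT t; rewrite t0 lexx => /(_ isT).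
  by rewrite ge_max => /andP[_]; have := gle t t0 tT; have := xE _ t0; lra.
- have := yg t t0 tT t; rewrite t0 lexx => /(_ isT).
  by rewrite ge_max => /andP[].
have t0 := le_trans s0 st; have sT := le_trans st tT.
have [lst|lst] := ltP (l s) (l t); last first.
  suff : g s <= g t by have := lmono _ _ s0 st; lra.
  apply: regulator_le => //.
    have := yg t t0 tT t; rewrite t0 lexx => /(_ isT).
    by rewrite ge_max => /andP[].
  move=> u /andP[u0 us]; have := yg t t0 tT u.
  by rewrite u0 (le_trans us st) => /(_ isT); rewrite ge_max => /andP[].
(* At this zero of [x] one has [w r = - l t], hence [g t >= l t + a r], while [g s <= l s + a s] and
   [a s <= a r]. *)
have [r [sr rt xr0 lr]] := hit _ _ s0 st lst.
have r0 := le_trans s0 sr; have rT := le_trans rt tT.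
have := yg t t0 tT r; rewrite r0 rt => /(_ isT); rewrite ge_max => /andP[_].
have := xE _ r0; have := gle s s0 sT; have := amono _ _ s0 sr rT.
by rewrite xr0 lr; lra.
Qed.

End regulator.

(** Complementarity enters as the order statement [sp_hit]: if a coordinate of the regulator grows
    on [[s, t]], the path has a zero there after which that coordinate stays constant up to [t]. *)
Record skorokhod_pair (R : realType) (d : nat) (M : 'M[R]_d)
    (w x l : R -> 'cV[R]_d) : Prop := {
  sp_ge0 : forall (t : R) i, 0 <= t -> 0 <= x t i 0 ;
  sp_eq : forall t : R, 0 <= t -> x t = w t + l t - M *m l t ;
  sp_mono : forall (s t : R) i, 0 <= s -> s <= t -> l s i 0 <= l t i 0 ;
  sp_start : l 0 = 0 ;
  sp_hit : forall (s t : R) i, 0 <= s -> s <= t -> l s i 0 < l t i 0 ->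
    exists r, [/\ s <= r, r <= t, x r i 0 = 0 & l r i 0 = l t i 0] }.

(** * A common minorant of two reflected paths with the same noise *)

Section common_minorant.
Context (R : realType) (d : nat) (M : 'M[R]_d) (W : R -> 'cV[R]_d) (T : R).
Hypothesis M_ge0 : forall i j, 0 <= M i j.
Hypothesis T_ge0 : 0 <= T.

Definition regulator_step (l : R -> 'cV[R]_d) (t : R) : 'cV[R]_d :=
  \col_i regulator (fun s => (W s - M *m l s) i 0) t.

(** The increments of [k] exceed those of [l]. The netput of the minorant is [W] alone, and a
    positive [k 0] acts as an initial push which stands for the initial position. *)
Definition dominates (l k : R -> 'cV[R]_d) :=
  (forall i, 0 <= k 0 i 0) /\
  forall (s t : R) i, 0 <= s -> s <= t -> t <= T ->
    (k s - l s) i 0 <= (k t - l t) i 0.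

(** With [a = x0 + M (k - l)], the netput [W - M k] is [x0 + W - M l] lowered by [a], which is
    nondecreasing because [M >= 0]. Each coordinate is then a case of [regulator_comparison]. *)
Lemma regulator_step_dominates (x0 : 'cV[R]_d) (x l k : R -> 'cV[R]_d) :
  (forall i, 0 <= x0 i 0) -> skorokhod_pair M (fun t => x0 + W t) x l ->
  dominates l k ->
  dominates l (regulator_step k) /\
  forall (t : R) i, 0 <= t -> t <= T ->
    0 <= (W t + regulator_step k t - M *m k t) i 0 <= x t i 0.
Proof.
move=> x0_ge0 [xge0 xE lmono l0 hit] [k0 kl].
pose a i t := x0 i 0 + (M *m (k t - l t)) i 0.
have key i : let g := fun t => regulator_step k t i 0 in
  [/\ forall t : R, 0 <= t -> t <= T -> 0 <= (W t - M *m k t) i 0 + g t <= x t i 0,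
      forall t : R, 0 <= t -> t <= T -> 0 <= g t &
      forall s t : R, 0 <= s -> s <= t -> t <= T ->
        g s - l s i 0 <= g t - l t i 0].
  have wE t : (W t - M *m k t) i 0 = (x0 + W t - M *m l t) i 0 - a i t.
    by rewrite /a mulmxBr !mxE; ring.
  have -> : (fun t => regulator_step k t i 0)
      = regulator (fun t => (x0 + W t - M *m l t) i 0 - a i t).
    by apply/funext => t; rewrite mxE; congr (regulator _ t); apply/funext.
  have [] := @regulator_comparison R T (fun t => (x0 + W t - M *m l t) i 0)
    (fun t => x t i 0) (fun t => l t i 0) (a i).
  - by move=> t t0; rewrite xE// !mxE; ring.
  - by move=> t; exact: xge0.
  - by move=> s t; exact: lmono.
  - by rewrite l0 mxE.
  - by move=> s t; exact: hit.
  - by rewrite /a addr_ge0// l0 subr0 mulmx_ge0.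
  - move=> s t s0 st tT; rewrite /a lerD2l ler_mulmx// => j.
    exact: kl.
  by move=> h1 h2 h3; split=> // t t0 tT; rewrite wE h1.
split; first split=> [i|s t i s0 st tT].
- by have [_ h _] := key i; exact: h.
- by have [_ _ h] := key i; have := h s t s0 st tT; rewrite !mxE.
move=> t i t0 tT; have [h _ _] := key i.
by have := h t t0 tT; rewrite !mxE addrAC.
Qed.

(** The bound [K] makes the set behind the regulator for [k] bounded; the [sup] of an unbounded set
    of reals is a default value. *)
Lemma regulator_step_le (l k : R -> 'cV[R]_d) (K : R -> 'cV[R]_d) :
  (forall (t : R) i, 0 <= t -> t <= T -> 0 <= regulator_step k t i 0) ->
  (forall (t s : R) i, 0 <= s -> s <= t -> t <= T -> (M *m k s - W s) i 0 <= K t i 0) ->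
  (forall (t : R) i, 0 <= t -> t <= T -> l t i 0 <= k t i 0) ->
  forall (t : R) i, 0 <= t -> t <= T -> regulator_step l t i 0 <= regulator_step k t i 0.
Proof.
move=> k0 kK lk t i t0 tT; rewrite mxE; apply: regulator_le => //.
  exact: k0.
move=> s /andP[s0 st].
have : Num.max 0 (- (W s - M *m k s) i 0) <= regulator_step k t i 0.
  rewrite [leRHS]mxE.
  apply: (@le_regulator _ (fun s => (W s - M *m k s) i 0) t (K t i 0)).
    move=> u /andP[u0 ut].
    by have := kK t u i u0 ut tT; rewrite !mxE; lra.
  by rewrite s0 st.
rewrite ge_max => /andP[_]; apply: le_trans.
have : (M *m l s) i 0 <= (M *m k s) i 0.
  by apply: ler_mulmx => // j; apply: lk => //; exact: le_trans st tT.
by rewrite !mxE; lra.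
Qed.

(* The limit of the decreasing iteration [l |-> regulator_step l] started above both
   regulators; [regulator_step] keeps [l - lx] and [l - ly] nondecreasing. *)
Lemma common_minorant (h : 'cV[R]_d) (c : R) (x0 y0 : 'cV[R]_d)
    (x y lx ly : R -> 'cV[R]_d) :
  (forall i, 0 < h i 0) -> (forall i, (M *m h) i 0 <= c * h i 0) -> c < 1 ->
  (forall i, 0 <= x0 i 0) -> (forall i, 0 <= y0 i 0) ->
  skorokhod_pair M (fun t => x0 + W t) x lx ->
  skorokhod_pair M (fun t => y0 + W t) y ly ->
  exists z l : R -> 'cV[R]_d,
  [/\ forall (t : R) i, 0 <= t -> t <= T ->
        [/\ 0 <= z t i 0, z t i 0 <= x t i 0 & z t i 0 <= y t i 0],
      forall t : R, 0 <= t -> t <= T -> z t = W t + l t - M *m l t,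
      dominates lx l & dominates ly l].
Proof.
move=> h0 Mh c1 x0_ge0 y0_ge0 px py.
have ly_ge0 t i : 0 <= t -> 0 <= ly t i 0.
  by move=> t0; have := sp_mono py i (lexx 0) t0; rewrite (sp_start py) mxE.
have lx_ge0 t i : 0 <= t -> 0 <= lx t i 0.
  by move=> t0; have := sp_mono px i (lexx 0) t0; rewrite (sp_start px) mxE.
(* This constant makes [k0 = lx + ly + cst] satisfy [regulator_step k0 <= k0]: [(1 - M) cst]
   compensates [x0] and the term [M ly s], which is at most [M ly T] on the finite horizon. *)
have [cst [cst_ge0 McE]] : exists cst : 'cV[R]_d, (forall i, 0 <= cst i 0) /\
    M *m cst = cst - (x0 + M *m ly T).
  exists (invmx (1%:M - M) *m (x0 + M *m ly T)).
  split; last exact: (invmx_1BK M_ge0 h0 Mh c1).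
  apply: (invmx_1B_ge0 M_ge0 h0 Mh c1) => j; rewrite mxE addr_ge0// mulmx_ge0//.
  by move=> i; exact: ly_ge0.
pose k0 t := lx t + ly t + cst.
pose k n := iter n regulator_step k0.
have dom0x : dominates lx k0.
  split=> [i|s t i s0 st tT]; first by rewrite !mxE !addr_ge0 ?lx_ge0 ?ly_ge0.
  by have := sp_mono py i s0 st; rewrite !mxE; lra.
have dom0y : dominates ly k0.
  split=> [i|s t i s0 st tT]; first by rewrite !mxE !addr_ge0 ?lx_ge0 ?ly_ge0.
  by have := sp_mono px i s0 st; rewrite !mxE; lra.
have domx n : dominates lx (k n).
  by elim: n => //= n IH; have [] := regulator_step_dominates x0_ge0 px IH.
have domy n : dominates ly (k n).
  by elim: n => //= n IH; have [] := regulator_step_dominates y0_ge0 py IH.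
have boundx n t i : 0 <= t -> t <= T ->
    0 <= (W t + k n.+1 t - M *m k n t) i 0 <= x t i 0.
  have [_ bnd] := regulator_step_dominates x0_ge0 px (domx n); exact: bnd.
have boundy n t i : 0 <= t -> t <= T ->
    0 <= (W t + k n.+1 t - M *m k n t) i 0 <= y t i 0.
  have [_ bnd] := regulator_step_dominates y0_ge0 py (domy n); exact: bnd.
have k_ge0 n t i : 0 <= t -> t <= T -> 0 <= k n t i 0.
  move=> t_0 tT; have [kn0 kn] := domx n.
  have := kn 0 t i (lexx 0) t_0 tT; rewrite (sp_start px) subr0.
  by have := kn0 i; have := lx_ge0 t i t_0; rewrite !mxE; lra.
have k1 t i : 0 <= t -> t <= T -> k 1%N t i 0 <= k 0%N t i 0.
  move=> t_0 tT; rewrite /= mxE; apply: regulator_le => //.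
    exact: (k_ge0 0%N).
  move=> s /andP[s0 st].
  have sT := le_trans st tT.
  have : (M *m ly s) i 0 <= (M *m ly T) i 0.
    by apply: ler_mulmx => // j; exact: (sp_mono py).
  have := sp_ge0 px i s0; rewrite (sp_eq px s0) /k0 !mulmxDr McE.
  have := sp_mono px i s0 st; have := sp_mono py i s0 st.
  have := ly_ge0 s i s0; rewrite !mxE.
  lra.
(* The bound asked by [regulator_step_le] is [k n.+1] itself: the path of stage [n] is nonnegative,
   so [M k_n - W <= k_(n+1)], and [k n.+1] is nondecreasing in time. *)
have kS n t i : 0 <= t -> t <= T -> k n.+1 t i 0 <= k n t i 0.
  elim: n t i => [|n IH] t i t_0 tT; first exact: k1.
  apply: (@regulator_step_le (k n.+1) (k n) (fun t => k n.+1 t)) => //.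
    by move=> *; exact: (k_ge0 n.+1).
  move=> u s j s0 su uT.
  have := boundx n s j s0 (le_trans su uT) => /andP[+ _].
  have [_ kn] := domx n.+1; have := kn s u j s0 su uT.
  have := sp_mono px j s0 su.
  move: (k n.+1) (k n) => k' k''; rewrite !mxE.
  lra.
pose l t : 'cV[R]_d := \col_i inf [set k n t i 0 | n in [set: nat]].
have kl t i : 0 <= t -> t <= T -> (fun n => k n t i 0) @ \oo --> l t i 0.
  move=> t_0 tT; rewrite mxE; apply: nonincreasing_cvgn.
    by apply/nonincreasing_seqP => n; exact: kS.
  by exists 0 => _ [n _ <-]; exact: k_ge0.
pose z t := W t + l t - M *m l t.
have zE t i : 0 <= t -> t <= T ->
    (fun n => (W t + k n.+1 t - M *m k n t) i 0) @ \oo --> z t i 0.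
  move=> t_0 tT; rewrite /z.
  have colE (u v : R -> 'cV[R]_d) :
      (W t + u t - M *m v t) i 0 = W t i 0 + u t i 0 - \sum_j M i j * v t j 0.
    by rewrite !mxE.
  rewrite (_ : (fun n => _) =
    (fun n => W t i 0 + k n.+1 t i 0 - \sum_j M i j * k n t j 0)); last first.
    by apply/funext => n; rewrite colE.
  rewrite colE.
  apply: cvgB; first apply: cvgD; first exact: cvg_cst.
    by have := kl t i t_0 tT; rewrite -(cvg_shiftS (fun n => k n t i 0)).
  apply: cvg_big => [|j _]; first exact: add_continuous.
  by apply: cvgMl_tmp; exact: kl.
have subE (p q : 'cV[R]_d) i : (p - q) i 0 = p i 0 - q i 0 by rewrite !mxE.
have kl_dom v : (forall n, dominates v (k n)) -> dominates v l.
  move=> dom; split=> [i|s t i s0 st tT].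
    apply: (cvgr_to_ge (kl 0 i (lexx 0) T_ge0)); apply: nearW => n.
    by have [] := dom n.
  have cvgB' u : 0 <= u -> u <= T ->
      (fun n => k n u i 0 - v u i 0) @ \oo --> (l u - v u) i 0.
    move=> u0 uT; rewrite subE.
    by apply: cvgB; [exact: kl|exact: cvg_cst].
  apply: (ler_cvg_to (cvgB' s s0 (le_trans st tT)) (cvgB' t (le_trans s0 st) tT)).
  apply: nearW => n; have [_] := dom n.
  by move=> /(_ s t i s0 st tT); rewrite !subE.
exists z, l; split=> //; [|exact: kl_dom|exact: kl_dom].
move=> t i t_0 tT; split.
- apply: (cvgr_to_ge (zE t i t_0 tT)); apply: nearW => n.
  by have /andP[] := boundx n t i t_0 tT.
- apply: (cvgr_to_le (zE t i t_0 tT)); apply: nearW => n.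
  by have /andP[] := boundx n t i t_0 tT.
- apply: (cvgr_to_le (zE t i t_0 tT)); apply: nearW => n.
  by have /andP[] := boundy n t i t_0 tT.
Qed.

End common_minorant.

(** * Contraction of the gap over good blocks *)

Section contraction.
Context (R : realType) (d : nat) (M : 'M[R]_d) (h : 'cV[R]_d) (c T : R).
Context (x0 : 'cV[R]_d) (W x lx z l : R -> 'cV[R]_d).
Hypothesis M_ge0 : forall i j, 0 <= M i j.
Hypothesis M_col : forall j, \sum_i M i j <= 1.
Hypothesis h_gt0 : forall i, 0 < h i 0.
Hypothesis Mh : forall i, (M *m h) i 0 <= c * h i 0.
Hypothesis c_lt1 : c < 1.
Hypothesis T_ge0 : 0 <= T.
Hypothesis px : skorokhod_pair M (fun t => x0 + W t) x lx.
Hypothesis zE : forall t : R, 0 <= t -> t <= T -> z t = W t + l t - M *m l t.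
Hypothesis lx_l : dominates T lx l.
Hypothesis zx : forall (t : R) i, 0 <= t -> t <= T -> 0 <= z t i 0 <= x t i 0.

(** By [gapE] this is [R^-1 (x - z)]; written through the regulators, its monotonicity in time is
    exactly [dominates]. *)
Let q t := invmx (1%:M - M) *m x0 - (l t - lx t).

Let gapE t : 0 <= t -> t <= T -> x t - z t = q t - M *m q t.
Proof.
move=> t0 tT; rewrite /q (zE t0 tT) (sp_eq px t0)/= !mulmxBr.
rewrite (invmx_1BK M_ge0 h_gt0 Mh c_lt1).
by apply/colP => i; rewrite ![in LHS]mxE ![in RHS]mxE; ring.
Qed.

Let q_mono (s t : R) i : 0 <= s -> s <= t -> t <= T -> q t i 0 <= q s i 0.
Proof.
move=> s0 st tT; rewrite /q !(mxB_E (invmx _ *m x0)) lerB//.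
by case: lx_l => _; exact.
Qed.

(** In a good block each coordinate has its own zero [r] of [x]; there [z] vanishes too, so
    [q_i(r) = (M q(r))_i]. As [q] is nonincreasing, the different times combine into
    [q (tau k.+1) <= M q (tau k)]. *)
Lemma gap_contraction (tau : nat -> R) (good : pred nat) (n : nat) :
  0 <= tau 0%N -> (forall k, tau k <= tau k.+1) -> tau n <= T ->
  (forall k, (k < n)%N -> good k -> forall i, exists r,
     [/\ tau k <= r, r <= tau k.+1 & x r i 0 = 0]) ->
  norm1 (x T - z T) <= \sum_i (M ^+ (\sum_(k < n) good k) *m x0) i 0.
Proof.
move=> tau0 tauS tauT hit.
have tau_mono : {homo tau : j k / (j <= k)%N >-> j <= k}.
  exact: (homo_leq _ le_trans).
have tau_ge0 k : 0 <= tau k by apply: le_trans tau0 (tau_mono _ _ _).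
pose v := invmx (1%:M - M) *m x0.
have qv k : (k <= n)%N ->
    forall i, q (tau k) i 0 <= (M ^+ (\sum_(j < k) good j) *m v) i 0.
  elim: k => [|k IH] kn i.
    rewrite big_ord0 expr0 mul1mx /q mxB_E lerBlDr lerDl mxB_E.
    have := tau_mono _ _ (leq0n n) => /le_trans/(_ tauT) tau0T.
    have [l0] := lx_l; move=> /(_ 0 (tau 0%N) i (lexx 0) tau0 tau0T).
    by rewrite mxB_E (sp_start px) mxE subr0 => /(le_trans (l0 i)); rewrite mxB_E.
  have kT : tau k.+1 <= T by apply: le_trans tauT; exact: tau_mono.
  rewrite big_ord_recr/=; case: (boolP (good k)) => gk; last first.
    rewrite addn0; apply: le_trans (IH (ltnW kn) i).
    exact: q_mono.
  rewrite addn1 exprS -[_ * _]/(M *m _) -mulmxA.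
  have [r [kr rk xr]] := hit k kn gk i.
  have r0 := le_trans (tau_ge0 k) kr; have rT := le_trans rk kT.
  apply: (@le_trans _ _ (q r i 0)); first exact: q_mono.
  apply: (@le_trans _ _ ((M *m q r) i 0)).
    have := congr1 (fun u : 'cV_d => u i 0) (gapE r0 rT).
    by have /andP[] := zx i r0 rT; rewrite !mxB_E xr; lra.
  apply: ler_mulmx => // j; apply: le_trans (IH (ltnW kn) j).
  exact: q_mono.
set m := (\sum_(k < n) good k)%N.
have -> : norm1 (x T - z T) = \sum_i (q T - M *m q T) i 0.
  apply: eq_bigr => i _; rewrite -gapE// ger0_norm// mxB_E subr_ge0.
  by have /andP[] := zx i T_ge0 (lexx T).
have -> : M ^+ m *m x0 = M ^+ m *m v - M *m (M ^+ m *m v).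
  rewrite mulmxA -[M *m M ^+ m]/(M * M ^+ m) -exprS exprSr.
  rewrite -[_ * M]/(_ *m M) -mulmxA (invmx_1BK M_ge0 h_gt0 Mh c_lt1) mulmxBr.
  by rewrite opprB addrC subrK.
(* The operator [1 - M] need not preserve order, but the sum of the entries of [u - M u] is monotone
   in [u], since column sums of [M] are at most 1. The bound on [q] thus passes to the total gap. *)
have sumE (u : 'cV[R]_d) :
    \sum_i (u - M *m u) i 0 = \sum_j (1 - \sum_i M i j) * u j 0.
  under eq_bigr do rewrite mxB_E.
  rewrite sumrB; under [X in _ - X]eq_bigr do rewrite mxE.
  rewrite exchange_big/= -sumrB; apply: eq_bigr => j _.
  by rewrite -mulr_suml mulrBl mul1r.
rewrite !sumE ler_sum// => j _; rewrite ler_wpM2l ?subr_ge0//.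
by apply: le_trans (qv n (leqnn n) j); exact: q_mono.
Qed.

End contraction.

(** * From complementarity integrals to hitting times *)

Lemma within_continuousP (R : realType) (f : R -> R) :
  {within `[0, +oo[, continuous f} -> forall r e : R, 0 <= r -> 0 < e ->
  exists2 del : R, 0 < del &
    forall u : R, 0 <= u -> `|u - r| < del -> `|f u - f r| < e.
Proof.
move=> /subspace_continuousP cf r e r0 e0.
have := cf r; rewrite /= in_itv/= r0 => /(_ isT) /cvgrPdist_lt/(_ e e0).
rewrite near_withinE => /nbhs_ballP[del/= del0 H]; exists del => // u u0 ur.
rewrite distrC; apply: H; first by rewrite /ball/= distrC.
by rewrite /= in_itv/= u0.
Qed.

Lemma lebesgue_stieltjes_itv_oc (R : realType) (F : cumulative R R) (a b : R) :
  a <= b -> lebesgue_stieltjes_measure F `]a, b] = (F b - F a)%:E.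
Proof.
move=> ab; rewrite /lebesgue_stieltjes_measure /measure_extension.
rewrite measurable_mu_extE/=; last exact: is_ocitv.
by rewrite wlength_itv_bnd.
Qed.

(** Let [r] be the supremum of the times [u] with [l u < l t]; continuity gives [l r = l t]. If
    [x r > 0], then [x >= x r / 2] on some []v, r]], an interval of positive mass for [dl], and the
    integral cannot vanish. *)
Lemma complementarity_hit (R : realType) (x l : R -> R) (F : cumulative R R) :
  {within `[0, +oo[, continuous x} -> {within `[0, +oo[, continuous l} ->
  (forall t : R, 0 <= t -> 0 <= x t) ->
  (forall s t : R, 0 <= s -> s <= t -> l s <= l t) ->
  (forall s, F s = l (Num.max 0 s)) ->
  (forall t : R, 0 < t ->
    (\int[lebesgue_stieltjes_measure F]_(s in `[0%R, t]) (x s)%:E = 0)%E) ->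
  forall s t : R, 0 <= s -> s <= t -> l s < l t ->
    exists r, [/\ s <= r, r <= t, x r = 0 & l r = l t].
Proof.
move=> cx cl x_ge0 lmono FE int0 s t s0 st lst.
pose A := [set u | s <= u <= t /\ l u < l t].
have As : A s by rewrite /A/= lexx.
have Aub : has_ubound A by exists t => u [/andP[]].
have supA : has_sup A by split; [exists s|].
pose r := sup A.
have sr : s <= r by exact: ub_le_sup.
have rt : r <= t by apply: ge_sup; [exists s|move=> u [/andP[]]].
have r0 := le_trans s0 sr; have t0 := le_trans r0 rt.
have lr : l r = l t.
  apply/eqP; rewrite eq_le lmono//= leNgt; apply/negP => lrt.
  have rtlt : r < t by rewrite lt_neqAle rt andbT; apply: contraTneq lrt => ->; rewrite ltxx.
  have e0 : 0 < l t - l r by rewrite subr_gt0.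
  have [del del0 H] := within_continuousP cl r0 e0.
  pose u := Num.min t (r + del / 2).
  have ru : r < u by rewrite lt_min rtlt ltrDl divr_gt0.
  have ut : u <= t by rewrite ge_min lexx.
  have : u <= r.
    apply: ub_le_sup => //; split; first by rewrite (le_trans sr (ltW ru)).
    have ur : u - r < del.
      by rewrite ltrBlDl gt_min; apply/orP; right; rewrite ltrD2l ltr_pdivrMr// ltr_pMr// ltr1n.
    have := H u (le_trans r0 (ltW ru)); rewrite gtr0_norm ?subr_gt0// => /(_ ur).
    by move=> /ltr_normlW; lra.
  by rewrite leNgt ru.
exists r; split=> //; apply/eqP; rewrite eq_le x_ge0// andbT leNgt; apply/negP => xr.
have srlt : s < r.
  rewrite lt_neqAle sr andbT; apply/eqP => srE.
  by move: lst; rewrite srE lr ltxx.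
have e0 : 0 < x r / 2 by rewrite divr_gt0.
have [del del0 H] := within_continuousP cx r0 e0.
pose v := Num.max s (r - del / 2).
have vr : v < r by rewrite gt_max srlt ltrBlDr ltrDl divr_gt0.
have sv : s <= v by rewrite le_max lexx.
have v0 := le_trans s0 sv.
have lvr : l v < l t.
  have rv : 0 < r - v by rewrite subr_gt0.
  have [u Au] := sup_adherent rv supA; rewrite -/r opprB addrC subrK => vu.
  have [/andP[su _] lut] := Au.
  by rewrite (le_lt_trans _ lut)// lmono// ltW.
have xge u : v < u -> u <= r -> x r / 2 <= x u.
  move=> vu ur.
  have : `|u - r| < del.
    rewrite ler0_norm ?subr_le0// opprB ltrBlDr.
    have : r - del / 2 < u by apply: le_lt_trans vu; rewrite le_max lexx orbT.
    by lra.
  move=> /(H u (le_trans v0 (ltW vu))); rewrite distrC => /ltr_normlW; lra.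
have tgt0 : 0 < t by apply: lt_le_trans rt; exact: le_lt_trans s0 srlt.
have mx : measurable_fun `[0, t] (EFin \o x).
  apply/measurable_EFinP.
  apply: subspace_continuous_measurable_fun; first exact: measurable_itv.
  apply: continuous_subspaceW cx => u /=; rewrite !in_itv/= andbT.
  by case/andP.
have := int0 t tgt0; apply/eqP; rewrite gt_eqF//.
apply: (@lt_le_trans _ _
  (\int[lebesgue_stieltjes_measure F]_(u in `]v, r]) (cst (x r / 2)%:E u))%E).
  rewrite integral_cst//.
  rewrite [X in (_ * X)%E](_ : _ = (F r - F v)%:E); last first.
    by apply: lebesgue_stieltjes_itv_oc; exact: ltW.
  rewrite -EFinM lte_fin mulr_gt0//.
  by rewrite !FE (max_idPr v0) (max_idPr r0) lr subr_gt0.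
apply: (@le_trans _ _
  (\int[lebesgue_stieltjes_measure F]_(u in `]v, r]) (x u)%:E)%E).
  apply: ge0_le_integral => //=; try exact: measurable_itv.
  - by move=> u _; rewrite lee_fin ltW.
  - apply: measurable_funS mx; first exact: measurable_itv.
    move=> u /=; rewrite !in_itv/= => /andP[vu ur].
    by rewrite (le_trans v0 (ltW vu)) (le_trans ur rt).
  - by move=> u; rewrite in_itv/= => /andP[vu ur]; rewrite lee_fin xge.
apply: ge0_subset_integral => //=; try exact: measurable_itv.
- by move=> u; rewrite in_itv/= => /andP[u0 _]; rewrite lee_fin x_ge0.
- move=> u /=; rewrite !in_itv/= => /andP[vu ur].
  by rewrite (le_trans v0 (ltW vu)) (le_trans ur rt).
Qed.
Lemma reflected_path_skorokhod (R : realType) (d : nat) (Rf : 'M[R]_d)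
    (y x l : R -> 'cV[R]_d) :
  reflected_path Rf y x l -> skorokhod_pair (1%:M - Rf) y x l.
Proof.
move=> [cx x_ge0 xE cl lmono l0 compl].
have coord (f : R -> 'cV[R]_d) i : {within `[0, +oo[, continuous f} ->
    {within `[0, +oo[, continuous (fun t => f t i 0)}.
  move=> cf; apply: (@within_continuous_comp _ _ _ _ f (fun v : 'cV[R]_d => v i 0)) => //.
  by move=> v _; exact: coord_continuous.
split=> //.
- by move=> t i t0; exact: x_ge0.
- by move=> t t0; rewrite xE// mulmxBl mul1mx opprB addrA addrAC addrK.
- move=> s t i s0 st lst; have [F FE int0] := compl i.
  apply: (@complementarity_hit R (fun t => x t i 0) (fun t => l t i 0) F) => //.
  + exact: coord.
  + exact: coord.
  + by move=> u u0; exact: x_ge0.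
  + by move=> u v; exact: lmono.
Qed.

(** * The weighted maximum of R^-1 X over one time block *)

Section lyapunov.
Context (R : realType) (d : nat) (M : 'M[R]_d) (h : 'cV[R]_d) (gam Ch : R).

Definition weighted_max (q : 'cV[R]_d) : R := \big[Num.max/0]_i (q i 0 / h i 0).

Hypothesis h_ge1 : forall i, 1 <= h i 0.

Lemma weighted_max_ge0 (q : 'cV[R]_d) : 0 <= weighted_max q.
Proof. exact: bigmax_ge_id. Qed.

Lemma le_weighted_max (q : 'cV[R]_d) i : q i 0 <= weighted_max q * h i 0.
Proof.
rewrite -ler_pdivrMr ?(lt_le_trans ltr01 (h_ge1 i))//.
exact: (le_bigmax _ (fun i => q i 0 / h i 0) i).
Qed.

Lemma weighted_max_le (q : 'cV[R]_d) (K : R) : 0 <= K -> (forall i, q i 0 <= K * h i 0) ->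
  weighted_max q <= K.
Proof.
move=> K0 qK; apply: bigmax_le => // i _.
by rewrite ler_pdivrMr ?(lt_le_trans ltr01 (h_ge1 i)).
Qed.

Hypothesis h_le : forall i, h i 0 <= Ch.
Hypothesis M_ge0 : forall i j, 0 <= M i j.
Hypothesis Mh : forall i, (M *m h) i 0 <= (1 - gam) * h i 0.
Hypothesis gam_gt0 : 0 < gam.
Hypothesis gam_lt1 : gam < 1.

Context (del : R) (Q N x l : R -> 'cV[R]_d).
Hypothesis del_gt0 : 0 < del.
Hypothesis Q_ge0 : forall (t : R) i, 0 <= t -> 0 <= Q t i 0.
Hypothesis Q_zero : forall (t : R) i, 0 <= t -> x t i 0 = 0 ->
  Q t i 0 <= (M *m Q t) i 0.
Hypothesis Q_incr : forall (u v : R) i, 0 <= u -> u <= v ->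
  Q v i 0 <= Q u i 0 + (N v i 0 - N u i 0) - del * (v - u) + (l v i 0 - l u i 0).
Hypothesis l_mono : forall (s t : R) i, 0 <= s -> s <= t -> l s i 0 <= l t i 0.
Hypothesis l_hit : forall (s t : R) i, 0 <= s -> s <= t -> l s i 0 < l t i 0 ->
  exists r, [/\ s <= r, r <= t, x r i 0 = 0 & l r i 0 = l t i 0].

Local Notation V t := (weighted_max (Q t)).

Section block.
Context (s t om : R).
Hypothesis s_ge0 : 0 <= s.
Hypothesis st : s <= t.
Hypothesis om_ge0 : 0 <= om.
Hypothesis N_osc : forall (u v : R) i, s <= u -> u <= v -> v <= t ->
  N v i 0 - N u i 0 <= om.

(** After its last zero [u] the coordinate is not pushed, so it moves only by noise and downward
    drift from [Q_i(u) <= (M Q(u))_i <= (1 - gam) * Vs * h_i]. *)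
Let Q_after_hit (Vs : R) (r : R) i : s <= r -> r <= t ->
  (forall u : R, s <= u -> u <= r -> V u <= Vs) -> l s i 0 < l r i 0 ->
  Q r i 0 <= (1 - gam) * Vs * h i 0 + om.
Proof.
move=> sr rt VVs lsr.
have [u [su ur xu lu]] := l_hit s_ge0 sr lsr.
have u0 := le_trans s_ge0 su.
have := Q_incr i u0 ur; have := N_osc i su ur rt.
have := Q_zero u0 xu.
have : (M *m Q u) i 0 <= Vs * (M *m h) i 0.
  rewrite !mxE mulr_sumr ler_sum// => j _.
  rewrite mulrCA ler_wpM2l// (le_trans (le_weighted_max _ j))// ler_wpM2r ?VVs//.
  exact: le_trans ler01 (h_ge1 j).
have : Vs * (M *m h) i 0 <= Vs * ((1 - gam) * h i 0).
  rewrite ler_wpM2l//; apply: le_trans (weighted_max_ge0 _) (VVs u su ur).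
have : 0 <= del * (r - u) by rewrite mulr_ge0 ?(ltW del_gt0) ?subr_ge0.
by rewrite lu; lra.
Qed.

Let Q_no_push (r : R) i : s <= r -> r <= t -> l r i 0 <= l s i 0 ->
  Q r i 0 <= V s * h i 0 + om - del * (r - s).
Proof.
move=> sr rt lsr; have := Q_incr i s_ge0 sr; have := N_osc i (lexx s) sr rt.
by have := le_weighted_max (Q s) i; lra.
Qed.

(* At a coordinate where [Q i / h i] is close to its maximum over [i], the path
   [x i] is away from 0, hence is not pushed and feels the drift [- del]. *)
Lemma weighted_max_step :
  V t <= Num.max (V s + om - del * (t - s) / Ch) ((1 - gam) * V s + om / gam).
Proof.
pose A := [set V r | r in `[s, t]].
have omh i : om <= om * h i 0 by rewrite ler_peMr.
have Aub : has_ubound A.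
  exists (\sum_i (Q s i 0 + om + (l t i 0 - l s i 0))) => z [r /=].
  rewrite in_itv/= => /andP[sr rt] <-.
  have term_ge0 i : 0 <= Q s i 0 + om + (l t i 0 - l s i 0).
    by rewrite addr_ge0 ?subr_ge0 ?l_mono// addr_ge0 ?Q_ge0.
  apply: weighted_max_le => [|i]; first by rewrite sumr_ge0.
  apply: (@le_trans _ _ (Q s i 0 + om + (l t i 0 - l s i 0))).
    have := Q_incr i s_ge0 sr; have := N_osc i (lexx s) sr rt.
    have := l_mono i (le_trans s_ge0 sr) rt.
    have : 0 <= del * (r - s) by rewrite mulr_ge0 ?(ltW del_gt0) ?subr_ge0.
    by lra.
  apply: (@le_trans _ _ (\sum_i (Q s i 0 + om + (l t i 0 - l s i 0)))).
    by rewrite (bigD1 i)//= lerDl sumr_ge0.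
  by rewrite ler_peMr// sumr_ge0.
have A0 : A !=set0 by exists (V s); exists s => //=; rewrite in_itv/= lexx.
(* The contraction refers to [V] at unknown hitting times inside the block, so the supremum over the
   block is bounded first, from [Vs <= V s + om] or [Vs <= (1 - gam) * Vs + om]. *)
pose Vs := sup A.
have VVs r : s <= r -> r <= t -> V r <= Vs.
  by move=> sr rt; apply: ub_le_sup => //; exists r => //=; rewrite in_itv/= sr.
have Vs_ge0 : 0 <= Vs by apply: le_trans (weighted_max_ge0 _) (VVs s _ _).
have gVs_ge0 : 0 <= (1 - gam) * Vs by rewrite mulr_ge0// subr_ge0 ltW.
have Vs_le : Vs <= V s + om / gam.
  have : Vs <= Num.max (V s + om) ((1 - gam) * Vs + om).
    apply: ge_sup => // z [r /=]; rewrite in_itv/= => /andP[sr rt] <-.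
    apply: weighted_max_le => [|i].
      by rewrite le_max addr_ge0 ?weighted_max_ge0.
    rewrite maxr_pMl ?(le_trans ler01)// le_max.
    have [lsr|lsr] := ltP (l s i 0) (l r i 0); apply/orP; [right|left].
      have := Q_after_hit sr rt (fun u su ur => VVs u su (le_trans ur rt)) lsr.
      by have := omh i; lra.
    have := Q_no_push sr rt lsr; have := omh i.
    have : 0 <= del * (r - s) by rewrite mulr_ge0 ?(ltW del_gt0) ?subr_ge0.
    by lra.
  have omg : om <= om / gam by rewrite ler_pdivlMr// ler_piMr// ltW.
  rewrite le_max => /orP[H|H]; first by lra.
  have : Vs <= om / gam by rewrite ler_pdivlMr//; lra.
  by have := weighted_max_ge0 (Q s); lra.
have omE : (1 - gam) * (om / gam) + om = om / gam by field; rewrite gt_eqF.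
apply: weighted_max_le => [|i].
  rewrite le_max; apply/orP; right.
  by rewrite addr_ge0 ?mulr_ge0 ?weighted_max_ge0 ?subr_ge0 ?invr_ge0// ltW.
have h0 : 0 < h i 0 by exact: lt_le_trans ltr01 (h_ge1 i).
rewrite maxr_pMl ?(ltW h0)// le_max.
have [lst|lst] := ltP (l s i 0) (l t i 0); apply/orP; [right|left].
  apply: le_trans (Q_after_hit st (lexx t) VVs lst) _.
  have : (1 - gam) * Vs <= (1 - gam) * (V s + om / gam).
    by rewrite ler_wpM2l// subr_ge0 ltW.
  rewrite mulrDr => H.
  apply: (@le_trans _ _ (((1 - gam) * Vs + om) * h i 0)).
    by rewrite [leRHS]mulrDl lerD2l.
  by rewrite ler_wpM2r ?(ltW h0)//; lra.
apply: le_trans (Q_no_push st (lexx t) lst) _.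
rewrite mulrBl mulrDl lerB// ?lerD2l//.
rewrite -[leLHS]mulrA ler_piMr ?mulr_ge0 ?(ltW del_gt0) ?subr_ge0//.
by rewrite mulrC ler_pdivrMr ?mul1r// (lt_le_trans h0).
Qed.

(** Without any push, the drift would carry [Q_i] below 0; so every regulator coordinate grows, and
    growth requires a zero. *)
Lemma all_hit_zero : Ch * V s + om < del * (t - s) ->
  forall i, exists r, [/\ s <= r, r <= t & x r i 0 = 0].
Proof.
move=> drift i.
suff /(l_hit s_ge0 st) [r [sr rt xr _]] : l s i 0 < l t i 0 by exists r.
have := Q_incr i s_ge0 st; have := N_osc i (lexx s) st (lexx t).
have := Q_ge0 i (le_trans s_ge0 st).
have : Q s i 0 <= Ch * V s.
  apply: le_trans (le_weighted_max _ i) _.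
  by rewrite mulrC ler_wpM2r ?weighted_max_ge0.
by lra.
Qed.

End block.
End lyapunov.

(** * Deterministic counting of the bad blocks *)

Section drift_counting.
Context (R : realType).

(** Above the level [2 * c1 / gam * Del] one has [gam * V >= 2 * c1 * Del], whereas quiet noise adds
    at most [om / gam <= c1 * Del]: a net drop of [c1 * Del] remains. The second bound holds for all
    noise and is the source of [block_cost]. *)
Lemma drift_step (gam c1 rate V V' om Del : R) :
  0 < gam -> gam < 1 -> 0 < c1 -> 8 * c1 <= rate -> 0 <= Del -> 0 <= V -> 0 <= om ->
  V' <= Num.max (V + om - rate * Del) ((1 - gam) * V + om / gam) ->
  let f v := Num.max 0 (v - 2 * c1 / gam * Del) in
  (om <= gam * c1 * Del -> f V' <= Num.max 0 (f V - c1 * Del)) /\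
  f V' <= Num.max 0 (f V - c1 * Del) + (c1 * Del + om / gam).
Proof.
move=> g0 g1 c0 cr D0 V0 om0 V'le f.
set z := 2 * c1 / gam * Del.
have zE : gam * z = 2 * (c1 * Del) by rewrite /z; field; rewrite gt_eqF.
have cD : 0 <= c1 * Del by rewrite mulr_ge0// ltW.
have rD : 8 * (c1 * Del) <= rate * Del by rewrite mulrA ler_wpM2r.
have z0 : 0 <= z by rewrite /z !mulr_ge0 ?invr_ge0// ltW.
have omg : om <= om / gam by rewrite ler_pdivlMr// ler_piMr// ltW.
have gV : 0 <= gam * V by rewrite mulr_ge0// ltW.
split=> [omle|].
- have omg' : om / gam <= c1 * Del.
    by rewrite ler_pdivrMr// mulrC mulrA.
  have key : V' <= Num.max z (V - c1 * Del).
    apply: le_trans V'le _; rewrite ge_max !le_max; apply/andP; split.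
      by apply/orP; right; lra.
    have [Vz|zV] := leP V z; apply/orP; [left|right].
      have : (1 - gam) * V <= (1 - gam) * z by rewrite ler_wpM2l// subr_ge0 ltW.
      by lra.
    have : gam * z <= gam * V by rewrite ler_pM2l// ltW.
    by lra.
  rewrite /f -/z ge_max le_max lexx/= le_max.
  move: key; rewrite le_max => /orP[H|H]; first by apply/orP; left; lra.
  apply/orP; right; apply: (@le_trans _ _ (V - z - c1 * Del)); first by lra.
  by rewrite lerD2r le_max lexx orbT.
- have key : V' <= V + om / gam.
    apply: le_trans V'le _; rewrite ge_max; apply/andP; split; lra.
  have fV : V - z <= f V by rewrite /f le_max lexx orbT.
  have fV0 : 0 <= f V by rewrite /f le_max lexx.
  have fm : f V <= Num.max 0 (f V - c1 * Del) + c1 * Del.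
    by rewrite -lerBlDr le_max lexx orbT.
  by rewrite {1}/f -/z ge_max; apply/andP; split; lra.
Qed.

(** The potential is [f] plus [a] times the number of bad blocks so far. A bad block has either
    [f k > a], and the drop of [f] pays for [a], or loud noise, and one [xi k] pays for the growth
    of [f] and a second one for [a]; hence the factor 2. *)
Lemma sum_bad_le (f xi : nat -> R) (a : R) (quiet : pred nat) (n : nat) :
  0 < a -> (forall k, (k <= n)%N -> 0 <= f k) -> (forall k, (k < n)%N -> 0 <= xi k) ->
  (forall k, (k < n)%N -> ~~ quiet k -> a <= xi k) ->
  (forall k, (k < n)%N -> f k.+1 <= Num.max 0 (f k - a) + xi k) ->
  a * (\sum_(k < n) ~~ ((f k <= a)%R && quiet k))%:R <=
    f 0%N + 2 * \sum_(k < n) xi k.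
Proof.
move=> a0 f0 xi0 noisy fS.
suff H m : (m <= n)%N ->
    a * (\sum_(k < m) ~~ ((f k <= a)%R && quiet k))%:R + f m <=
    f 0%N + 2 * \sum_(k < m) xi k.
  by have := H n (leqnn n); have := f0 n (leqnn n); lra.
elim: m => [|m IH] mn; first by rewrite !big_ord0 mulr0 mulr0 add0r addr0.
rewrite !big_ord_recr/= natrD mulrDr mulrDr.
have := IH (ltnW mn); have := fS m mn; have := xi0 m mn; have := f0 m (ltnW mn).
case: (leP (f m) a) => fma; case: (boolP (quiet m)) => [_|/(noisy m mn)] /=.
- rewrite mulr0 (max_idPl _); last by rewrite subr_le0.
  by lra.
- rewrite mulr1 (max_idPl _); last by rewrite subr_le0.
  by lra.
- rewrite mulr1 (max_idPr _); last by rewrite subr_ge0 ltW.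
  by lra.
- rewrite mulr1 (max_idPr _); last by rewrite subr_ge0 ltW.
  by lra.
Qed.

(** The products run over all [k < n], with a test on [j], to match products of factors
    [1 + C k * psi k] in which some [C k] are 0. *)
Lemma geometric_recursion (E w : nat -> R) (r : R) (n : nat) : 0 <= r ->
  (forall k, 0 <= w k) -> (forall k, (k < n)%N -> E k.+1 <= (r * E k + 1) * w k) ->
  E n <= r ^+ n * E 0%N * \prod_(k < n) w k +
    \sum_(j < n) r ^+ (n.-1 - j) * \prod_(k < n) (if (j <= k)%N then w k else 1).
Proof.
move=> r0 w0; elim: n => [|n IH] ES.
  by rewrite !big_ord0 expr0 mul1r mulr1 addr0.
apply: le_trans (ES n (ltnSn n)) _.
have {IH} := IH (fun k kn => ES k (ltnW kn)).
rewrite !big_ord_recr/= subnn expr0 mul1r leqnn.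
have -> : \prod_(k < n) (if (n <= k)%N then w k else 1) = 1.
  by rewrite big1// => k _; rewrite leqNgt ltn_ord.
rewrite mul1r => IH.
rewrite mulrDl mul1r addrA lerD2r.
apply: le_trans (_ : _ <= r * (_ + _) * w n) _.
  by rewrite ler_wpM2r// ler_wpM2l//; exact: IH.
rewrite mulrDr mulrDl lerD//.
  by rewrite exprS -!mulrA.
rewrite mulr_sumr mulr_suml ler_sum// => j _.
rewrite big_ord_recr/= (ltnW (ltn_ord j)) mulrA mulrA -exprS.
by rewrite -subSn ?prednK// ?(leq_ltn_trans _ (ltn_ord j))// -ltnS prednK// (leq_ltn_trans _ (ltn_ord j)).
Qed.

End drift_counting.

(** * Dyadic chaining of the noise *)

Section chaining.
Context (R : realType).

(** The bound is the geometric sum of the increments allowed at levels 0 to [m]: a point with even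
    index already belongs to the previous level, and one with odd index is a single increment
    further. *)
Lemma dyadic_chain (N : R -> R) (s Del a : R) :
  (forall m j, (j < 2 ^ m)%N ->
    `|N (s + Del * j.+1%:R / 2 ^+ m) - N (s + Del * j%:R / 2 ^+ m)| <=
      (3 / 4) ^+ m * a) ->
  forall m j, (j <= 2 ^ m)%N ->
    `|N (s + Del * j%:R / 2 ^+ m) - N s| <= 4 * a * (1 - (3 / 4) ^+ m.+1).
Proof.
move=> incr; have a0 : 0 <= a.
  by have := incr 0%N 0%N isT; rewrite expr0 mul1r; apply: le_trans.
elim=> [|m IH] j jm.
  move: jm; rewrite expn0; case: j => [_|[_|//]].
    by rewrite mulr0 mul0r addr0 subrr normr0 expr1; apply: mulr_ge0; lra.
  have := incr 0%N 0%N isT; rewrite !expr0 mulr0 mul0r addr0 mul1r expr1.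
  by move/le_trans; apply; lra.
have half i : s + Del * (2 * i)%:R / 2 ^+ m.+1 = s + Del * i%:R / 2 ^+ m.
  rewrite natrM exprS; congr (_ + _).
  have : 2 ^+ m != 0 :> R by rewrite expf_neq0.
  by move: (2 ^+ m) => p p0; field.
have r_ge0 : 0 <= (3 / 4) ^+ m.+1 * a by rewrite mulr_ge0// exprn_ge0.
have r2 : 4 * a * (1 - (3 / 4) ^+ m.+2) =
    4 * a * (1 - (3 / 4) ^+ m.+1) + (3 / 4) ^+ m.+1 * a.
  by rewrite (exprS _ m.+1); lra.
have IH' i : (2 * i <= 2 ^ m.+1)%N ->
    `|N (s + Del * (2 * i)%:R / 2 ^+ m.+1) - N s| <= 4 * a * (1 - (3 / 4) ^+ m.+1).
  by rewrite half expnS leq_pmul2l// => /IH.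
rewrite r2; have := odd_double_half j; rewrite -mul2n.
case: (odd j) => /= jE; last first.
  have := IH' j./2; move: jE; rewrite add0n => ->.
  by move=> /(_ jm); lra.
have j2 : (2 * j./2 <= 2 ^ m.+1)%N by rewrite (leq_trans _ jm)// -{2}jE.
have := incr m.+1 (2 * j./2)%N; rewrite -{1}add1n jE => /(_ jm).
rewrite -add1n jE; have := IH' _ j2.
move: (N (s + Del * (2 * j./2)%:R / 2 ^+ m.+1)) => u H1 H2.
have := ler_normD (N (s + Del * j%:R / 2 ^+ m.+1) - u) (u - N s).
by rewrite addrA subrK => /le_trans; apply; rewrite addrC lerD.
Qed.

Lemma chaining (N : R -> R) (s Del a : R) : 0 <= s -> 0 < Del ->
  (forall r e : R, 0 <= r -> 0 < e ->
    exists2 del : R, 0 < del &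
      forall u : R, 0 <= u -> `|u - r| < del -> `|N u - N r| < e) ->
  (forall m j, (j < 2 ^ m)%N ->
    `|N (s + Del * j.+1%:R / 2 ^+ m) - N (s + Del * j%:R / 2 ^+ m)| <=
      (3 / 4) ^+ m * a) ->
  forall u v : R, s <= u -> u <= s + Del -> s <= v -> v <= s + Del ->
    N v - N u <= 8 * a.
Proof.
move=> s0 D0 cN incr.
have a0 : 0 <= a.
  by have := incr 0%N 0%N isT; rewrite expr0 mul1r; apply: le_trans.
suff H (u : R) : s <= u -> u <= s + Del -> `|N u - N s| <= 4 * a.
  move=> u v su ut sv vt; have := H u su ut; have := H v sv vt.
  by rewrite !ler_norml => /andP[_ ?] /andP[? _]; lra.
move=> su ut; apply/ler_addgt0Pr => e e0.
have [del del0 Hdel] := cN u e (le_trans s0 su) e0.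
pose m := Num.bound (Del / del).
have Dm : Del / del < 2 ^+ m by exact: upper_nthrootP.
have p0 : 0 < 2 ^+ m :> R by rewrite exprn_gt0.
pose y := (u - s) / Del * 2 ^+ m.
have y0 : 0 <= y by rewrite /y mulr_ge0 ?divr_ge0 ?subr_ge0// ltW.
pose j := Num.truncn y.
have /andP[jy yj] := truncn_itv y0.
have y1 : y <= 2 ^+ m.
  by rewrite /y ler_piMl ?(ltW p0)// ler_pdivrMr// mul1r lerBlDl.
have jm : (j <= 2 ^ m)%N.
  by rewrite -(ler_nat R) natrX; apply: le_trans y1.
have uE : u = s + Del * y / 2 ^+ m.
  by rewrite /y; field; rewrite !gt_eqF.
pose w := s + Del * j%:R / 2 ^+ m.
have w0 : 0 <= w.
  by rewrite /w addr_ge0// mulr_ge0 ?invr_ge0 ?mulr_ge0 ?(ltW D0) ?(ltW p0).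
have wu : `|w - u| < del.
  have -> : w - u = - (Del * (y - j%:R) / 2 ^+ m).
    by rewrite /w uE; ring.
  rewrite normrN ger0_norm; last first.
    by rewrite mulr_ge0 ?invr_ge0 ?mulr_ge0 ?subr_ge0// ltW.
  rewrite ltr_pdivrMr//.
  apply: (@le_lt_trans _ _ (Del * 1)).
    by rewrite ler_pM2l// lerBlDr; apply: ltW; rewrite addrC natr1.
  by rewrite mulr1 mulrC -ltr_pdivrMr.
have := Hdel w w0 wu; have := dyadic_chain incr jm; rewrite -/w.
have rm : 4 * a * (1 - (3 / 4) ^+ m.+1) <= 4 * a.
  by rewrite ler_piMr ?mulr_ge0// lerBlDr lerDl exprn_ge0.
rewrite (distrC (N w) (N u)) => H1 H2.
have := ler_normD (N u - N w) (N w - N s); rewrite addrA subrK; lra.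
Qed.

(** The exponent is [th * y + th * w * (y - g)]. For [y > g] the tilt only increases it, so
    [expR (th * y) <= psi] whatever the weight [w]: one number [psi] serves all levels. *)
Lemma expR_tilt_bound (th w g psi y : R) : 0 < th -> 0 <= w -> 0 < g ->
  expR (th * (1 + w) * y - th * w * g) <= psi ->
  y <= Num.max g (ln psi / th) /\ (psi < 1 -> y <= g).
Proof.
move=> th0 w0 g0 H.
have [yg|gy] := leP y g; first by rewrite le_max yg.
have thy : th * y <= th * (1 + w) * y - th * w * g.
  have : 0 <= th * w * (y - g) by rewrite !mulr_ge0 ?(ltW th0)// subr_ge0 ltW.
  by lra.
have ey : expR (th * y) <= psi by apply: le_trans H; rewrite ler_expR.
split.
  rewrite le_max; apply/orP; right; rewrite ler_pdivlMr// mulrC.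
  by rewrite -(expRK (th * y)) ler_ln ?posrE ?expR_gt0// (lt_le_trans _ ey)// expR_gt0.
move=> psi1; have : 1 <= expR (th * y).
  by rewrite -expR0 ler_expR mulr_ge0 ?(ltW th0)// (le_trans (ltW g0))// ltW.
by move/le_trans/(_ ey); rewrite leNgt psi1.
Qed.

End chaining.

(** * Integrals against the image of a measure with density *)

Section change_of_density.
Import HBNNSimple.
Local Open Scope ereal_scope.
Context d d' (T : measurableType d) (T' : measurableType d') (R : realType).
Variables (mu : {measure set T -> \bar R}) (nu : {measure set T' -> \bar R}).
Variables (phi : T -> T') (g : T -> R).
Hypothesis mphi : measurable_fun setT phi.
Hypothesis mg : measurable_fun setT g.
Hypothesis g0 : forall x, (0 <= g x)%R.
Hypothesis nuE : forall A, measurable A ->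
  nu A = \int[mu]_(x in phi @^-1` A) (g x)%:E.

Let integral_density_nnsfun (h : {nnsfun T' >-> R}) :
  \int[nu]_y (h y)%:E = \int[mu]_x (h (phi x) * g x)%:E.
Proof.
under [LHS]eq_integral do rewrite fimfunE -fsumEFin//.
rewrite [LHS]ge0_integral_fsum//; last 2 first.
  - by move=> r; exact/measurable_EFinP/measurableT_comp.
  - by move=> n x _; rewrite EFinM nnfun_muleindic_ge0.
have mpre r : measurable (phi @^-1` (h @^-1` [set r])).
  by rewrite -[X in measurable X]setTI; exact: mphi.
under [RHS]eq_integral.
  move=> x xD; rewrite fimfunE EFinM -fsumEFin// ge0_mule_fsuml; last first.
    by move=> r; rewrite EFinM nnfun_muleindic_ge0.
  over.
have mind r : measurable_fun setT (fun x : T => (\1_(h @^-1` [set r]) (phi x) : R)).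
  by apply: (@measurable_indic _ T R setT (phi @^-1` (h @^-1` [set r]))).
rewrite [RHS]ge0_integral_fsum//; last 2 first.
  - move=> r; apply: emeasurable_funM; last exact/measurable_EFinP.
    by apply/measurable_EFinP; apply: measurable_funM => //.
  - by move=> n x _; rewrite mule_ge0 ?lee_fin//; exact: nnfun_muleindic_ge0.
apply: eq_fsbigr => r rh.
under eq_integral do rewrite EFinM.
rewrite integralZl_indic_nnsfun// integral_indic// setIT nuE//.
have r0 : (0 <= r)%R by move: rh; rewrite inE => -[y _ <-].
rewrite integral_mkcond -ge0_integralZl//; last 2 first.
  - apply/(measurable_restrictT _ _).1 => //.
    by apply: measurable_funTS; exact/measurable_EFinP.
  - by move=> x _; apply: erestrict_ge0 => y _; rewrite lee_fin.
apply: eq_integral => x _; rewrite patchE EFinM -muleA; congr (_ * _).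
rewrite indicE; case: ifPn => xr.
  by rewrite mem_set ?mul1e//; move: xr; rewrite inE.
by rewrite memNset ?mul0e// => xr'; move/negP: xr; apply; rewrite inE.
Qed.

(** Simple functions and monotone convergence. It is applied to laws (density 1), to the Gaussian
    density ([phi] the identity), and to independence, where the density is a product of other
    factors. *)
Lemma ge0_integral_density (f : T' -> R) : measurable_fun setT f ->
  (forall y, (0 <= f y)%R) ->
  \int[nu]_y (f y)%:E = \int[mu]_x (f (phi x) * g x)%:E.
Proof.
move=> mf f0; have mf' : measurable_fun setT (EFin \o f) by exact/measurable_EFinP.
have f0' y : [set: T'] y -> 0 <= (EFin \o f) y by move=> _ /=; rewrite lee_fin.
pose h := nnsfun_approx measurableT mf'.
have hf y : (h n y)%:E @[n --> \oo] --> (f y)%:E.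
  exact: (@cvg_nnsfun_approx _ _ _ _ measurableT _ mf' f0' y).
have hmono y : {homo (fun n => h n y) : n m / (n <= m)%N >-> (n <= m)%R}.
  by move=> n m nm; exact/lefP/nd_nnsfun_approx.
transitivity (lim (\int[nu]_y (h n y)%:E @[n --> \oo])).
  rewrite -monotone_convergence//=.
  - by apply: eq_integral => y _; apply/esym/cvg_lim => //; exact: hf.
  - by move=> n; exact/measurable_EFinP/measurable_funTS.
  - by move=> n ? _; rewrite lee_fin.
  - by move=> y _ a b ab; rewrite lee_fin hmono.
transitivity (lim (\int[mu]_x (h n (phi x) * g x)%:E @[n --> \oo])).
  by apply: congr_lim; apply/funext => n /=; exact: integral_density_nnsfun.
rewrite -monotone_convergence//=.
- apply: eq_integral => x _; apply/cvg_lim => //.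
  under eq_fun do rewrite EFinM.
  by rewrite EFinM; apply: cvgeZr => //; exact: hf.
- move=> n; apply/measurable_EFinP; apply: measurable_funM => //.
  by apply: measurableT_comp => //.
- by move=> n x _; rewrite lee_fin mulr_ge0.
- by move=> x _ a b ab; rewrite lee_fin ler_wpM2r// hmono.
Qed.

End change_of_density.

Lemma ge0_integral_law d d' (Omega : measurableType d) (T : measurableType d')
    (R : realType) (P : probability Omega R) (nu : {measure set T -> \bar R})
    (Z : Omega -> T) (f : T -> R) :
  measurable_fun setT Z ->
  (forall A, measurable A -> P (Z @^-1` A) = nu A) ->
  measurable_fun setT f -> (forall y, 0 <= f y) ->
  (\int[nu]_y (f y)%:E = \int[P]_w (f (Z w))%:E)%E.
Proof.
move=> mZ Znu mf f0.
have m1 : measurable_fun setT (cst 1 : Omega -> R) by exact: measurable_cst.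
have nuE A : measurable A ->
    nu A = (\int[P]_(w in Z @^-1` A) (cst 1%R w)%:E)%E.
  move=> mA; rewrite -Znu//.
  rewrite [RHS](_ : _ = \int[P]_(w in Z @^-1` A) (cst 1 w))%E//.
  rewrite integral_cst; first by rewrite mul1e.
  by have := mZ measurableT _ mA; rewrite setTI.
rewrite (ge0_integral_density mZ m1 (fun=> ler01) nuE mf f0).
by apply: eq_integral => w _; rewrite mulr1.
Qed.

(** * Products of functions of independent variables, Gaussian exponential moments *)

Section independence.
Local Open Scope ereal_scope.
Context d (Omega : measurableType d) (R : realType) (P : probability Omega R).

(** Indicators are turned into functions one index at a time, [r] listing those already treated.
    With the other factors as density, the image under [Z i] is a constant multiple of the law of
    [Z i], by the induction hypothesis for an arbitrary set at [i]; it remains to integrate [f i]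
    against it. *)
Lemma expectation_fun_independent (I : finType) (Z : I -> Omega -> R)
    (f : I -> R -> R) (c : I -> R) :
  (forall i, measurable_fun setT (Z i)) -> mutually_independent P Z ->
  (forall i, measurable_fun setT (f i)) -> (forall i x, (0 <= f i x)%R) ->
  (forall i, \int[P]_w (f i (Z i w))%:E = (c i)%:E) ->
  \int[P]_w (\prod_i f i (Z i w))%:E = (\prod_i c i)%:E.
Proof.
move=> mZ indZ mf f0 fc.
pose F (r : seq I) (A : I -> set R) i x : R := if i \in r then f i x else \1_(A i) x.
pose C (r : seq I) (A : I -> set R) i : R :=
  if i \in r then c i else fine (P (Z i @^-1` A i)).
have mF r A i : (forall j, measurable (A j)) ->
    measurable_fun setT (fun w => F r A i (Z i w)).
  move=> mA; rewrite /F; case: (i \in r); first exact: (measurableT_comp (mf i) (mZ i)).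
  by apply: (measurableT_comp _ (mZ i)); exact: measurable_indic.
have F0 r A i x : (0 <= F r A i x)%R by rewrite /F; case: ifP.
have c0 i : (0 <= c i)%R.
  by rewrite -lee_fin -fc; apply: integral_ge0 => w _; rewrite lee_fin.
have C0 r A i : (0 <= C r A i)%R.
  by rewrite /C; case: ifP => // _; rewrite fine_ge0.
have main (r : seq I) : uniq r -> forall A, (forall j, measurable (A j)) ->
    \int[P]_w (\prod_i F r A i (Z i w))%:E = (\prod_i C r A i)%:E.
  elim: r => [_ A mA|i r IH /= /andP[ir ur] A mA].
    rewrite /F /C /=.
    transitivity (\int[P]_w (\1_(\bigcap_(j in [set: I]) (Z j @^-1` A j)) w)%:E).
      apply: eq_integral => w _; congr (_%:E); rewrite indicE.
      case: (boolP (w \in _)) => [|nw].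
        rewrite inE => wA; apply: big1 => j _.
        by rewrite indicE mem_set//; exact: wA.
      have [j Aj] : exists j, ~ A j (Z j w).
        apply: contrapT => H; move/negP: nw; apply; rewrite inE => j _.
        by apply: contrapT => Aj; apply: H; exists j.
      by rewrite (bigD1 j)//= indicE memNset// mul0r.
    rewrite integral_indic//; last first.
      apply: fin_bigcap_measurable => [|j _]; first exact: finite_finset.
      by rewrite -[X in measurable X]setTI; exact: mZ.
    by rewrite setIT; exact: indZ.
  pose A' (B : set R) j := if j == i then B else A j.
  have mA' B : measurable B -> forall j, measurable (A' B j).
    by move=> mB j; rewrite /A'; case: ifP.
  pose g w := (\prod_(j | j != i) F (i :: r) A j (Z j w))%R.
  have g0 w : (0 <= g w)%R by apply: prodr_ge0 => j _; exact: F0.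
  have mg : measurable_fun setT g.
    rewrite /g; under eq_fun do rewrite -big_filter.
    by apply: measurable_prod => j _; exact: mF.
  pose K : R := (\prod_(j | j != i) C (i :: r) A j)%R.
  have K0 : (0 <= K)%R by apply: prodr_ge0 => j _; exact: C0.
  pose Zi : {RV P >-> R} := mfun_Sub (mem_set (mZ i)).
  pose nu := mscale (NngNum K0) (distribution P Zi).
  have nuE B : measurable B -> nu B = \int[P]_(w in Z i @^-1` B) (g w)%:E.
    move=> mB.
    have := IH ur (A' B) (mA' B mB).
    rewrite (bigD1 i)//= {1}/C (negbTE ir) /A' eqxx.
    rewrite (eq_bigr (C (i :: r) A)); last first.
      by move=> j ji; rewrite /C inE (negbTE ji).
    rewrite -/K => H.
    rewrite /nu /mscale/= /distribution /pushforward.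
    rewrite [X in _ * X = _](_ : _ = P (Z i @^-1` B))//.
    rewrite -(@fineK _ (P (Z i @^-1` B))) ?fin_num_measure//; last first.
      by rewrite -[X in measurable X]setTI; exact: (mZ i measurableT _ mB).
    rewrite -EFinM mulrC -H [RHS]integral_mkcond. apply: eq_integral => w _.
    rewrite (bigD1 i)//= {1}/F (negbTE ir) eqxx patchE indicE.
    rewrite (eq_bigr (fun j => F (i :: r) A j (Z j w))); last first.
      by move=> j ji; rewrite /F inE (negbTE ji).
    rewrite -/(g w) (_ : (w \in _) = (Z i w \in B)); last by [].
    by case: (Z i w \in B); rewrite ?mul1r ?mul0r.
  have := ge0_integral_density (mZ i) mg g0 nuE (mf i) (f0 i).
  rewrite ge0_integral_mscale//; last 2 first.
    exact/measurable_EFinP.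
    by move=> x _; rewrite lee_fin.
  rewrite ge0_integral_distribution//; last 2 first.
    exact/measurable_EFinP.
    by move=> x; rewrite lee_fin.
  rewrite /= fc -EFinM => E.
  rewrite [in RHS](bigD1 i)//= -/K {1}/C inE eqxx/= mulrC E.
  apply: eq_integral => w _.
  by rewrite (bigD1 i)//= {1}/F inE eqxx.
have := main (enum I) (enum_uniq I) (fun=> setT) (fun=> measurableT).
rewrite (eq_bigr c) => [<-|i _]; last by rewrite /C mem_enum.
by apply: eq_integral => w _; congr (_%:E); apply: eq_bigr => i _; rewrite /F mem_enum.
Qed.

(** Completing the square moves the mean of the density to [a * s ^+ 2]. *)
Lemma normal_mgf (s a : R) : (0 < s)%R ->
  \int[normal_prob 0 s]_x (expR (a * x))%:E = (expR (a ^+ 2 * s ^+ 2 / 2))%:E.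
Proof.
move=> s0; have sN0 : s != 0%R by rewrite gt_eqF.
have mexp : measurable_fun setT (fun x : R => expR (a * x)).
  by apply: (measurableT_comp (@measurable_expR R)); exact: mulrl_measurable.
have nuE A : measurable A -> normal_prob 0 s A =
    \int[lebesgue_measure]_(x in idfun @^-1` A) (normal_pdf 0 s x)%:E by [].
rewrite (@ge0_integral_density _ _ (measurableTypeR R) (measurableTypeR R) R
  lebesgue_measure (normal_prob 0 s) idfun _ (@measurable_id _ _ setT)
  (measurable_normal_pdf 0 s) (normal_pdf_ge0 0 s) nuE _ mexp (fun x => expR_ge0 _)).
transitivity (\int[lebesgue_measure]_x
    ((expR (a ^+ 2 * s ^+ 2 / 2))%:E * (normal_pdf (a * s ^+ 2) s x)%:E)).
  apply: eq_integral => x _; rewrite -EFinM; congr (_%:E).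
  rewrite !normal_pdfE// mulrCA [RHS]mulrCA; congr (_ * _)%R.
  by rewrite /normal_fun -!expRD; congr expR => /=; field.
transitivity ((expR (a ^+ 2 * s ^+ 2 / 2))%:E *
    \int[lebesgue_measure]_x (normal_pdf (a * s ^+ 2) s x)%:E); last first.
  by rewrite integral_normal_pdf mule1.
apply: (@ge0_integralZl _ (measurableTypeR R) R lebesgue_measure setT measurableT
  (fun x => (normal_pdf (a * s ^+ 2) s x)%:E)).
- by apply/measurable_EFinP; exact: measurable_normal_pdf.
- by move=> x _; rewrite lee_fin normal_pdf_ge0.
- by rewrite lee_fin expR_ge0.
Qed.

Lemma normal_law_mgf (Z : Omega -> R) (s a : R) : (0 < s)%R ->
  measurable_fun setT Z ->
  (forall A, measurable A -> P (Z @^-1` A) = normal_prob 0 s A) ->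
  \int[P]_w (expR (a * Z w))%:E = (expR (a ^+ 2 * s ^+ 2 / 2))%:E.
Proof.
move=> s0 mZ Zlaw; rewrite -normal_mgf//.
have mexp : measurable_fun setT (fun x : R => expR (a * x)).
  by apply: (measurableT_comp (@measurable_expR R)); exact: mulrl_measurable.
by rewrite (@ge0_integral_law _ _ Omega (measurableTypeR R) R P (normal_prob 0 s) Z _
  mZ Zlaw mexp (fun x => expR_ge0 _)).
Qed.

End independence.
Lemma measurable_mx_entry (R : realType) (m n : nat) (i : 'I_m) (j : 'I_n) :
  measurable_fun setT (fun A : 'M[R]_(m, n) => A i j).
Proof.
move=> _ Y mY; apply: sub_sigma_algebra; exists (i, j) => //=.
by exists Y.
Qed.

Lemma sum_nat_block (R : nmodType) (n L : nat) (F : nat -> R) :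
  \sum_(x < n * L) F x = \sum_(k < n) \sum_(l < L) F (k * L + l)%N.
Proof.
elim: n => [|n IH]; first by rewrite mul0n !big_ord0.
rewrite mulSnr big_split_ord/= IH big_ord_recr/=.
by congr (_ + _).
Qed.

Lemma sum_option (R : nmodType) (A : finType) (F : option A -> R) :
  \sum_o F o = F None + \sum_a F (Some a).
Proof.
rewrite (bigD1 None)//=; congr (_ + _).
rewrite (reindex_omap Some id)/=; last by case.
by apply: eq_bigl => a; rewrite eqxx.
Qed.

(** * Exponential moments of Brownian increments on a grid *)

Section brownian_grid.
Context d (Omega : measurableType d) (R : realType) (P : probability Omega R).
Context (dim : nat) (B : R -> {RV P >-> 'cV[R]_dim}).
Hypothesis bm : brownian_motion B.
Context (dl : R).
Hypothesis dl_gt0 : 0 < dl.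

Definition bm_incr (l : nat) (i : 'I_dim) (w : Omega) : R :=
  (B (dl * l.+1%:R) w - B (dl * l%:R) w) i 0.

Lemma measurable_bm_entry t i : measurable_fun setT (fun w => B t w i 0).
Proof.
apply: (measurableT_comp (@measurable_mx_entry R dim 1 i 0)).
exact: measurable_funPT.
Qed.

Lemma measurable_bm_incr l i : measurable_fun setT (bm_incr l i).
Proof.
rewrite /bm_incr; under eq_fun do rewrite mxB_E.
by apply: measurable_funB; exact: measurable_bm_entry.
Qed.

Lemma bm_mgf (K : nat) (c : nat -> 'I_dim -> R) :
  (\int[P]_w (expR (\sum_(l < K) \sum_i c l i * bm_incr l i w))%:E =
   (expR (\sum_(l < K) \sum_i c l i ^+ 2 * dl / 2))%:E)%E.
Proof.
pose t (k : nat) := dl * k%:R.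
have tS k : t k.+1 - t k = dl by rewrite /t -mulrBr -natr1 addrAC subrr add0r mulr1.
have tlt k : t k < t k.+1 by rewrite -subr_gt0 tS.
have t0 k : 0 <= t k by rewrite mulr_ge0// ltW.
have ind := bm_independent bm (t0 0%N) (fun k (_ : (k < K)%N) => tlt k).
have mexp a : measurable_fun setT (fun x : R => expR (a * x)).
  by apply: (measurableT_comp (@measurable_expR R)); exact: mulrl_measurable.
have := @expectation_fun_independent _ Omega R P _ _
  (fun (ki : 'I_K * 'I_dim) x => expR (c ki.1 ki.2 * x))
  (fun ki => expR (c ki.1 ki.2 ^+ 2 * dl / 2)) _ ind _ _ _.
rewrite -expR_sum pair_big/= => <-.
- by apply: eq_integral => w _; rewrite -expR_sum pair_big.
- by case=> k i; exact: measurable_bm_incr.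
- by move=> ki; exact: mexp.
- by move=> ki x; exact: expR_ge0.
- move=> [k i]; have sdl : 0 < Num.sqrt dl by rewrite sqrtr_gt0.
  rewrite /= (normal_law_mgf (c k i) sdl (measurable_bm_incr k i)).
    by rewrite sqr_sqrtr// ltW.
  by move=> A mA; have := bm_gaussian bm i (t0 k) (tlt k) mA; rewrite tS.
Qed.

Context (n L : nat) (A : finType) (coef : A -> nat -> 'I_dim -> R).
Context (wgt : A -> R) (C : nat -> R).
Hypothesis wgt_ge0 : forall a, 0 <= wgt a.
Hypothesis C_ge0 : forall k, 0 <= C k.

(** [f] selects at most one linear form per block, [None] standing for the factor 1. Division by [L]
    glues the selected forms into a single form on the grid of [n * L] steps. *)
Lemma bm_mgf_blocks (f : 'I_n -> option A) :
  let coef' o l i := if o is Some a then coef a l i else 0 in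
  (\int[P]_w (\prod_(k < n)
     expR (\sum_(l < L) \sum_i coef' (f k) l i * bm_incr (k * L + l) i w))%:E =
   (\prod_(k < n) expR (\sum_(l < L) \sum_i coef' (f k) l i ^+ 2 * dl / 2))%:E)%E.
Proof.
move=> coef'.
pose c l i := if insub (l %/ L)%N is Some k then coef' (f k) (l %% L)%N i else 0.
have cE (k : 'I_n) (l : 'I_L) i : c (k * L + l)%N i = coef' (f k) l i.
  have L0 : (0 < L)%N by apply: leq_ltn_trans (ltn_ord l).
  by rewrite /c divnMDl// divn_small// addn0 valK modnMDl modn_small.
have := bm_mgf (n * L) c.
rewrite (sum_nat_block n L (fun l => \sum_i c l i ^+ 2 * dl / 2)) expR_sum.
under eq_integral => w _.
  rewrite (sum_nat_block n L (fun l => \sum_i c l i * bm_incr l i w)) expR_sum.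
  under eq_bigr do under eq_bigr do under eq_bigr do rewrite cE.
  over.
move=> ->; congr (_%:E); apply: eq_bigr => k _; congr expR.
by apply: eq_bigr => l _; apply: eq_bigr => i _; rewrite cE.
Qed.

(** Expanding the product over all choices [f] leaves exponentials of single linear forms, with
    expectations given by [bm_mgf_blocks]; the same expansion, read backwards, restores a product
    over blocks. *)
Lemma bm_prod_expectation :
  (\int[P]_w (\prod_(k < n) (1 + C k * \sum_a wgt a *
       expR (\sum_(l < L) \sum_i coef a l i * bm_incr (k * L + l) i w)))%:E =
   (\prod_(k < n) (1 + C k * \sum_a wgt a *
       expR (\sum_(l < L) \sum_i coef a l i ^+ 2 * dl / 2)))%:E)%E.
Proof.
pose coef' o l i := if o is Some a then coef a l i else 0.
pose W k o := if o is Some a then C k * wgt a else 1.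
have W_ge0 k o : 0 <= W k o.
  by case: o => [a|]; rewrite /W ?ler01// mulr_ge0.
have expand (e : 'I_n -> option A -> R) : (forall k, e k None = 1) ->
    \prod_(k < n) (1 + C k * \sum_a wgt a * e k (Some a)) =
    \sum_(f : {ffun 'I_n -> option A}) (\prod_(k < n) W k (f k)) * \prod_(k < n) e k (f k).
  move=> e1.
  transitivity (\prod_(k < n) \sum_o W k o * e k o).
    apply: eq_bigr => k _; rewrite sum_option e1 mulr1; congr (_ + _).
    by rewrite mulr_sumr; apply: eq_bigr => a _; rewrite mulrA.
  rewrite bigA_distr_bigA/=; apply: eq_bigr => f _.
  by rewrite big_split.
pose lin k o w := expR (\sum_(l < L) \sum_i coef' o l i * bm_incr (k * L + l) i w).
have zero (G : 'I_L -> 'I_dim -> R) : (forall l i, G l i = 0) ->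
    expR (\sum_(l < L) \sum_i G l i) = 1.
  by move=> G0; rewrite big1 ?expR0// => l _; rewrite big1.
transitivity (\int[P]_w (\sum_(f : {ffun 'I_n -> option A})
    ((\prod_(k < n) W k (f k)) * \prod_(k < n) lin k (f k) w)%:E))%E.
  apply: eq_integral => w _; rewrite sumEFin -(expand (fun k o => lin k o w))//.
  by move=> k; apply: zero => l i; rewrite mul0r.
have mlin k o : measurable_fun setT (lin k o).
  apply: (measurableT_comp (@measurable_expR R)).
  apply: measurable_sum => l; apply: measurable_sum => i.
  by apply: measurable_funM => //; exact: measurable_bm_incr.
have mprod (f : 'I_n -> option A) :
    measurable_fun setT (fun w => \prod_(k < n) lin k (f k) w).
  by apply: measurable_prod => k _; exact: mlin.
have prod_ge0 (f : 'I_n -> option A) w : 0 <= \prod_(k < n) lin k (f k) w.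
  by apply: prodr_ge0 => k _; exact: expR_ge0.
rewrite ge0_integral_sum//; last 2 first.
- move=> f; apply/measurable_EFinP; apply: measurable_funM => //; exact: mprod.
- by move=> f w _; rewrite lee_fin mulr_ge0// prodr_ge0.
transitivity (\sum_(f : {ffun 'I_n -> option A}) ((\prod_(k < n) W k (f k)) *
    \prod_(k < n) expR (\sum_(l < L) \sum_i coef' (f k) l i ^+ 2 * dl / 2))%:E)%E.
  apply: eq_bigr => f _; under eq_integral do rewrite EFinM.
  rewrite ge0_integralZl//.
  - by rewrite EFinM bm_mgf_blocks.
  - by apply/measurable_EFinP; exact: mprod.
  - by move=> w _; rewrite lee_fin.
  - by rewrite lee_fin prodr_ge0.
rewrite sumEFin -(expand (fun k o => expR (\sum_(l < L) \sum_i coef' o l i ^+ 2 * dl / 2)))//.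
by move=> k; apply: zero => l i; rewrite expr0n/= mul0r mul0r.
Qed.

End brownian_grid.

(** * The tilted exponential sum controlling the noise of a block *)

Section noise.
Context d (Omega : measurableType d) (R : realType) (P : probability Omega R).
Context (dim : nat) (B : R -> {RV P >-> 'cV[R]_dim}).
Hypothesis bm : brownian_motion B.
Context (W : 'M[R]_dim) (v Del th g : R).
Hypothesis Del_gt0 : 0 < Del.
Hypothesis th_gt0 : 0 < th.
Hypothesis W_row : forall i, \sum_j W i j ^+ 2 <= v ^+ 2.
Hypothesis th_le : 2 * th ^+ 2 * v ^+ 2 * Del <= th * g / 2.
Hypothesis thg_ge : expR (- (th * g / 20)) <= 4^-1.

Definition noise (w : Omega) (t : R) : 'cV[R]_dim := W *m B t w.

(* The tilt grows with the level [m] fast enough to beat the union bound over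
   the [2 ^ m] increments, and slowly enough to keep their moment generating
   functions bounded: [(21 / 20) ^+ 2 * (8 / 9) < 1]. *)
Definition noise_tilt (m : nat) : R := (21 / 20) ^+ m.

Definition noise_incr (k m j : nat) (i : 'I_dim) (w : Omega) : R :=
  noise w (k%:R * Del + Del * j.+1%:R / 2 ^+ m) i 0 -
  noise w (k%:R * Del + Del * j%:R / 2 ^+ m) i 0.

(** The factor [(4 / 3) ^+ m] rescales increments of level [m] to the decay allowed in [chaining],
    [b] provides both signs, and the exponent is that of [expR_tilt_bound] with
    [w = noise_tilt m]. *)
Definition psi_term (k m j : nat) (i : 'I_dim) (b : bool) (w : Omega) : R :=
  expR (th * (1 + noise_tilt m) * ((4 / 3) ^+ m * ((-1) ^+ b * noise_incr k m j i w))
        - th * noise_tilt m * g).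

Definition psi (M k : nat) (w : Omega) : R :=
  \sum_(m < M.+1) \sum_(j < 2 ^ m) \sum_i \sum_(b : bool) psi_term k m j i b w.

Let tilt_ge m : 1 + m%:R / 20 <= noise_tilt m.
Proof.
elim: m => [|m IH]; first by rewrite mul0r addr0 /noise_tilt expr0.
rewrite /noise_tilt exprS -/(noise_tilt m) -natr1.
have : 0 <= m%:R :> R by [].
by lra.
Qed.

Let tilt_gt0 m : 0 < noise_tilt m.
Proof. by rewrite exprn_gt0//; lra. Qed.

Section level.
Context (M : nat).
Let dl : R := Del / 2 ^+ M.
Let L := (2 ^ M)%N.
(** The position [j] ranges over ['I_L] at every level, so that the type does not depend on [m];
    [wgt] is 0 beyond [2 ^ m]. An increment of level [m] is a window of [2 ^ (M - m)] steps of the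
    finest grid. *)
Let A : finType := ('I_M.+1 * 'I_L * 'I_dim * bool)%type.
Let al (m : nat) (b : bool) : R :=
  th * (1 + noise_tilt m) * ((4 / 3) ^+ m * (-1) ^+ b).
Let coef (a : A) (l : nat) (i : 'I_dim) : R := let: (m, j, i0, b) := a in
  if (j * 2 ^ (M - m) <= l < j.+1 * 2 ^ (M - m))%N then al m b * W i0 i else 0.
Let wgt (a : A) : R := let: (m, j, i0, b) := a in
  if (j < 2 ^ m)%N then expR (- (th * noise_tilt m * g)) else 0.

Let wgtE (m : 'I_M.+1) (j : 'I_L) i b : wgt (m, j, i, b) =
  if (j < 2 ^ m)%N then expR (- (th * noise_tilt m * g)) else 0.
Proof. by []. Qed.

Let dl_gt0 : 0 < dl. Proof. by rewrite divr_gt0// exprn_gt0. Qed.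

Let sum_window (V : nmodType) (m j : nat) (F : nat -> V) :
  (m <= M)%N -> (j < 2 ^ m)%N ->
  \sum_(l < L) (if (j * 2 ^ (M - m) <= l < j.+1 * 2 ^ (M - m))%N then F l else 0) =
  \sum_(j * 2 ^ (M - m) <= l < j.+1 * 2 ^ (M - m)) F l.
Proof.
move=> mM jm; have jL : (j.+1 * 2 ^ (M - m) <= L)%N.
  have -> : L = (2 ^ m * 2 ^ (M - m))%N by rewrite -expnD subnKC.
  by rewrite leq_pmul2r// expn_gt0.
rewrite (big_nat_widen _ _ _ _ _ jL) big_geq_mkord [RHS]big_mkcond/=.
by apply: eq_bigr => l _; rewrite andbC.
Qed.

Let dlE m : (m <= M)%N -> dl * (2 ^ (M - m))%:R = Del / 2 ^+ m.
Proof.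
move=> mM; have -> : dl = Del / (2 ^+ m * 2 ^+ (M - m)) by rewrite -exprD subnKC.
have h1 : 2 ^+ m != 0 :> R by rewrite expf_neq0.
have h2 : 2 ^+ (M - m) != 0 :> R by rewrite expf_neq0.
by rewrite natrX; field; rewrite h1 h2.
Qed.

Let linE (k m : nat) (j : 'I_L) (m' : 'I_M.+1) i b w :
  m' = m :> nat -> (j < 2 ^ m)%N ->
  \sum_(l < L) \sum_i' coef (m', j, i, b) l i' * bm_incr B dl (k * L + l) i' w =
  al m b * noise_incr k m j i w.
Proof.
move=> m'E jm; have mM : (m <= M)%N by rewrite -m'E -ltnS.
pose F l := noise w (dl * (k * L + l)%:R) i 0.
transitivity (\sum_(l < L) (if (j * 2 ^ (M - m) <= l < j.+1 * 2 ^ (M - m))%N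
    then al m b * (F l.+1 - F l) else 0)).
  apply: eq_bigr => l _; rewrite /coef m'E; case: ifP => _; last first.
    by rewrite big1// => i' _; rewrite mul0r.
  rewrite /F /noise -mxB_E -mulmxBr mxE mulr_sumr; apply: eq_bigr => i' _.
  by rewrite /bm_incr addnS mulrA.
rewrite (sum_window (fun l => al m b * (F l.+1 - F l)) mM jm).
rewrite -mulr_sumr telescope_sumr; last by rewrite leq_pmul2r ?expn_gt0.
have FE j' : F (j' * 2 ^ (M - m))%N = noise w (k%:R * Del + Del * j'%:R / 2 ^+ m) i 0.
  have DL : dl * L%:R = Del by have := dlE (leq0n M); rewrite subn0 expr0 divr1.
  rewrite /F natrD mulrDr !natrM mulrCA DL mulrCA dlE//.
  by congr (noise w (_ + _) i 0); ring.
by rewrite !FE.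
Qed.

Lemma psi_expansion k w : psi M k w =
  \sum_a wgt a * expR (\sum_(l < L) \sum_i coef a l i * bm_incr B dl (k * L + l) i w).
Proof.
transitivity (\sum_(m < M.+1) \sum_(j < L) \sum_i \sum_(b : bool)
    wgt (m, j, i, b) * expR (\sum_(l < L) \sum_i'
       coef (m, j, i, b) l i' * bm_incr B dl (k * L + l) i' w)); last first.
  by rewrite !pair_big/=; apply: eq_bigr => -[[[m j] i] b].
apply: eq_bigr => m _; have mM : (m <= M)%N by rewrite -ltnS.
have mL : (2 ^ m <= L)%N by rewrite leq_exp2l.
rewrite (big_ord_widen _ (fun j => \sum_i \sum_(b : bool) psi_term k m j i b w) mL).
rewrite big_mkcond; apply: eq_bigr => j _; case: ifP => jm; last first.
  by rewrite big1// => i _; rewrite big1// => b _; rewrite wgtE jm mul0r.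
apply: eq_bigr => i _; apply: eq_bigr => b _.
rewrite (linE k i b w (erefl (m : nat)) jm) wgtE jm /psi_term addrC expRD; congr (_ * expR _).
by rewrite /al !mulrA.
Qed.

(** The variance adds at most [th * g / 2] to the exponent, against the tilt [th * g * (1 + m / 20)]
    at least. The surplus [expR (- (m * th * g / 20)) <= 4 ^- m] beats the [2 ^ m] positions; the 4
    is two signs times a geometric sum at most 2. *)
Lemma psi_wgt_sum_le :
  \sum_a wgt a * expR (\sum_(l < L) \sum_i coef a l i ^+ 2 * dl / 2) <=
  4 * dim%:R * expR (- (th * g / 2)).
Proof.
have varle (m : 'I_M.+1) (j : 'I_L) i b : (j < 2 ^ m)%N ->
    \sum_(l < L) \sum_i' coef (m, j, i, b) l i' ^+ 2 * dl / 2 <= th * g / 2.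
  move=> jm; have mM : (m <= M)%N by rewrite -ltnS.
  pose c := al m b ^+ 2 * (\sum_i' W i i' ^+ 2) * dl / 2.
  have -> : \sum_(l < L) \sum_i' coef (m, j, i, b) l i' ^+ 2 * dl / 2 =
      \sum_(l < L) (if (j * 2 ^ (M - m) <= l < j.+1 * 2 ^ (M - m))%N then c else 0).
    apply: eq_bigr => l _; rewrite /coef; case: ifP => _; last first.
      by rewrite big1// => i' _; rewrite expr0n/= !mul0r.
    rewrite /c mulr_sumr !mulr_suml; apply: eq_bigr => i' _.
    by rewrite exprMn.
  rewrite (sum_window (fun=> c) mM jm) sumr_const_nat -mulnBl subSnn mul1n.
  have -> : c *+ 2 ^ (M - m) =
      (al m b ^+ 2 / 2 ^+ m) * (\sum_i' W i i' ^+ 2) * Del / 2.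
    have h1 : 2 ^+ m != 0 :> R by rewrite expf_neq0.
    rewrite -mulr_natr /c -(mulrA (_ * _ * dl)) (mulrC 2^-1) mulrA.
    by rewrite -(mulrA _ dl) dlE//; field.
  have alE : al m b ^+ 2 / 2 ^+ m <= 4 * th ^+ 2.
    have -> : al m b ^+ 2 / 2 ^+ m = th ^+ 2 * ((1 + noise_tilt m) ^+ 2 * (8 / 9) ^+ m).
      have -> : (8 / 9) ^+ m = ((4 / 3) ^+ m) ^+ 2 / 2 ^+ m :> R.
        by rewrite -exprM mulnC exprM -exprVn -exprMn; congr (_ ^+ _); field.
      rewrite /al !exprMn sqrr_sign; ring.
    rewrite mulrC ler_pM2r ?exprn_gt0//.
    apply: (@le_trans _ _ ((2 * noise_tilt m) ^+ 2 * (8 / 9) ^+ m)).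
      rewrite ler_wpM2r ?exprn_ge0// ler_sqr ?nnegrE.
      - have : 1 <= noise_tilt m by apply: le_trans (tilt_ge m); rewrite lerDl.
        by lra.
      - by rewrite addr_ge0// ltW.
      - by rewrite mulr_ge0// ltW.
    rewrite exprMn -mulrA /noise_tilt -exprM mulnC exprM -exprMn.
    rewrite (_ : 2 ^+ 2 = 4); last by rewrite expr2; ring.
    by rewrite ler_piMr// exprn_ile1//; lra.
  apply: le_trans th_le.
  have S0 : 0 <= \sum_i' W i i' ^+ 2 by apply: sumr_ge0 => ? _; exact: sqr_ge0.
  have : al m b ^+ 2 / 2 ^+ m * (\sum_i' W i i' ^+ 2) <= 4 * th ^+ 2 * v ^+ 2.
    by rewrite ler_pM// mulr_ge0 ?sqr_ge0// invr_ge0 exprn_ge0.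
  move: (_ / 2 ^+ m * _) => p pl.
  have : p * Del <= 4 * th ^+ 2 * v ^+ 2 * Del by rewrite ler_pM2r.
  by lra.
pose e := expR (- (th * g / 20)).
have e0 : 0 <= e by exact: expR_ge0.
have wle (m : 'I_M.+1) (j : 'I_L) i b :
    wgt (m, j, i, b) * expR (\sum_(l < L) \sum_i' coef (m, j, i, b) l i' ^+ 2 * dl / 2)
    <= (if (j < 2 ^ m)%N then expR (- (th * g / 2)) * e ^+ m else 0).
  rewrite wgtE; case: ifP => jm; last by rewrite mul0r.
  rewrite -expRD -expRM_natl -expRD ler_expR.
  have := varle m j i b jm; have := tilt_ge m.
  have thg : 0 <= th * g.
    have h0 : 0 <= 2 * th ^+ 2 * v ^+ 2 * Del.
      apply: mulr_ge0 (ltW Del_gt0); apply: mulr_ge0 (sqr_ge0 v).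
      by apply: mulr_ge0 (sqr_ge0 th).
    by have := le_trans h0 th_le; lra.
  move=> ht; have : th * g * (1 + m%:R / 20) <= th * g * noise_tilt m by rewrite ler_wpM2l.
  by move: (\sum_(_ < _) _) => u; lra.
have -> : \sum_a wgt a * expR (\sum_(l < L) \sum_i coef a l i ^+ 2 * dl / 2) =
  \sum_(m < M.+1) \sum_(j < L) \sum_i \sum_(b : bool)
    wgt (m, j, i, b) * expR (\sum_(l < L) \sum_i' coef (m, j, i, b) l i' ^+ 2 * dl / 2).
  by rewrite !pair_big/=; apply: eq_bigr => -[[[m j] i] b].
apply: (@le_trans _ _ (\sum_(m < M.+1) 2 * dim%:R * expR (- (th * g / 2)) * 2^-1 ^+ m)).
  apply: ler_sum => m _; have mM : (m <= M)%N by rewrite -ltnS.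
  have mL : (2 ^ m <= L)%N by rewrite leq_exp2l.
  apply: (@le_trans _ _ (\sum_(j < L) (if (j < 2 ^ m)%N then
      2 * dim%:R * (expR (- (th * g / 2)) * e ^+ m) else 0))).
    apply: ler_sum => j _.
    apply: (@le_trans _ _ (\sum_(i < dim) \sum_(b : bool)
      (if (j < 2 ^ m)%N then expR (- (th * g / 2)) * e ^+ m else 0))).
      by apply: ler_sum => i _; apply: ler_sum => b _; exact: wle.
    rewrite sumr_const card_ord sumr_const card_bool.
    by case: ifP => _; rewrite ?mul0rn// -mulrnA -[leLHS]mulr_natl natrM.
  rewrite -big_mkcond -(big_ord_widen _ (fun j => 2 * dim%:R * (expR (- (th * g / 2)) * e ^+ m)) mL).
  rewrite sumr_const card_ord -[leLHS]mulr_natr natrX -!mulrA.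
  rewrite !ler_wpM2l ?expR_ge0// -exprMn lerXn2r ?nnegrE ?mulr_ge0//.
  by have := thg_ge; rewrite -/e; lra.
rewrite -mulr_sumr.
have : \sum_(m < M.+1) 2^-1 ^+ m <= 2 :> R.
  suff -> : \sum_(m < M.+1) 2^-1 ^+ m = 2 - 2^-1 ^+ M :> R.
    by rewrite gerBl exprn_ge0// invr_ge0.
  elim: M => [|M' IH]; first by rewrite big_ord1 !expr0; lra.
  by rewrite big_ord_recr/= IH exprS; lra.
have : 0 <= 2 * dim%:R * expR (- (th * g / 2)) by rewrite !mulr_ge0 ?expR_ge0.
move=> c0 /(ler_wpM2l c0); lra.
Qed.

Lemma psi_prod_expectation_le (n : nat) (C : nat -> R) (K : R) :
  (forall k, 0 <= C k) -> 0 < K -> K * (4 * dim%:R * expR (- (th * g / 2))) <= 1 ->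
  (\int[P]_w (\prod_(k < n) (1 + C k * psi M k w))%:E <=
   (\prod_(k < n) (1 + C k / K))%:E)%E.
Proof.
move=> C0 K0 K1.
have wgt_ge0 a : 0 <= wgt a.
  by case: a => -[[m j] i] b; rewrite /wgt; case: ifP => // _; exact: expR_ge0.
have := bm_prod_expectation bm dl_gt0 n L coef wgt_ge0 C0.
under eq_integral => w _ do under eq_bigr do rewrite -psi_expansion.
move=> ->; rewrite lee_fin.
have S0 : 0 <= \sum_a wgt a * expR (\sum_(l < L) \sum_i coef a l i ^+ 2 * dl / 2).
  by apply: sumr_ge0 => a _; rewrite mulr_ge0 ?expR_ge0.
apply: ler_prod => k _; rewrite addr_ge0 ?mulr_ge0//=.
rewrite lerD2l ler_wpM2l//; apply: le_trans psi_wgt_sum_le _.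
by rewrite -[K^-1]mul1r ler_pdivlMr// mulrC.
Qed.

End level.
End noise.

(** * Passage to all dyadic levels *)

Section monotone_noise.
Context d (Omega : measurableType d) (R : realType) (P : probability Omega R).
Context (psi : nat -> nat -> Omega -> R) (K : R).
Hypothesis mpsi : forall M k, measurable_fun setT (psi M k).
Hypothesis psi_ge0 : forall M k w, 0 <= psi M k w.
Hypothesis psi_mono : forall k w, nondecreasing_seq (fun M => psi M k w).
Hypothesis K_gt0 : 0 < K.
Hypothesis psi_prod : forall n (C : nat -> R) M, (forall k, 0 <= C k) ->
  (\int[P]_w (\prod_(k < n) (1 + C k * psi M k w))%:E <=
   (\prod_(k < n) (1 + C k / K))%:E)%E.

Definition psi_sup (k : nat) (w : Omega) : R :=
  sup (range (fun M => psi M k w)).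

(** Elsewhere the real [sup] in [psi_sup] is only a default value. *)
Definition psi_bounded (w : Omega) : Prop :=
  forall k, has_ubound (range (fun M => psi M k w)).

Let H n (C : nat -> R) (w : Omega) : \bar R :=
  limn (fun M => (\prod_(k < n) (1 + C k * psi M k w))%:E).

Let prod_mono n (C : nat -> R) w : (forall k, 0 <= C k) ->
  nondecreasing_seq (fun M => (\prod_(k < n) (1 + C k * psi M k w))%:E : \bar R).
Proof.
move=> CK M M' MM'; rewrite lee_fin; apply: ler_prod => k _.
have C0 := CK k.
rewrite addr_ge0 ?mulr_ge0//= lerD2l ler_wpM2l//.
exact: psi_mono.
Qed.

Let H_cvg n (C : nat -> R) w : (forall k, 0 <= C k) ->
  (fun M => (\prod_(k < n) (1 + C k * psi M k w))%:E) @ \oo --> H n C w.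
Proof.
by move=> CK; apply/ereal_nondecreasing_is_cvgn; exact: prod_mono.
Qed.

Let prod_ge0 n (C : nat -> R) M w : (forall k, 0 <= C k) ->
  0 <= \prod_(k < n) (1 + C k * psi M k w).
Proof.
move=> CK; apply: prodr_ge0 => k _; have C0 := CK k.
by rewrite addr_ge0 ?mulr_ge0.
Qed.

Let H_ge n (C : nat -> R) M w : (forall k, 0 <= C k) ->
  ((\prod_(k < n) (1 + C k * psi M k w))%:E <= H n C w)%E.
Proof.
move=> CK; have /cvg_lim HE := ereal_nondecreasing_cvgn (prod_mono n w CK).
by rewrite /H HE//; apply: ereal_sup_ubound; exists M.
Qed.

Let mprod n (C : nat -> R) M : measurable_fun setT
  (fun w => (\prod_(k < n) (1 + C k * psi M k w))%:E : \bar R).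
Proof.
apply/measurable_EFinP; apply: measurable_prod => k _.
by apply: measurable_funD => //; apply: measurable_funM.
Qed.

Let mH n (C : nat -> R) : (forall k, 0 <= C k) -> measurable_fun setT (H n C).
Proof.
move=> CK; apply: (emeasurable_fun_cvg
  (fun M w => (\prod_(k < n) (1 + C k * psi M k w))%:E)) => [M|w _].
  exact: mprod.
exact: H_cvg.
Qed.

Let H_ge0 n (C : nat -> R) w : (forall k, 0 <= C k) -> (0 <= H n C w)%E.
Proof.
by move=> CK; apply: le_trans (H_ge n 0 w CK); rewrite lee_fin prod_ge0.
Qed.

Let int_H n (C : nat -> R) : (forall k, 0 <= C k) -> (\int[P]_w H n C w <= (\prod_(k < n) (1 + C k / K))%:E)%E.
Proof.
move=> CK; rewrite monotone_convergence//.
- apply: lime_le.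
    apply/ereal_nondecreasing_is_cvgn => M M' MM'; apply: ge0_le_integral => //.
    + by move=> w _; rewrite lee_fin prod_ge0.
    + by move=> w _; exact: prod_mono.
  by apply: nearW => M; exact: psi_prod.
- by move=> M w _; rewrite lee_fin prod_ge0.
- by move=> w _; exact: prod_mono.
Qed.

Lemma psi_bounded_ae : {ae P, forall w, psi_bounded w}.
Proof.
apply: ae_foralln => k0.
(* With this choice the product reduces to [1 + K * psi M k0 w]; its limit in [M] is integrable,
   hence almost surely finite. *)
pose C k : R := if k == k0 then K else 0.
have CK k : 0 <= C k by rewrite /C; case: ifP => // _; exact: ltW.
have HE M w : \prod_(k < k0.+1) (1 + C k * psi M k w) = 1 + K * psi M k0 w.
  rewrite (bigD1 (@Ordinal k0.+1 k0 (ltnSn k0)))//= big1 => [|k kk0].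
    by rewrite mulr1 /C eqxx.
  rewrite /C; case: eqP => [kE|_]; last by rewrite mul0r addr0.
  by move/eqP: kk0; case; exact/val_inj.
have intH : P.-integrable setT (H k0.+1 C).
  apply/integrableP; split; first exact: mH.
  under eq_integral do rewrite gee0_abs ?H_ge0//.
  by apply: le_lt_trans (int_H _ _) _ => //; rewrite ltry.
have := integrable_ae measurableT intH.
apply: filterS => w /(_ I) Hfin.
exists ((fine (H k0.+1 C w) - 1) / K) => _ [M _ <-].
rewrite ler_pdivlMr// mulrC lerBrDl -HE -lee_fin fineK//.
exact: H_ge.
Qed.

Lemma psi_le_sup w M k : psi_bounded w -> psi M k w <= psi_sup k w.
Proof. by move=> bw; apply: ub_le_sup => //; exists M. Qed.

(** [G] is the limit taken in the extended reals: measurable on the whole space, and equal to the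
    product of suprema where these are finite. *)
Lemma psi_sup_majorant n (C : nat -> R) : (forall k, 0 <= C k) ->
  exists G : Omega -> \bar R, [/\ measurable_fun setT G,
    forall w, (0 <= G w)%E,
    (\int[P]_w G w <= (\prod_(k < n) (1 + C k / K))%:E)%E &
    forall w, psi_bounded w ->
      G w = (\prod_(k < n) (1 + C k * psi_sup k w))%:E].
Proof.
move=> CK; exists (H n C); split.
- exact: mH.
- by move=> w; exact: H_ge0.
- exact: int_H.
move=> w bw; apply/cvg_lim => //; apply: cvg_EFin; first exact: nearW.
apply: cvg_big => [|k _]; first exact: mul_continuous.
apply: cvgD; first exact: cvg_cst.
by apply: cvgMl_tmp; exact: nondecreasing_cvgn.
Qed.

End monotone_noise.

(** * Block dynamics of a single reflected path *)

Record weighted_substochastic (R : realType) (d : nat) (M : 'M[R]_d)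
    (h : 'cV[R]_d) (gam Ch : R) : Prop := {
  ws_ge0 : forall i j, 0 <= M i j ;
  ws_col : forall j, \sum_i M i j <= 1 ;
  ws_h_ge1 : forall i, 1 <= h i 0 ;
  ws_h_le : forall i, h i 0 <= Ch ;
  ws_Mh : forall i, (M *m h) i 0 <= (1 - gam) * h i 0 ;
  ws_gam_gt0 : 0 < gam ;
  ws_gam_lt1 : gam < 1 ;
  ws_Ch_ge1 : 1 <= Ch }.

Section path_blocks.
Context (R : realType) (d : nat) (Rf D : 'M[R]_d) (mu : 'cV[R]_d).
Context (h : 'cV[R]_d) (gam Ch del th Del : R).
Local Notation M := (1%:M - Rf).
Hypothesis ws : weighted_substochastic M h gam Ch.
Hypothesis del_gt0 : 0 < del.
Hypothesis th_gt0 : 0 < th.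
Hypothesis Del_gt0 : 0 < Del.
Hypothesis drift : forall i, (invmx Rf *m mu) i 0 < - del.

Definition step_rate : R := gam * del / (8 * Ch).
Local Notation c1 := step_rate.
Definition block_gain : R := c1 * Del.
Local Notation a := block_gain.
(** The chaining constant 8 turns this level into [gam * c1 * Del], the largest noise that
    [drift_step] regards as quiet. *)
Definition quiet_level : R := gam * c1 * Del / 8.
Local Notation g := quiet_level.
Definition excess (q : 'cV[R]_d) : R :=
  Num.max 0 (weighted_max h q - 2 * c1 / gam * Del).
(** At this rate the noisy part [8 * ln (psi k) / (th * gam)] of a cost contributes [ln (psi k) / 8]
    to the exponent. *)
Definition exp_rate : R := th * gam / 64.
Local Notation lam := exp_rate.

Context (b : R -> 'cV[R]_d) (psi : nat -> R).
Local Notation N t := (invmx Rf *m D *m b t).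
Hypothesis b_cont : forall i (r e : R), 0 <= r -> 0 < e ->
  exists2 eta : R, 0 < eta &
    forall u : R, 0 <= u -> `|u - r| < eta -> `|(N u) i 0 - (N r) i 0| < e.
Hypothesis psi_bound : forall k m j i (s : bool), (j < 2 ^ m)%N ->
  expR (th * (1 + noise_tilt R m) * ((4 / 3) ^+ m * ((-1) ^+ s *
     ((N (k%:R * Del + Del * j.+1%:R / 2 ^+ m)) i 0 -
      (N (k%:R * Del + Del * j%:R / 2 ^+ m)) i 0)))
    - th * noise_tilt R m * g) <= psi k.

Context (x0 : 'cV[R]_d) (x l : R -> 'cV[R]_d).
Hypothesis x0_ge0 : forall i, 0 <= x0 i 0.
Hypothesis sp : skorokhod_pair M (fun t => x0 + (D *m b t + t *: mu)) x l.
Hypothesis x_start : x 0 = x0.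

Let gam_gt0 := ws_gam_gt0 ws.
Let gam_lt1 := ws_gam_lt1 ws.
Let Ch_ge1 := ws_Ch_ge1 ws.

Lemma step_rate_gt0 : 0 < c1.
Proof. by rewrite /c1 divr_gt0 ?mulr_gt0// (lt_le_trans ltr01). Qed.

Lemma block_gain_gt0 : 0 < a.
Proof. by rewrite /a mulr_gt0 ?step_rate_gt0. Qed.

Lemma quiet_level_gt0 : 0 < g.
Proof.
have c0 := step_rate_gt0.
by rewrite /g divr_gt0// mulr_gt0// mulr_gt0//; exact: gam_gt0.
Qed.

Lemma exp_rate_gt0 : 0 < lam.
Proof. by rewrite /lam divr_gt0 ?mulr_gt0. Qed.

Lemma excess_ge0 q : 0 <= excess q.
Proof. by rewrite /excess le_max lexx. Qed.

Definition block_osc (k : nat) : R :=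
  if psi k < 1 then 8 * g else 8 * Num.max g (ln (psi k) / th).
Definition block_cost (k : nat) : R :=
  if psi k < 1 then 0 else a + block_osc k / gam.

Lemma psi_gt0 k : 0 < psi k \/ d = 0%N.
Proof.
case: (posnP d) => [->|d0]; [by right|left].
apply: lt_le_trans (@psi_bound k 0%N 0%N (Ordinal d0) false isT).
exact: expR_gt0.
Qed.

Let h_gt0 i : 0 < h i 0.
Proof. exact: lt_le_trans ltr01 (ws_h_ge1 ws i). Qed.

Let c_lt1 : 1 - gam < 1.
Proof. by rewrite ltrBlDr ltrDl. Qed.

Lemma block_osc_ge k (u v : R) i : k%:R * Del <= u -> u <= v -> v <= k.+1%:R * Del ->
  (N v) i 0 - (N u) i 0 <= block_osc k.
Proof.
move=> ku uv vk.
have kD0 : 0 <= k%:R * Del by rewrite mulr_ge0// ltW.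
have kD : k.+1%:R * Del = k%:R * Del + Del by rewrite -natr1 mulrDl mul1r.
have osc (y : R) : (forall m j, (j < 2 ^ m)%N -> forall s : bool,
    (4 / 3) ^+ m * ((-1) ^+ s *
      ((N (k%:R * Del + Del * j.+1%:R / 2 ^+ m)) i 0 -
       (N (k%:R * Del + Del * j%:R / 2 ^+ m)) i 0)) <= y) ->
    (N v) i 0 - (N u) i 0 <= 8 * y.
  move=> H; apply: (@chaining _ (fun t => (N t) i 0) (k%:R * Del) Del y) => //.
  - exact: b_cont.
  - move=> m j jm; have := H m j jm true; have := H m j jm false.
    rewrite expr0 expr1 mul1r mulN1r.
    move: (_ - _) => z.
    have p0 : 0 < (4 / 3) ^+ m :> R by rewrite exprn_gt0.
    have -> : 3 / 4 = (4 / 3)^-1 :> R by field.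
    rewrite exprVn ler_norml => H1 H2; apply/andP; split.
      by rewrite lerNl mulrC ler_pdivlMr// mulrC.
    by rewrite mulrC ler_pdivlMr// mulrC.
  - by rewrite -kD; exact: le_trans uv vk.
  - exact: le_trans ku uv.
  - by rewrite -kD.
have tau0 m : 0 <= noise_tilt R m by rewrite exprn_ge0//; lra.
have tb m j (s : bool) (jm : (j < 2 ^ m)%N) := expR_tilt_bound th_gt0 (tau0 m)
  quiet_level_gt0 (psi_bound k i s jm).
rewrite /block_osc; case: ifP => p1; apply: osc => m j jm s.
  by have [_] := tb m j s jm; apply.
by have [] := tb m j s jm.
Qed.

Lemma block_osc_ge0 k : 0 <= block_osc k.
Proof.
have := quiet_level_gt0 => g0; rewrite /block_osc; case: ifP => _.
  by rewrite mulr_ge0// ltW.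
by rewrite mulr_ge0// le_max ltW.
Qed.

Let Q t := invmx Rf *m x t.

Let Q_ge0 (t : R) i : 0 <= t -> 0 <= Q t i 0.
Proof.
move=> t0; have := invmx_1B_ge0 (ws_ge0 ws) h_gt0 (ws_Mh ws) c_lt1.
rewrite opprB addrC subrK => H; apply: H => j.
exact: sp_ge0 sp _ _ t0.
Qed.

Let Rf_unit : Rf \in unitmx.
Proof.
have := unitmx_1B (ws_ge0 ws) h_gt0 (ws_Mh ws) c_lt1.
by rewrite opprB addrC subrK.
Qed.

Let Q_fix t : M *m Q t = Q t - x t.
Proof.
rewrite mulmxBl mul1mx /Q; congr (_ - _).
by rewrite (mulKVmx Rf_unit).
Qed.

Let Q_zero (t : R) i : 0 <= t -> x t i 0 = 0 -> Q t i 0 <= (M *m Q t) i 0.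
Proof. by move=> t0 xt; rewrite Q_fix mxB_E xt subr0. Qed.

Let Q_incr (u v : R) i : 0 <= u -> u <= v ->
  Q v i 0 <= Q u i 0 + ((N v) i 0 - (N u) i 0) - del * (v - u) + (l v i 0 - l u i 0).
Proof.
move=> u0 uv.
have QE t : 0 <= t -> Q t = invmx Rf *m x0 + N t + t *: (invmx Rf *m mu) + l t.
  move=> t0; rewrite /Q.
  have -> : x t = x0 + D *m b t + t *: mu + Rf *m l t.
    rewrite (sp_eq sp t0) mulmxBl mul1mx /=; apply/colP => j.
    by rewrite !(mxB_E, mxD_E); ring.
  by rewrite !mulmxDr mulKmx// mulmxA scalemxAr.
rewrite (QE _ u0) (QE _ (le_trans u0 uv)).
have : (v - u) * (invmx Rf *m mu) i 0 <= (v - u) * - del.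
  by rewrite ler_wpM2l ?subr_ge0// ltW.
rewrite !mxD_E !(mxE scalemx_key).
by move: ((invmx Rf *m mu) i 0) ((N v) i 0) ((N u) i 0) => p q r; lra.
Qed.

Local Notation V k := (weighted_max h (Q (k%:R * Del))).

Lemma excess_step k :
  excess (Q (k.+1%:R * Del)) <=
    Num.max 0 (excess (Q (k%:R * Del)) - a) + block_cost k.
Proof.
have kD0 : 0 <= k%:R * Del by rewrite mulr_ge0// ltW.
have kD : k.+1%:R * Del = k%:R * Del + Del by rewrite -natr1 mulrDl mul1r.
have kD' : k.+1%:R * Del - k%:R * Del = Del by rewrite kD addrC addKr.
have kk : k%:R * Del <= k.+1%:R * Del by rewrite kD lerDl ltW.
have := weighted_max_step (ws_h_ge1 ws) (ws_h_le ws) (ws_ge0 ws) (ws_Mh ws)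
  gam_gt0 gam_lt1 del_gt0 Q_ge0 Q_zero Q_incr (sp_mono sp) (sp_hit sp) kD0 kk
  (block_osc_ge0 k) (fun u v i => @block_osc_ge k u v i).
rewrite kD' -mulrA (mulrC Del) mulrA => Vstep.
have rate : 8 * c1 <= del / Ch.
  rewrite /c1 (_ : 8 * _ = gam * (del / Ch)); last by field; rewrite gt_eqF// (lt_le_trans ltr01).
  by rewrite ler_piMl ?(ltW gam_lt1)// divr_ge0// ltW// (lt_le_trans ltr01).
have [quiet noisy] := drift_step gam_gt0 gam_lt1 step_rate_gt0 rate (ltW Del_gt0)
  (weighted_max_ge0 h _) (block_osc_ge0 k) Vstep.
rewrite /excess /block_cost; case: ifP => pk; last exact: noisy.
rewrite addr0; apply: quiet; rewrite /block_osc pk /g.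
by rewrite mulrC divfK.
Qed.

(** Small excess gives [V <= 3 * a / gam], so [Ch * V] is at most 3/8 of [del * Del], and quiet
    noise at most 1/8 of it: together half of the drift asked by [all_hit_zero]. *)
Lemma block_hits k : excess (Q (k%:R * Del)) <= a -> psi k < 1 ->
  forall i, exists r, [/\ k%:R * Del <= r, r <= k.+1%:R * Del & x r i 0 = 0].
Proof.
move=> ek pk.
have kD0 : 0 <= k%:R * Del by rewrite mulr_ge0// ltW.
have kD : k.+1%:R * Del = k%:R * Del + Del by rewrite -natr1 mulrDl mul1r.
have kD' : k.+1%:R * Del - k%:R * Del = Del by rewrite kD addrC addKr.
have kk : k%:R * Del <= k.+1%:R * Del by rewrite kD lerDl ltW.
apply: (all_hit_zero (ws_h_ge1 ws) (ws_h_le ws) Q_ge0 Q_incr (sp_hit sp) kD0 kk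
  (fun u v i => @block_osc_ge k u v i)).
rewrite kD' /block_osc pk.
have : V k <= 3 * a / gam.
  have : V k - 2 * c1 / gam * Del <= a.
    by apply: le_trans ek; rewrite /excess le_max lexx orbT.
  have : a <= a / gam by rewrite ler_pdivlMr// ler_piMr ?(ltW gam_lt1)// ltW// block_gain_gt0.
  by rewrite /a; lra.
have Ch0 : 0 < Ch by rewrite (lt_le_trans ltr01).
move=> /(ler_wpM2l (ltW Ch0)).
have -> : Ch * (3 * a / gam) = 3 / 8 * (del * Del).
  by rewrite /a /c1; field; rewrite !gt_eqF.
have : 8 * g <= del * Del / 8.
  have -> : 8 * g = gam ^+ 2 / Ch * (del * Del / 8).
    by rewrite /g /c1; field; rewrite gt_eqF.
  rewrite ler_piMl ?divr_ge0 ?mulr_ge0 ?(ltW del_gt0) ?(ltW Del_gt0)//.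
  rewrite ler_pdivrMr// mul1r (le_trans _ Ch_ge1)//.
  by rewrite exprn_ile1// ltW.
have : 0 < del * Del by rewrite mulr_gt0.
by lra.
Qed.

(** The bound is affine in [psi k], the shape whose products over blocks have a controlled
    expectation. The exponent [2 * lam * a] arises because [8 * g / gam = a]. *)
Lemma expR_block_cost k : (0 < d)%N ->
  expR (lam * block_cost k) <= 1 + expR (2 * lam * a) * psi k.
Proof.
move=> d0; have lam0 := exp_rate_gt0.
have [psi0|/eqP] := psi_gt0 k; last by rewrite -leqn0 leqNgt d0.
rewrite /block_cost; case: ltP => p1.
  by rewrite mulr0 expR0 lerDl mulr_ge0 ?expR_ge0// ltW.
have lnp : 0 <= ln (psi k) by rewrite ln_ge0.
have mx : Num.max g (ln (psi k) / th) <= g + ln (psi k) / th.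
  have := quiet_level_gt0 => g0.
  by rewrite ge_max lerDl lerDr (ltW g0) divr_ge0// ltW.
have cost : a + block_osc k / gam <= 2 * a + 8 * ln (psi k) / (th * gam).
  rewrite /block_osc ltNge p1/=.
  have -> : 2 * a + 8 * ln (psi k) / (th * gam) = a + 8 * (g + ln (psi k) / th) / gam.
    by rewrite /g /a; field; rewrite !gt_eqF.
  by rewrite lerD2l ler_wpM2r ?invr_ge0 ?(ltW gam_gt0)// ler_wpM2l.
apply: (@le_trans _ _ (expR (2 * lam * a + ln (psi k)))).
  rewrite ler_expR; apply: le_trans (ler_wpM2l (ltW lam0) cost) _.
  have -> : lam * (2 * a + 8 * ln (psi k) / (th * gam)) = 2 * lam * a + ln (psi k) / 8.
    by rewrite /lam; field; rewrite !gt_eqF.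
  by lra.
by rewrite expRD lnK ?posrE// lerDr.
Qed.

Lemma block_cost_ge0 k : 0 <= block_cost k.
Proof.
rewrite /block_cost; case: ifP => // _.
by rewrite addr_ge0 ?divr_ge0 ?block_osc_ge0 ?(ltW gam_gt0)// ltW// block_gain_gt0.
Qed.

Definition good_block (k : nat) : bool :=
  (excess (Q (k%:R * Del)) <= a)%R && (psi k < 1)%R.

Lemma sum_bad_blocks (n : nat) :
  a * (\sum_(k < n) ~~ good_block k)%:R <=
    excess (invmx Rf *m x0) + 2 * \sum_(k < n) block_cost k.
Proof.
have -> : invmx Rf *m x0 = Q (0%:R * Del) by rewrite mul0r /Q x_start.
apply: (@sum_bad_le _ (fun k => excess (Q (k%:R * Del))) block_cost a
  (fun k => psi k < 1)) => //.
- exact: block_gain_gt0.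
- by move=> k _; exact: excess_ge0.
- by move=> k _; exact: block_cost_ge0.
- move=> k _ pk; rewrite /block_cost (negbTE pk) lerDl divr_ge0 ?block_osc_ge0//.
  exact: ltW.
- by move=> k _; exact: excess_step.
Qed.

(** Exponentiating [excess_step] and using [expR (lam * Num.max 0 (f - a)) <= r * expR (lam * f) +
    1] gives the recursion solved by [geometric_recursion]. *)
Lemma excess_recursion (n : nat) (r : R) (w : nat -> R) : (0 < d)%N ->
  r = expR (- (lam * a)) -> (forall k, w k = 1 + expR (2 * lam * a) * psi k) ->
  expR (lam * excess (invmx Rf *m x (n%:R * Del))) <=
    r ^+ n * expR (lam * excess (invmx Rf *m x0)) * \prod_(k < n) w k +
    \sum_(j < n) r ^+ (n.-1 - j) * \prod_(k < n) (if (j <= k)%N then w k else 1).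
Proof.
move=> d0 rE wE; have lam0 := exp_rate_gt0.
have -> : invmx Rf *m x0 = Q (0%:R * Del) by rewrite mul0r /Q x_start.
rewrite -/(Q _).
apply: (@geometric_recursion _ (fun k => expR (lam * excess (Q (k%:R * Del)))) w).
- by rewrite rE expR_ge0.
- move=> k; have [psi0|/eqP] := psi_gt0 k; last by rewrite -leqn0 leqNgt d0.
  by rewrite wE addr_ge0// mulr_ge0 ?expR_ge0// ltW.
move=> k _.
have : lam * excess (Q (k.+1%:R * Del)) <=
    lam * (Num.max 0 (excess (Q (k%:R * Del)) - a) + block_cost k).
  by rewrite ler_pM2l// excess_step.
rewrite mulrDr -ler_expR expRD => /le_trans; apply.
apply: ler_pM; rewrite ?expR_ge0//; last by rewrite wE; exact: expR_block_cost.
rewrite maxr_pMr ?(ltW lam0)// mulr0.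
have e0 := expR_ge0 (lam * excess (Q (k%:R * Del))).
rewrite maxElt; case: ifP => _.
  by rewrite mulrBr expRD -rE mulrC lerDl.
by rewrite expR0 lerDr mulr_ge0 ?rE ?expR_ge0.
Qed.

End path_blocks.

(** * Gap between one path and the minorant after n blocks *)

Lemma norm1_ge0 (R : realType) (d : nat) (z : 'cV[R]_d) : 0 <= norm1 z.
Proof. exact: sumr_ge0. Qed.

Lemma norm1_ge0E (R : realType) (d : nat) (z : 'cV[R]_d) :
  (forall i, 0 <= z i 0) -> norm1 z = \sum_i z i 0.
Proof. by move=> z0; apply: eq_bigr => i _; rewrite ger0_norm. Qed.

Lemma norm1_triangle (R : realType) (d : nat) (x y z : 'cV[R]_d) :
  norm1 (x - y) <= norm1 (x - z) + norm1 (y - z).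
Proof.
rewrite /norm1 -big_split/= ler_sum// => i _; rewrite !mxB_E.
by rewrite (distrC (y i 0)) -{1}(subrK (z i 0) (x i 0)) -addrA ler_normD.
Qed.

Lemma min1_le_sqrt (R : realType) (y : R) : 0 <= y -> Num.min 1 y <= Num.sqrt y.
Proof.
move=> y0; have [y1|y1] := leP 1 y; first by rewrite -{1}sqrtr1 ler_wsqrtr.
rewrite -{1}(sqr_sqrtr y0) expr2 ler_piMl ?sqrtr_ge0//.
by rewrite -[leRHS]sqrtr1 ler_wsqrtr// ltW.
Qed.

Lemma sum_negb (n : nat) (p : pred nat) :
  (\sum_(k < n) p k + \sum_(k < n) ~~ p k)%N = n.
Proof.
rewrite -big_split/= (eq_bigr (fun=> 1%N)); last by move=> k _; case: (p k).
by rewrite sum_nat_const card_ord muln1.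
Qed.

Section path_gap.
Context (R : realType) (d : nat) (Rf D : 'M[R]_d) (mu : 'cV[R]_d).
Context (h : 'cV[R]_d) (gam Ch del th Del kappa beta : R).
Local Notation M := (1%:M - Rf).
Hypothesis ws : weighted_substochastic M h gam Ch.
Hypothesis del_gt0 : 0 < del.
Hypothesis th_gt0 : 0 < th.
Hypothesis Del_gt0 : 0 < Del.
Hypothesis drift : forall i, (invmx Rf *m mu) i 0 < - del.
Hypothesis kappa_gt0 : 0 < kappa.
Hypothesis beta_gt0 : 0 < beta.
Hypothesis beta_lt1 : beta < 1.
Hypothesis decay : forall n i,
  (M ^+ n *m const_mx 1 : 'cV_d) i 0 <= kappa * (1 - beta) ^+ n.
Local Notation a := (block_gain gam Ch del Del).
Local Notation g := (quiet_level gam Ch del Del).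
Local Notation excess := (excess h gam Ch del Del).
Local Notation cost := (block_cost gam Ch del th Del).

Context (b : R -> 'cV[R]_d) (psi : nat -> R).
Local Notation N t := (invmx Rf *m D *m b t).
Hypothesis b_cont : forall i (r e : R), 0 <= r -> 0 < e ->
  exists2 eta : R, 0 < eta &
    forall u : R, 0 <= u -> `|u - r| < eta -> `|(N u) i 0 - (N r) i 0| < e.
Hypothesis psi_bound : forall k m j i (s : bool), (j < 2 ^ m)%N ->
  expR (th * (1 + noise_tilt R m) * ((4 / 3) ^+ m * ((-1) ^+ s *
     ((N (k%:R * Del + Del * j.+1%:R / 2 ^+ m)) i 0 -
      (N (k%:R * Del + Del * j%:R / 2 ^+ m)) i 0)))
    - th * noise_tilt R m * g) <= psi k.

(** Half of the [n] blocks being good bounds the relative gap by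
    [Y = d * kappa * exp (- beta * n / 2)], and it is always at most 1; [min (1, Y) <= sqrt Y]
    trades half of the rate for the square root of [d]. *)
Definition gap_factor (n : nat) : R :=
  Num.sqrt (d%:R * kappa) * expR (- (beta * n%:R / 4)).

Let factor_bound (x0 : 'cV[R]_d) (n m : nat) : (forall i, 0 <= x0 i 0) ->
  n%:R / 2 <= m%:R :> R ->
  \sum_i (M ^+ m *m x0) i 0 <= norm1 x0 * gap_factor n.
Proof.
move=> x0_ge0 nm; rewrite norm1_ge0E//.
have S0 : 0 <= \sum_i x0 i 0 by apply: sumr_ge0.
have dk : 0 <= d%:R * kappa by rewrite mulr_ge0// ltW.
have rho0 : 0 <= 1 - beta by rewrite subr_ge0 ltW.
pose Y := d%:R * kappa * expR (- (beta * n%:R / 2)).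
have Y0 : 0 <= Y by rewrite mulr_ge0 ?expR_ge0.
have -> : gap_factor n = Num.sqrt Y.
  rewrite /Y sqrtrM// /gap_factor; congr (_ * _).
  rewrite (_ : - (beta * n%:R / 2) = - (beta * n%:R / 4) * 2%:R); last by lra.
  by rewrite expRM_natr sqrtr_sqr ger0_norm ?expR_ge0.
apply: (@le_trans _ _ ((\sum_i x0 i 0) * Num.min 1 Y)); last first.
  by rewrite ler_wpM2l// min1_le_sqrt.
rewrite minr_pMr// mulr1 le_min.
rewrite (sum_exprmx_le (ws_ge0 ws))//=; last exact: ws_col ws.
have kr : 0 <= kappa * (1 - beta) ^+ m by rewrite mulr_ge0 ?exprn_ge0// ltW.
apply: le_trans (sum_exprmx_le_decay (ws_ge0 ws) decay kr x0_ge0) _.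
rewrite mulrC ler_wpM2l// /Y mulrA ler_wpM2l//.
apply: (@le_trans _ _ (expR (- beta) ^+ m)).
  by rewrite lerXn2r ?nnegrE ?expR_ge0// -[1 - beta]/(1 + - beta) expR_ge1Dx.
rewrite -expRM_natl ler_expR.
have : beta * (n%:R / 2) <= beta * m%:R by rewrite ler_wpM2l// ltW.
by lra.
Qed.

(** The boolean is an indicator. When it vanishes, [sum_bad_blocks] leaves at least [n / 2] good
    blocks; otherwise the gap is bounded by the initial norm. *)
Lemma path_gap (T : R) (n : nat) (x0 : 'cV[R]_d) (x l z l' : R -> 'cV[R]_d) :
  (forall i, 0 <= x0 i 0) ->
  skorokhod_pair M (fun t => x0 + (D *m b t + t *: mu)) x l -> x 0 = x0 ->
  n%:R * Del <= T ->
  (forall t : R, 0 <= t -> t <= T -> z t = (D *m b t + t *: mu) + l' t - M *m l' t) ->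
  dominates T l l' ->
  (forall (t : R) i, 0 <= t -> t <= T -> 0 <= z t i 0 <= x t i 0) ->
  norm1 (x T - z T) <= norm1 x0 * (gap_factor n +
    (a * n%:R / 2 < excess (invmx Rf *m x0) + 2 * \sum_(k < n) cost psi k)%R%:R).
Proof.
move=> x0_ge0 sp x_start nT zE ll' zx.
have a0 := block_gain_gt0 ws del_gt0 Del_gt0.
have nD0 : 0 <= n%:R * Del by rewrite mulr_ge0// ltW.
have T0 := le_trans nD0 nT.
have h_gt0 i : 0 < h i 0 by exact: lt_le_trans ltr01 (ws_h_ge1 ws i).
have c_lt1 : 1 - gam < 1 by rewrite ltrBlDr ltrDl (ws_gam_gt0 ws).
pose good := good_block Rf h gam Ch del Del psi x.
have gf0 : 0 <= gap_factor n by rewrite mulr_ge0 ?sqrtr_ge0 ?expR_ge0.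
have n10 := norm1_ge0 x0.
have gap : norm1 (x T - z T) <= \sum_i (M ^+ (\sum_(k < n) good k) *m x0) i 0.
  apply: (gap_contraction (ws_ge0 ws) (ws_col ws) h_gt0 (ws_Mh ws) c_lt1 T0 sp zE ll' zx
    (tau := fun k => k%:R * Del)) => //.
  - by rewrite mul0r.
  - by move=> k; rewrite ler_wpM2r ?(ltW Del_gt0)// ler_nat.
  - move=> k _ /andP[ek pk].
    exact: (block_hits ws del_gt0 th_gt0 Del_gt0 drift b_cont psi_bound sp).
apply: le_trans gap _.
case: ltP => H.
  apply: le_trans (sum_exprmx_le (ws_ge0 ws) _ (ws_col ws) x0_ge0) _.
  rewrite norm1_ge0E in n10 *; last exact: x0_ge0.
  by rewrite ler_peMr// lerDr.
rewrite addr0; apply: factor_bound => //.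
have := sum_bad_blocks ws del_gt0 th_gt0 Del_gt0 drift b_cont psi_bound sp x_start n.
rewrite -/good => /le_trans/(_ H).
rewrite -[in X in _ <= X -> _]mulrA ler_pM2l//.
have := sum_negb n good; move=> /(congr1 (fun k => k%:R : R)); rewrite natrD.
by lra.
Qed.

End path_gap.

(** * Measurability of the functionals involved *)

Section measurability.
Context (R : realType) (d : nat).

Lemma measurable_mulmx_entry (A : 'M[R]_d) (i : 'I_d) :
  measurable_fun setT (fun z : 'cV[R]_d => (A *m z) i 0).
Proof.
under eq_fun do rewrite mxE.
apply: measurable_sum => j; apply: measurable_funM => //.
exact: measurable_mx_entry.
Qed.

Lemma measurable_norm1B disp (T : measurableType disp) (X Y : T -> 'cV[R]_d) :
  measurable_fun setT X -> measurable_fun setT Y ->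
  measurable_fun setT (fun w => norm1 (X w - Y w)).
Proof.
move=> mX mY; apply: measurable_sum => i.
under eq_fun do rewrite mxB_E.
apply: (measurableT_comp (@normr_measurable R setT)).
by apply: measurable_funB; apply: (measurableT_comp (@measurable_mx_entry R d 1 i 0)).
Qed.

Lemma measurable_weighted_max (h : 'cV[R]_d) disp (T : measurableType disp)
    (q : T -> 'cV[R]_d) : (forall i, measurable_fun setT (fun w => q w i 0)) ->
  measurable_fun setT (fun w => weighted_max h (q w)).
Proof.
move=> mq; rewrite /weighted_max; elim: (index_enum _) => [|i s IH].
  by under eq_fun do rewrite big_nil; exact: measurable_cst.
under eq_fun do rewrite big_cons.
by apply: measurable_maxr => //; apply: measurable_funM.
Qed.

Lemma measurable_excess (h : 'cV[R]_d) gam Ch del Del (A : 'M[R]_d) :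
  measurable_fun setT (fun z : 'cV[R]_d => excess h gam Ch del Del (A *m z)).
Proof.
apply: measurable_maxr => //; apply: measurable_funB => //.
by apply: measurable_weighted_max => i; exact: measurable_mulmx_entry.
Qed.

End measurability.

(** * Gap of two reflected Brownian motions, and its expectation *)

Section model.
Context (R : realType) (d : nat) (Rf D : 'M[R]_d) (mu : 'cV[R]_d).
Context (h : 'cV[R]_d) (gam Ch del th Del kappa beta v : R).
Local Notation M := (1%:M - Rf).
Hypothesis d_gt0 : (0 < d)%N.
Hypothesis ws : weighted_substochastic M h gam Ch.
Hypothesis del_gt0 : 0 < del.
Hypothesis th_gt0 : 0 < th.
Hypothesis Del_gt0 : 0 < Del.
Hypothesis drift : forall i, (invmx Rf *m mu) i 0 < - del.
Hypothesis kappa_gt0 : 0 < kappa.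
Hypothesis beta_gt0 : 0 < beta.
Hypothesis beta_lt1 : beta < 1.
Hypothesis decay : forall n i,
  (M ^+ n *m const_mx 1 : 'cV_d) i 0 <= kappa * (1 - beta) ^+ n.
Local Notation W := (invmx Rf *m D).
Local Notation a := (block_gain gam Ch del Del).
Local Notation g := (quiet_level gam Ch del Del).
Local Notation lam := (exp_rate gam th).
Local Notation K := (expR (2 * lam * a)).
Local Notation excess := (excess h gam Ch del Del).
Hypothesis W_row : forall i, \sum_j W i j ^+ 2 <= v ^+ 2.
Hypothesis th_le : 2 * th ^+ 2 * v ^+ 2 * Del <= th * g / 2.
Hypothesis thg_ge : expR (- (th * g / 20)) <= 4^-1.
Hypothesis K_le : K * (4 * d%:R * expR (- (th * g / 2))) <= 1.
Hypothesis gain_ge : 2 <= expR (lam * a / 16).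

Context (disp : measure_display) (Omega : measurableType disp).
Context (P : probability Omega R) (B : R -> {RV P >-> 'cV[R]_d}).
Hypothesis bm : brownian_motion B.

Let psiM := psi B W Del th g.
Let psiS := psi_sup psiM.

Lemma measurable_psi m k : measurable_fun setT (psiM m k).
Proof.
apply: measurable_sum => m'; apply: measurable_sum => j.
apply: measurable_sum => i; apply: measurable_sum => s.
apply: (measurableT_comp (@measurable_expR R)).
apply: measurable_funB => //; do 3 apply: measurable_funM => //.
have mN t : measurable_fun setT (fun w => noise B W w t i 0).
  by apply: (measurableT_comp (measurable_mulmx_entry W i)); exact: measurable_funPT.
by apply: measurable_funB; exact: mN.
Qed.

Lemma psi_ge0 m k w : 0 <= psiM m k w.
Proof. by do 4 apply: sumr_ge0 => ? _; exact: expR_ge0. Qed.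

Lemma psi_nondecreasing k w : nondecreasing_seq (fun m => psiM m k w).
Proof.
apply/nondecreasing_seqP => m; rewrite /psiM /psi [leRHS]big_ord_recr/= lerDl.
by do 3 apply: sumr_ge0 => ? _; exact: expR_ge0.
Qed.

Let psi_expectation n (C : nat -> R) m : (forall k, 0 <= C k) ->
  (\int[P]_w (\prod_(k < n) (1 + C k * psiM m k w))%:E <=
   (\prod_(k < n) (1 + C k / K))%:E)%E.
Proof.
move=> C0; apply: (psi_prod_expectation_le bm Del_gt0 th_gt0 W_row th_le thg_ge) => //.
exact: expR_gt0.
Qed.

Definition regular_path (w : Omega) : Prop :=
  [/\ psi_bounded psiM w, B 0 w = 0 &
      {within `[0, +oo[, continuous (fun t => B t w)}].

Lemma regular_path_ae : {ae P, forall w, regular_path w}.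
Proof.
have := psi_bounded_ae measurable_psi psi_ge0 psi_nondecreasing (expR_gt0 _) psi_expectation.
have := bm_start bm; have := bm_continuous bm.
by apply: filterS3 => w ? ? ?; split.
Qed.

Lemma regular_path_noise w i (r e : R) : regular_path w -> 0 <= r -> 0 < e ->
  exists2 eta : R, 0 < eta & forall u : R, 0 <= u -> `|u - r| < eta ->
    `|(W *m B u w) i 0 - (W *m B r w) i 0| < e.
Proof.
move=> [_ _ cB] r0 e0; apply: (@within_continuousP R (fun t => (W *m B t w) i 0)) => //.
rewrite (_ : (fun t => _) = fun t => \sum_j W i j * B t w j 0); last first.
  by apply/funext => t; rewrite mxE.
apply/subspace_continuousP => t t0.
apply: cvg_big => [|j _]; first exact: add_continuous.
apply: cvgMl_tmp.
move/subspace_continuousP: cB => /(_ t t0) cB.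
exact: (cvg_comp _ _ cB (@coord_continuous _ _ _ j 0 (B t w))).
Qed.

Lemma regular_path_psi w k m j i (s : bool) : regular_path w -> (j < 2 ^ m)%N ->
  expR (th * (1 + noise_tilt R m) * ((4 / 3) ^+ m * ((-1) ^+ s *
     ((W *m B (k%:R * Del + Del * j.+1%:R / 2 ^+ m) w) i 0 -
      (W *m B (k%:R * Del + Del * j%:R / 2 ^+ m) w) i 0)))
    - th * noise_tilt R m * g) <= psiS k w.
Proof.
move=> [bw _ _] jm.
apply: le_trans (psi_le_sup m k bw).
rewrite -[X in X <= _]/(psi_term B W Del th g k m j i s w).
have T0 k' m' j' i' s' : 0 <= psi_term B W Del th g k' m' j' i' s' w by exact: expR_ge0.
rewrite /psiM /psi big_ord_recr/=.
have -> : psi_term B W Del th g k m j i s w =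
    0 + psi_term B W Del th g k m (Ordinal jm) i s w by rewrite add0r.
apply: lerD; first by do 4 apply: sumr_ge0 => ? _.
rewrite (bigD1 (Ordinal jm))//= (bigD1 i)//= (bigD1 s)//= -!addrA lerDl.
by rewrite !addr_ge0//; do ?[apply: sumr_ge0 => ? _].
Qed.

Definition rbm_path (w : Omega) (x0 : 'cV[R]_d) (x : R -> 'cV[R]_d) : Prop :=
  x 0 = x0 /\ exists l, skorokhod_pair M (fun t => x0 + (D *m B t w + t *: mu)) x l.

Lemma is_RBM_path (xi : Omega -> 'cV[R]_d) (X : R -> {RV P >-> 'cV[R]_d}) :
  is_RBM D mu Rf B xi X -> {ae P, forall w, rbm_path w (xi w) (X^~ w)}.
Proof.
move=> [L]; have := bm_start bm; apply: filterS2 => w B0 rp.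
split.
  rewrite (rp_decomp rp (lexx 0)) B0 mulmx0 scale0r !addr0.
  by rewrite (rp_regulator_start rp) mulmx0 addr0.
exists (L^~ w); have := reflected_path_skorokhod rp.
by under eq_fun do rewrite -addrA.
Qed.

Lemma rbm_path_ge0 w x0 x : rbm_path w x0 x -> forall i, 0 <= x0 i 0.
Proof. by move=> [<- [l sp]] i; exact: sp_ge0 sp _ _ (lexx 0). Qed.


Local Notation cost k w := (block_cost gam Ch del th Del (psiS ^~ w) k).

Definition block_prod (n : nat) (w : Omega) : R :=
  \prod_(k < n) (1 + K * psiS k w).

Lemma expR_sum_cost n w : regular_path w ->
  expR (lam * \sum_(k < n) cost k w) <= block_prod n w.
Proof.
move=> rw; rewrite mulr_sumr expR_sum; apply: ler_prod => k _.
rewrite expR_ge0/=; apply: (expR_block_cost ws del_gt0 th_gt0 Del_gt0 (b := fun t => B t w)) => //.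
by move=> k' m j i s jm; exact: regular_path_psi.
Qed.

Lemma block_prod_ge0 n w : regular_path w -> 0 <= block_prod n w.
Proof. by move=> rw; apply: le_trans (expR_sum_cost n rw); exact: expR_ge0. Qed.

Lemma rbm_gap w x0 y0 x y t n : regular_path w ->
  rbm_path w x0 x -> rbm_path w y0 y -> n%:R * Del <= t ->
  norm1 (x t - y t) <=
    norm1 x0 * (gap_factor d kappa beta n +
      (a * n%:R / 2 < excess (invmx Rf *m x0) + 2 * \sum_(k < n) cost k w)%R%:R) +
    norm1 y0 * (gap_factor d kappa beta n +
      (a * n%:R / 2 < excess (invmx Rf *m y0) + 2 * \sum_(k < n) cost k w)%R%:R).
Proof.
move=> rw px py nt.
have x00 := rbm_path_ge0 px; have y00 := rbm_path_ge0 py.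
have [x0E [lx sx]] := px; have [y0E [ly sy]] := py.
have h_gt0 i : 0 < h i 0 by exact: lt_le_trans ltr01 (ws_h_ge1 ws i).
have c_lt1 : 1 - gam < 1 by rewrite ltrBlDr ltrDl (ws_gam_gt0 ws).
have t0 : 0 <= t by apply: le_trans nt; rewrite mulr_ge0// ltW.
have [z [l' [zxy zE ldx ldy]]] := common_minorant (ws_ge0 ws) t0 h_gt0 (ws_Mh ws) c_lt1
  x00 y00 sx sy.
have bc i r e := @regular_path_noise w i r e rw.
have bpsi k m j i s := @regular_path_psi w k m j i s rw.
apply: le_trans (norm1_triangle _ _ (z t)) _.
apply: lerD.
  apply: (path_gap ws del_gt0 th_gt0 Del_gt0 drift kappa_gt0 beta_gt0 beta_lt1 decay
    bc bpsi x00 sx x0E nt zE ldx).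
  by move=> u i u0 ut; have [-> ->] := zxy u i u0 ut.
apply: (path_gap ws del_gt0 th_gt0 Del_gt0 drift kappa_gt0 beta_gt0 beta_lt1 decay
  bc bpsi y00 sy y0E nt zE ldy).
by move=> u i u0 ut; have [-> _ ->] := zxy u i u0 ut.
Qed.

(** Chernoff bound at rate [lam / 2], so that the doubled cost [2 * S] appears with the rate [lam]
    of [expR_sum_cost]. *)
Lemma bad_le_exp (e0 S : R) n w : regular_path w -> S = \sum_(k < n) cost k w ->
  (a * n%:R / 2 < e0 + 2 * S)%R%:R <=
    expR (lam * e0 / 2 - lam * a * n%:R / 4) * block_prod n w.
Proof.
move=> rw SE; have lam0 := exp_rate_gt0 ws th_gt0.
have bp := expR_sum_cost n rw; have bp0 := block_prod_ge0 n rw.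
case: ltP => [bad|_]; last by rewrite mulr_ge0 ?expR_ge0.
apply: (@le_trans _ _ (expR (lam * e0 / 2 - lam * a * n%:R / 4) * expR (lam * S))).
  rewrite -expRD -{1}expR0 ler_expR.
  have : 0 <= lam * (e0 + 2 * S - a * n%:R / 2).
    by rewrite mulr_ge0 ?(ltW lam0)// subr_ge0 ltW.
  by lra.
by rewrite ler_wpM2l ?expR_ge0// SE.
Qed.

Lemma id_le_expR (c x : R) : 0 < c -> x <= expR (c * x) / c.
Proof.
move=> c0; rewrite ler_pdivlMr// mulrC; apply: le_trans (expR_ge1Dx _).
by rewrite lerDr.
Qed.

(** If [e0 > a * n / 4], its own exponential pays; otherwise [S > a * n / 8] and the noise pays. The
    initial value and the noise thus sit in separate summands, and no joint moment arises. *)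
Lemma bad_mul_le_exp (z0 e0 S : R) n w : regular_path w -> 0 <= z0 -> 0 <= e0 ->
  S = \sum_(k < n) cost k w ->
  (z0 + e0) * (a * n%:R / 2 < e0 + 2 * S)%R%:R <=
    (z0 + 2 / lam) * expR (- (lam * a * n%:R / 8)) * expR (lam * e0) +
    (z0 + a * n%:R / 4) * expR (- (lam * a * n%:R / 8)) * block_prod n w.
Proof.
move=> rw z00 e00 SE; have lam0 := exp_rate_gt0 ws th_gt0.
have a0 := block_gain_gt0 ws del_gt0 Del_gt0.
have bp := expR_sum_cost n rw; have bp0 := block_prod_ge0 n rw.
have n0 : 0 <= a * n%:R by rewrite mulr_ge0// ltW.
have l20 : 0 <= 2 / lam by rewrite divr_ge0// ltW.
have T1 : 0 <= (z0 + 2 / lam) * expR (- (lam * a * n%:R / 8)) * expR (lam * e0).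
  by rewrite !mulr_ge0 ?expR_ge0// addr_ge0.
have T2 : 0 <= (z0 + a * n%:R / 4) * expR (- (lam * a * n%:R / 8)) * block_prod n w.
  by rewrite !mulr_ge0 ?expR_ge0// addr_ge0// divr_ge0.
case: ltP => [bad|_]; last by rewrite mulr0 addr_ge0.
rewrite mulr1; have [e_small|e_big] := leP e0 (a * n%:R / 4).
  apply: (@le_trans _ _ ((z0 + a * n%:R / 4) *
      (expR (- (lam * a * n%:R / 8)) * expR (lam * S)))); last first.
    rewrite -[leLHS]add0r lerD// -[leRHS]mulrA ler_wpM2l ?addr_ge0 ?divr_ge0//.
    by rewrite ler_wpM2l ?expR_ge0// SE.
  apply: (@le_trans _ _ (z0 + a * n%:R / 4)); first by rewrite lerD2l.
  rewrite ler_peMr ?addr_ge0 ?divr_ge0// -expRD -{1}expR0 ler_expR.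
  have : 0 <= lam * (S - a * n%:R / 8).
    by rewrite mulr_ge0 ?(ltW lam0)// subr_ge0; lra.
  by lra.
apply: (@le_trans _ _ ((z0 + 2 / lam) *
    (expR (- (lam * a * n%:R / 8)) * expR (lam * e0)))); last first.
  by rewrite mulrA -[leLHS]addr0 lerD.
apply: (@le_trans _ _ ((z0 + 2 / lam) * expR (lam / 2 * e0))).
  rewrite mulrDl lerD//.
    by rewrite ler_peMr// -expR0 ler_expR mulr_ge0// divr_ge0// ltW.
  have l2 : 0 < lam / 2 by rewrite divr_gt0.
  by have := id_le_expR e0 l2; rewrite invf_div mulrC.
rewrite ler_wpM2l ?addr_ge0// -expRD ler_expR.
have : 0 <= lam * (e0 - a * n%:R / 4).
  by rewrite mulr_ge0 ?(ltW lam0)// subr_ge0 ltW.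
by lra.
Qed.

(** Each of the [n - j] active factors contributes [1 + K / K = 2]. *)
Lemma block_prod_majorant n j : exists G : Omega -> \bar R,
  [/\ measurable_fun setT G, forall w, (0 <= G w)%E,
      (\int[P]_w G w <= (2 ^+ (n - j))%:E)%E &
      forall w, regular_path w ->
        G w = (\prod_(k < n) (if (j <= k)%N then 1 + K * psiS k w else 1))%:E].
Proof.
pose C k := if (j <= k)%N then K else 0.
have C0 k : 0 <= C k by rewrite /C; case: ifP => // _; exact: expR_ge0.
have [G [mG G0 intG GE]] := psi_sup_majorant measurable_psi psi_ge0
  psi_nondecreasing psi_expectation n C0.
exists G; split=> //.
  suff -> : (2 ^+ (n - j) : R) = \prod_(k < n) (1 + C k / K) by [].
  rewrite -prodr_const_nat big_geq_mkord big_mkcond/=.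
  apply: eq_bigr => k _; rewrite /C; case: ifP => _; last by rewrite mul0r addr0.
  by rewrite divff// gt_eqF// expR_gt0.
move=> w [bw _ _]; rewrite GE//; congr (_%:E); apply: eq_bigr => k _.
by rewrite /C; case: ifP => _ //; rewrite mul0r addr0.
Qed.

(** * Exponential moment of the stationary excess *)

Section stationary_moment.
Context (pi : probability 'cV[R]_d R) (Xinf : {RV P >-> 'cV[R]_d}).
Context (Y : R -> {RV P >-> 'cV[R]_d}).
Hypothesis Xinf_law : has_law Xinf pi.
Hypothesis Y_law : forall t : R, 0 <= t -> has_law (Y t) pi.
Hypothesis Y_path : {ae P, forall w, rbm_path w (Xinf w) (Y^~ w)}.

Let phi (z : 'cV[R]_d) : R := expR (lam * excess (invmx Rf *m z)).

Let mphi : measurable_fun setT phi.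
Proof.
apply: (measurableT_comp (@measurable_expR R)); apply: measurable_funM => //.
exact: measurable_excess.
Qed.

Let mphi_min J : measurable_fun setT (fun z => Num.min (phi z) J).
Proof. by apply: measurable_minr. Qed.

Let law_eq (J t : R) : 0 < J -> 0 <= t ->
  (\int[P]_w (Num.min (phi (Xinf w)) J)%:E = \int[P]_w (Num.min (phi (Y t w)) J)%:E)%E.
Proof.
move=> J0 t0.
have m0 z : 0 <= Num.min (phi z) J by rewrite le_min expR_ge0 ltW.
have mX : measurable_fun setT Xinf by exact: measurable_funPT.
have mYt : measurable_fun setT (Y t) by exact: measurable_funPT.
rewrite -(ge0_integral_law mX Xinf_law (mphi_min J) m0).
by rewrite -(ge0_integral_law mYt (Y_law t0) (mphi_min J) m0).
Qed.

(** Truncation at [J] keeps the stationarity identity between finite quantities. Off the tail event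
    the initial excess is at most [a * n / 2], so [r ^+ n] brings the initial term down to
    [expR (- (lam * a * n / 2)) * 2 ^+ n <= 1]; the sum over [j] gives 4, hence 5. *)
Let tail_le (J : R) (n : nat) : 0 < J ->
  (\int[P]_w (Num.min (phi (Xinf w)) J)%:E <=
   J%:E * P [set w | (a * n%:R / 2 < excess (invmx Rf *m Xinf w))%R] + 5%:E)%E.
Proof.
move=> J0; have lam0 := exp_rate_gt0 ws th_gt0.
have a0 := block_gain_gt0 ws del_gt0 Del_gt0.
have nD0 : 0 <= n%:R * Del by rewrite mulr_ge0// ltW.
rewrite (law_eq J0 nD0).
set A := [set w | _].
have mX : measurable_fun setT Xinf by exact: measurable_funPT.
have me : measurable_fun setT (fun w => excess (invmx Rf *m Xinf w)).
  exact: (measurableT_comp (@measurable_excess R d h gam Ch del Del (invmx Rf)) mX).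
have mA : measurable A.
  rewrite -[A]setTI; exact: measurable_fun_ltr.
have [G G_spec] := choice (block_prod_majorant n).
have mG j : measurable_fun setT (G j) by have [] := G_spec j.
have G0 j w : (0 <= G j w)%E by have [_] := G_spec j.
have iG j : (\int[P]_w G j w <= (2 ^+ (n - j))%:E)%E by have [] := G_spec j.
pose r := expR (- (lam * a)).
have r0 : 0 <= r by exact: expR_ge0.
pose rhs w := (J%:E * (\1_A w)%:E + ((expR (- (lam * a * n%:R / 2)))%:E * G 0%N w +
  \sum_(j < n) (r ^+ (n.-1 - j))%:E * G j w))%E.
have mscale c j : measurable_fun setT (fun w => c%:E * G j w)%E.
  by apply: emeasurable_funM.
have scale0 c j w : (0 <= c)%R -> (0 <= c%:E * G j w)%E.
  by move=> c0; rewrite mule_ge0 ?lee_fin.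
have mind : measurable_fun setT (fun w => J%:E * (\1_A w)%:E)%E.
  apply: emeasurable_funM => //; apply/measurable_EFinP; exact: measurable_indic.
have ind0 w : (0 <= J%:E * (\1_A w)%:E)%E.
  by rewrite mule_ge0 ?lee_fin// ltW.
have msum : measurable_fun setT (fun w => \sum_(j < n) (r ^+ (n.-1 - j))%:E * G j w)%E.
  by apply: emeasurable_sum => j; exact: mscale.
have sum0 w : (0 <= \sum_(j < n) (r ^+ (n.-1 - j))%:E * G j w)%E.
  by apply: sume_ge0 => j _; rewrite scale0// exprn_ge0.
have e0 : 0 <= expR (- (lam * a * n%:R / 2)) by exact: expR_ge0.
have mtail : measurable_fun setT (fun w => (expR (- (lam * a * n%:R / 2)))%:E * G 0%N w +
    \sum_(j < n) (r ^+ (n.-1 - j))%:E * G j w)%E.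
  by apply: emeasurable_funD => //; exact: mscale.
have tail0 w : (0 <= (expR (- (lam * a * n%:R / 2)))%:E * G 0%N w +
    \sum_(j < n) (r ^+ (n.-1 - j))%:E * G j w)%E.
  by rewrite adde_ge0// scale0.
have mY : measurable_fun setT (Y (n%:R * Del)) by exact: measurable_funPT.
apply: (@le_trans _ _ (\int[P]_w rhs w)%E).
  apply: ae_ge0_le_integral => //.
  - by move=> w _; rewrite lee_fin le_min expR_ge0 ltW.
  - by apply/measurable_EFinP; exact: (measurableT_comp (mphi_min J) mY).
  - by move=> w _; rewrite adde_ge0.
  - exact: emeasurable_funD.
  have := regular_path_ae; move: Y_path; apply: filterS2 => w [Y0 [l sp]] rw _.
  rewrite /rhs indicE; case: (boolP (w \in A)) => wA.
    rewrite mule1; apply: (@le_trans _ _ J%:E); first by rewrite lee_fin ge_min lexx orbT.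
    by rewrite leeDl.
  rewrite mule0 add0e.
  have bc i u e := @regular_path_noise w i u e rw.
  have bpsi k m j i s := @regular_path_psi w k m j i s rw.
  have := excess_recursion ws del_gt0 th_gt0 Del_gt0 drift bc bpsi sp Y0 n
    (w := fun k => 1 + K * psiS k w) d_gt0 (erefl r) (fun=> erefl).
  have /negP : ~ (a * n%:R / 2 < excess (invmx Rf *m Xinf w)).
    by move=> H; move/negP: wA; apply; rewrite inE.
  rewrite -leNgt => small rec.
  have GE j : G j w = (\prod_(k < n) (if (j <= k)%N then 1 + K * psiS k w else 1))%:E.
    by have [_ _ _] := G_spec j; exact.
  rewrite GE -EFinM.
  rewrite (eq_bigr (fun j : 'I_n => (r ^+ (n.-1 - j) *
    \prod_(k < n) (if (j <= k)%N then 1 + K * psiS k w else 1))%:E)); last first.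
    by move=> j _; rewrite GE -EFinM.
  rewrite sumEFin -EFinD lee_fin ge_min; apply/orP; left.
  apply: le_trans rec _; rewrite lerD2r.
  have -> : \prod_(k < n) (if (0 <= k)%N then 1 + K * psiS k w else 1) =
    \prod_(k < n) (1 + K * psiS k w) by apply: eq_bigr.
  rewrite ler_wpM2r ?block_prod_ge0// -expRM_natl -expRD ler_expR.
  have : lam * excess (invmx Rf *m Xinf w) <= lam * (a * n%:R / 2) by rewrite ler_pM2l.
  by lra.
have two_le : 2 <= expR (lam * a / 16) by [].
have r_small : r <= 4^-1.
  rewrite /r expRN lef_pV2 ?posrE ?expR_gt0//.
  apply: (@le_trans _ _ (expR (lam * a / 16) ^+ 2)).
    rewrite (_ : 4 = 2 ^+ 2); last by rewrite expr2; lra.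
    by rewrite ler_sqr ?nnegrE ?expR_ge0.
  rewrite -expRM_natl ler_expR.
  have : 0 <= lam * a by exact: mulr_ge0 (ltW lam0) (ltW a0).
  by lra.
rewrite ge0_integralD// [X in (_ + X)%E]ge0_integralD//; last first.
  by move=> w _; rewrite scale0.
apply: leeD.
  have m1 : measurable_fun setT (fun w => (\1_A w)%:E : \bar R).
    by apply/measurable_EFinP; exact: measurable_indic.
  rewrite (@ge0_integralZl _ _ _ P setT measurableT (fun w => (\1_A w)%:E) m1 J%:E).
  - by rewrite integral_indic// setIT.
  - by move=> w _; rewrite lee_fin.
  - by rewrite lee_fin ltW.
have -> : 5%:E = (1 + 4%:E)%E :> \bar R by rewrite -EFinD; congr (_%:E); lra.
apply: leeD.
  rewrite ge0_integralZl//.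
  apply: (@le_trans _ _ ((expR (- (lam * a * n%:R / 2)))%:E * (2 ^+ n)%:E)%E).
    by rewrite lee_wpmul2l ?lee_fin//; have := iG 0%N; rewrite subn0.
  rewrite -EFinM lee_fin.
  apply: (@le_trans _ _ (expR (- (lam * a * n%:R / 2)) * expR (lam * a / 16) ^+ n)).
    by rewrite ler_wpM2l// lerXn2r ?nnegrE ?expR_ge0.
  rewrite -expRM_natl -expRD -[leRHS]expR0 ler_expR.
  have : 0 <= lam * a * n%:R.
    exact: mulr_ge0 (mulr_ge0 (ltW lam0) (ltW a0)) (ler0n _ _).
  by lra.
rewrite ge0_integral_sum//; last by move=> j w _; rewrite scale0// exprn_ge0.
apply: (@le_trans _ _ (\sum_(j < n) (2 * 2^-1 ^+ (n.-1 - j))%:E)%E).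
  apply: lee_sum => j _; rewrite ge0_integralZl ?lee_fin ?exprn_ge0//.
  apply: (@le_trans _ _ ((r ^+ (n.-1 - j))%:E * (2 ^+ (n - j))%:E)%E).
    by rewrite lee_wpmul2l ?lee_fin ?exprn_ge0.
  rewrite -EFinM lee_fin.
  (* There is one more factor 2 than factors [r]; it becomes the leading 2, and each pair [r * 2] is
     at most 1/2. *)
  have -> : (n - j = (n.-1 - j).+1)%N.
    by case: n j {A mA mG G0 iG G G_spec rhs mind ind0 msum sum0 e0 mtail tail0 mY nD0 mscale scale0} => [[]//|n j]; rewrite /= subSn// -ltnS.
  rewrite exprS mulrCA ler_wpM2l// -exprMn lerXn2r ?nnegrE ?mulr_ge0//.
  by lra.
rewrite sumEFin lee_fin -mulr_sumr.
have : \sum_(j < n) 2^-1 ^+ (n.-1 - j) <= 2 :> R.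
  rewrite (reindex_inj rev_ord_inj)/=.
  rewrite (eq_bigr (fun j : 'I_n => 2^-1 ^+ j : R)); last first.
    move=> j _; congr (_ ^+ _); have := ltn_ord j.
    rewrite /= -[(nat_of_ord j).+1]add1n subnDA subn1 => jn.
    by rewrite subKn// -ltnS prednK// (leq_ltn_trans _ jn).
  have sumE m : \sum_(j < m) 2^-1 ^+ j = 2 - 2 * 2^-1 ^+ m :> R.
    elim: m => [|m IH]; first by rewrite big_ord0 expr0; lra.
    by rewrite big_ord_recr/= IH exprS; lra.
  by rewrite sumE gerBl mulr_ge0// exprn_ge0.
by lra.
Qed.

(** At fixed [J], letting [n] grow makes [J] times the tail probability arbitrarily small; [J] then
    tends to infinity by monotone convergence. Finiteness of the moment is obtained, not assumed. *)
Lemma stationary_excess_moment :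
  (\int[P]_w (expR (lam * excess (invmx Rf *m Xinf w)))%:E <= 5%:E)%E.
Proof.
have a0 := block_gain_gt0 ws del_gt0 Del_gt0.
have mX : measurable_fun setT Xinf by exact: measurable_funPT.
have me : measurable_fun setT (fun w => excess (invmx Rf *m Xinf w)).
  exact: (measurableT_comp (@measurable_excess R d h gam Ch del Del (invmx Rf)) mX).
have bounded J : 0 < J -> (\int[P]_w (Num.min (phi (Xinf w)) J)%:E <= 5%:E)%E.
  move=> J0; apply/lee_addgt0Pr => e e0.
  pose E : {RV P >-> R} := mfun_Sub (mem_set me).
  have := cvg_ccdfy0 E => /fine_cvgP[_ /cvgrPdist_lt].
  have eJ : 0 < e / J by rewrite divr_gt0.
  move=> /(_ _ eJ) [y [_ Hy]].
  pose n := Num.bound (2 * Num.max 0 y / a).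
  have yn : y < a * n%:R / 2.
    have y0 : 0 <= 2 * Num.max 0 y / a.
      apply: divr_ge0 (ltW a0); apply: mulr_ge0 => //.
      by rewrite le_max lexx.
    have := archi_boundP y0; rewrite -/n ltr_pdivrMr// => H.
    have : y <= Num.max 0 y by rewrite le_max lexx orbT.
    by lra.
  apply: le_trans (tail_le n J0) _; rewrite addeC leeD2l//.
  have := Hy _ yn; rewrite sub0r normrN /ccdf /distribution /pushforward.
  rewrite /= [X in fine (P X)](_ : _ =
      [set w | (a * n%:R / 2 < excess (invmx Rf *m Xinf w))%R]); last first.
    by apply/seteqP; split => w /=; rewrite in_itv/= andbT.
  set A := [set w | _]; rewrite ger0_norm ?fine_ge0//.
  have mA : measurable A by rewrite -[A]setTI; exact: measurable_fun_ltr.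
  rewrite ltr_pdivlMr// => H.
  by rewrite -(@fineK _ (P A)) ?fin_num_measure// -EFinM lee_fin mulrC ltW.
have -> : (\int[P]_w (expR (lam * excess (invmx Rf *m Xinf w)))%:E =
    \int[P]_w limn (fun n : nat => (Num.min (phi (Xinf w)) n.+1%:R)%:E))%E.
  apply: eq_integral => w _; apply/esym/cvg_lim => //; apply: cvg_near_cst.
  exists (Num.bound (phi (Xinf w))) => // n /= bn.
  rewrite -/(phi (Xinf w)) min_l//.
  apply: ltW; apply: (lt_le_trans (archi_boundP (expR_ge0 _))).
  by rewrite ler_nat (leq_trans bn).
have mmin n : measurable_fun setT (fun w => (Num.min (phi (Xinf w)) n.+1%:R)%:E : \bar R).
  by apply/measurable_EFinP; exact: (measurableT_comp (mphi_min _) mX).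
have min0 n w : (0 <= (Num.min (phi (Xinf w)) n.+1%:R)%:E :> \bar R)%E.
  by rewrite lee_fin le_min expR_ge0/=.
have min_mono w : {homo (fun n : nat => (Num.min (phi (Xinf w)) n.+1%:R)%:E : \bar R) :
    n m / (n <= m)%N >-> (n <= m)%E}.
  by move=> n m nm; rewrite lee_fin le_min !ge_min lexx/= ler_nat ltnS nm orbT.
rewrite monotone_convergence//.
apply: lime_le; last by apply: nearW => n; exact: bounded.
apply/ereal_nondecreasing_is_cvgn => n m nm; apply: ge0_le_integral => //.
by move=> w _; exact: min_mono.
Qed.

(** With [q = R^-1 x0], the identity [x0 = q - M q] and [M q >= 0] give [x0 <= q], which the
    weighted maximum bounds. *)
Lemma norm1_le_excess (x0 : 'cV[R]_d) : (forall i, 0 <= x0 i 0) ->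
  norm1 x0 <= d%:R * Ch * (2 * step_rate gam Ch del / gam * Del +
    excess (invmx Rf *m x0)).
Proof.
move=> x00; rewrite norm1_ge0E//.
have h_gt0 i : 0 < h i 0 by exact: lt_le_trans ltr01 (ws_h_ge1 ws i).
have c_lt1 : 1 - gam < 1 by rewrite ltrBlDr ltrDl (ws_gam_gt0 ws).
set q := invmx Rf *m x0.
have q0 i : 0 <= q i 0.
  have := invmx_1B_ge0 (ws_ge0 ws) h_gt0 (ws_Mh ws) c_lt1 x00.
  by rewrite opprB addrC subrK; exact.
have Vle : weighted_max h q <= 2 * step_rate gam Ch del / gam * Del + excess q.
  by rewrite addrC -lerBlDr le_max lexx orbT.
have Ch0 : 0 <= Ch by rewrite (le_trans ler01)// (ws_Ch_ge1 ws).
apply: (@le_trans _ _ (\sum_(i < d) Ch * weighted_max h q)); last first.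
  by rewrite sumr_const card_ord -[leLHS]mulr_natl -[leRHS]mulrA ler_wpM2l// ler_wpM2l.
apply: ler_sum => i _; apply: (@le_trans _ _ (q i 0)).
  have := mulmx_ge0 (ws_ge0 ws) q0 i.
  have RfE : 1%:M - M = Rf by rewrite opprB addrC subrK.
  have := invmx_1BK (ws_ge0 ws) h_gt0 (ws_Mh ws) c_lt1 x0.
  by rewrite RfE -/q => ->; rewrite mxB_E subr_ge0.
apply: le_trans (le_weighted_max (ws_h_ge1 ws) q i) _.
by rewrite mulrC ler_wpM2r ?weighted_max_ge0// (ws_h_le ws).
Qed.

Lemma expectation_gap_le (x : 'cV[R]_d) (X : R -> {RV P >-> 'cV[R]_d})
    (t : R) (n : nat) (G z0 E8 : R) :
  (forall i, 0 <= x i 0) -> {ae P, forall w, rbm_path w x (X^~ w)} ->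
  n%:R * Del <= t ->
  G = gap_factor d kappa beta n ->
  z0 = 2 * step_rate gam Ch del / gam * Del ->
  E8 = expR (- (lam * a * n%:R / 8)) ->
  (\int[P]_w (norm1 (X t w - Y t w))%:E <=
   (norm1 x * G + d%:R * Ch * z0 * G +
    (norm1 x * expR (lam * excess (invmx Rf *m x) / 2 - lam * a * n%:R / 4) +
     d%:R * Ch * (z0 + a * n%:R / 4) * E8) * 2 ^+ n +
    d%:R * Ch * (G / lam + (z0 + 2 / lam) * E8) * 5)%:E)%E.
Proof.
move=> x0 X_path nt GE z0E E8E; have lam0 := exp_rate_gt0 ws th_gt0.
have a0 := block_gain_gt0 ws del_gt0 Del_gt0.
have G0 : 0 <= G by rewrite GE mulr_ge0 ?sqrtr_ge0 ?expR_ge0.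
have E80 : 0 <= E8 by rewrite E8E expR_ge0.
have Ch0 : 0 <= Ch by rewrite (le_trans ler01)// (ws_Ch_ge1 ws).
have dCh0 : 0 <= d%:R * Ch by rewrite mulr_ge0.
have z00 : 0 <= z0.
  rewrite z0E; apply: mulr_ge0 (ltW Del_gt0); apply: divr_ge0 (ltW (ws_gam_gt0 ws)).
  by rewrite mulr_ge0// ltW// (step_rate_gt0 ws del_gt0).
have n10 := norm1_ge0 x.
have an0 : 0 <= a * n%:R by rewrite mulr_ge0// ltW.
set A := norm1 x * G + d%:R * Ch * z0 * G.
set B1 := norm1 x * _ + _ * E8.
set C := d%:R * Ch * (G / lam + (z0 + 2 / lam) * E8).
have A0 : 0 <= A by rewrite addr_ge0 ?mulr_ge0.
have B10 : 0 <= B1.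
  by rewrite addr_ge0 ?mulr_ge0 ?expR_ge0 ?addr_ge0 ?divr_ge0.
have C0 : 0 <= C.
  apply: mulr_ge0 => //; apply: addr_ge0; first exact: divr_ge0 G0 (ltW lam0).
  by apply: mulr_ge0 => //; apply: addr_ge0 => //; exact: divr_ge0 _ (ltW lam0).
have [H [mH H0 iH HE]] := block_prod_majorant n 0%N.
rewrite subn0 in iH.
have mX : measurable_fun setT Xinf by exact: measurable_funPT.
have mXt : measurable_fun setT (X t) by exact: measurable_funPT.
have mYt : measurable_fun setT (Y t) by exact: measurable_funPT.
have mBH : measurable_fun setT (fun w => B1%:E * H w)%E by exact: emeasurable_funM.
have BH0 w : (0 <= B1%:E * H w)%E by rewrite mule_ge0 ?lee_fin.
have mp : measurable_fun setT (fun w => (phi (Xinf w))%:E : \bar R).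
  by apply/measurable_EFinP; exact: (measurableT_comp mphi mX).
have p0 w : (0 <= (phi (Xinf w))%:E :> \bar R)%E by rewrite lee_fin expR_ge0.
have mCp : measurable_fun setT (fun w => C%:E * (phi (Xinf w))%:E)%E.
  exact: emeasurable_funM.
have Cp0 w : (0 <= C%:E * (phi (Xinf w))%:E)%E.
  by apply: mule_ge0 (p0 w); rewrite lee_fin.
have mA : measurable_fun setT (fun _ : Omega => A%:E) by exact: measurable_cst.
have mAB : measurable_fun setT (fun w => A%:E + B1%:E * H w)%E.
  by apply: emeasurable_funD.
have AB0 w : (0 <= A%:E + B1%:E * H w)%E by rewrite adde_ge0 ?lee_fin.
apply: (@le_trans _ _
  (\int[P]_w ((A%:E + B1%:E * H w) + C%:E * (phi (Xinf w))%:E)%E)%E).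
  apply: ae_ge0_le_integral => //.
  - by move=> w _; rewrite lee_fin norm1_ge0.
  - by apply/measurable_EFinP; exact: measurable_norm1B.
  - by move=> w _; rewrite adde_ge0.
  - exact: emeasurable_funD.
  have := regular_path_ae; move: Y_path; move: X_path.
  apply: filterS3 => w pX pY rw _.
  rewrite HE// (_ : \prod_(k < n) _ = block_prod n w); last by apply: eq_bigr.
  rewrite -!EFinM -!EFinD lee_fin.
  apply: le_trans (rbm_gap rw pX pY nt) _.
  set e0 := excess (invmx Rf *m Xinf w); set S := \sum_(k < n) _.
  have e00 : 0 <= e0 by exact: excess_ge0.
  have y00 := rbm_path_ge0 pY.
  have bx := bad_le_exp (excess (invmx Rf *m x)) rw (erefl S).
  have by_ := bad_mul_le_exp rw z00 e00 (erefl S); rewrite -E8E in by_.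
  have ny := norm1_le_excess y00; rewrite -/e0 -z0E in ny.
  set bady := (_ < e0 + 2 * S)%R%:R in by_ *.
  set badx := (_ < _ + 2 * S)%R%:R in bx *.
  have bady0 : 0 <= bady by [].
  rewrite -GE.
  have t1 : norm1 x * (G + badx) <= norm1 x * G +
      norm1 x * expR (lam * excess (invmx Rf *m x) / 2 - lam * a * n%:R / 4) * block_prod n w.
    by rewrite mulrDr lerD2l -mulrA ler_wpM2l.
  have t2 : norm1 (Xinf w) * (G + bady) <= d%:R * Ch * ((z0 + e0) * (G + bady)).
    by rewrite mulrA ler_wpM2r// addr_ge0.
  have t3 : (z0 + e0) * G <= z0 * G + G / lam * phi (Xinf w).
    rewrite mulrDl lerD2l; have := ler_wpM2r G0 (id_le_expR e0 lam0).
    by rewrite /phi -/e0; lra.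
  have t4 : d%:R * Ch * ((z0 + e0) * (G + bady)) <=
      d%:R * Ch * ((z0 * G + G / lam * phi (Xinf w)) +
        ((z0 + 2 / lam) * E8 * phi (Xinf w) + (z0 + a * n%:R / 4) * E8 * block_prod n w)).
    by rewrite ler_wpM2l// mulrDr lerD.
  apply: (le_trans (lerD t1 (le_trans t2 t4))).
  by rewrite /A /B1 /C; lra.
rewrite ge0_integralD// ge0_integralD//.
rewrite -[leRHS]/(A%:E + (B1 * 2 ^+ n)%:E + (C * 5)%:E)%E; apply: leeD.
  apply: leeD.
    rewrite integral_cst// [X in (_ * X)%E](_ : _ = 1%E) ?mule1//.
    exact: probability_setT.
  by rewrite ge0_integralZl ?lee_fin// EFinM lee_wpmul2l ?lee_fin.
rewrite ge0_integralZl ?lee_fin// -[leRHS]/(C%:E * 5%:E)%E lee_wpmul2l ?lee_fin//.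
exact: stationary_excess_moment.
Qed.

End stationary_moment.
End model.

(** * What (BC1), (BC2) and (BC3) provide *)

Section condition_consequences.
Context (R : realType).

Lemma ler_mx_entry_norm (m n : nat) (A : 'M[R]_(m, n)) i j : `|A i j| <= `|A|.
Proof.
rewrite [leRHS]mx_normrE.
exact: (le_bigmax _ (fun ij : 'I_m * 'I_n => `|A ij.1 ij.2|) (i, j)).
Qed.

Lemma norm1_le_norm (d : nat) (x : 'cV[R]_d) : norm1 x <= d%:R * `|x|.
Proof.
rewrite /norm1; apply: le_trans (ler_sum _ _) _ => [i _|].
  exact: ler_mx_entry_norm.
by rewrite sumr_const card_ord mulr_natl.
Qed.

Lemma trmx_expr (d : nat) (A : 'M[R]_d) n : (A ^+ n)^T = A^T ^+ n.
Proof.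
elim: n => [|n IH]; first by rewrite !expr0 trmx1.
by rewrite exprS exprSr trmx_mul IH.
Qed.

Context (kappa beta delta sigma : R) (d : nat) (mu : 'cV[R]_d) (D Rf : 'M[R]_d).
Hypothesis beta_gt0 : 0 < beta.
Hypothesis beta_lt1 : beta < 1.
Hypothesis sigma_gt0 : 0 < sigma.
Hypothesis d_gt0 : (0 < d)%N.
Hypothesis bc : BC kappa beta delta sigma mu (D *m D^T) Rf.
Local Notation M := (1%:M - Rf).

Let MT : (1%:M - Rf^T)^T = M.
Proof. by rewrite linearB/= trmx1 trmxK. Qed.

Lemma BC_decay n i : (M ^+ n *m const_mx 1 : 'cV_d) i 0 <= kappa * (1 - beta) ^+ n.
Proof.
apply: le_trans (BC1_decay bc n).
rewrite (_ : M ^+ n *m const_mx 1 =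
    ((const_mx 1 : 'rV_d) *m (1%:M - Rf^T) ^+ n)^T); last first.
  by rewrite trmx_mul trmx_expr MT trmx_const.
rewrite mxE; apply: le_trans (ler_norm _) (ler_mx_entry_norm _ _ _).
Qed.

(** Half of the decay is given up: with [c = 1 - beta / 2] the ratio of the series is below 1, so a
    suitable [n0] depends on [kappa] and [beta] only. The form of the bound on [h] ensures that it
    is at least 1. *)
Lemma BC_weight_exists (n0 : nat) : (0 < n0)%N ->
  kappa * ((1 - beta) / (1 - beta / 2)) ^+ n0 <= 1 ->
  exists h : 'cV[R]_d, weighted_substochastic M h (beta / 2)
    (1 + `|\sum_(n < n0) kappa * ((1 - beta) / (1 - beta / 2)) ^+ n|).
Proof.
move=> n00 kn0.
have M_ge0 i j : 0 <= M i j.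
  by rewrite -MT mxE; have [] := BC1_substochastic bc.
have c0 : 0 < 1 - beta / 2 by move: beta_lt1 beta_gt0; lra.
have [h [h1 hle Mh]] := weight_exists M_ge0 BC_decay c0 n00 kn0.
exists h; split=> //.
- move=> j; have [_ /(_ j)] := BC1_substochastic bc.
  apply: le_trans; rewrite ler_sum// => i _.
  by rewrite -MT mxE.
- by move=> i; apply: le_trans (hle i) _; apply: le_trans (ler_norm _) _; rewrite lerDr.
- by rewrite divr_gt0.
- by move: beta_lt1 beta_gt0; lra.
- by rewrite lerDl.
Qed.

Context (h : 'cV[R]_d) (gam Ch : R).
Hypothesis ws : weighted_substochastic M h gam Ch.

Let h_gt0 i : 0 < h i 0.
Proof. exact: lt_le_trans ltr01 (ws_h_ge1 ws i). Qed.

Let c_lt1 : 1 - gam < 1.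
Proof. by rewrite ltrBlDr ltrDl (ws_gam_gt0 ws). Qed.

Let RfE : 1%:M - M = Rf.
Proof. by rewrite opprB addrC subrK. Qed.

Lemma invmx_le_norm (x : 'cV[R]_d) i :
  (invmx Rf *m x) i 0 <= `|x| / gam * h i 0.
Proof.
have := @invmx_1B_le _ _ _ _ _ (ws_ge0 ws) h_gt0 (ws_Mh ws) c_lt1 x `|x| (normr_ge0 _)
  (ws_h_ge1 ws) (fun i => le_trans (ler_norm _) (ler_mx_entry_norm x i 0)) i.
by rewrite RfE opprB addrC subrK.
Qed.

(** The left side is the quadratic form of [D *m D^T] at a row of [R^-1]. The entries of that row
    are nonnegative with sum at most [Ch / gam], and those of [D *m D^T] are at most [sigma ^+ 2],
    so no power of [d] appears. *)
Lemma noise_row_le i :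
  \sum_j (invmx Rf *m D) i j ^+ 2 <= (sigma * Ch / gam) ^+ 2.
Proof.
pose r k := invmx Rf i k.
have r0 k : 0 <= r k.
  have e0 j : 0 <= (delta_mx k 0 : 'cV[R]_d) j 0.
    by rewrite mxE; case: (_ && _); rewrite ?ler01.
  have := invmx_1B_ge0 (ws_ge0 ws) h_gt0 (ws_Mh ws) c_lt1 e0 i.
  by rewrite RfE -colE mxE.
have rsum : \sum_k r k <= Ch / gam.
  have := invmx_le_norm (const_mx 1) i; rewrite mxE.
  under eq_bigr do rewrite mxE mulr1.
  move/le_trans; apply.
  have -> : `|const_mx 1 : 'cV[R]_d| = 1.
    apply/eqP; rewrite eq_le; apply/andP; split.
      rewrite [leLHS]mx_normrE; apply: bigmax_le => // ij _.
      by rewrite mxE normr1.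
    have := ler_mx_entry_norm (const_mx 1 : 'cV[R]_d) (Ordinal d_gt0) 0.
    by rewrite mxE normr1.
  rewrite mul1r mulrC ler_wpM2r ?invr_ge0 ?(ltW (ws_gam_gt0 ws))//.
  exact: ws_h_le ws i.
have Dk k : \sum_j D k j ^+ 2 <= sigma ^+ 2.
  have /andP[_] := BC3 bc k.
  rewrite mxE; under eq_bigr do rewrite mxE -expr2.
  have S0 : 0 <= \sum_j D k j ^+ 2 by apply: sumr_ge0 => j _; exact: sqr_ge0.
  move=> sl; rewrite -(sqr_sqrtr S0) ler_sqr ?nnegrE ?sqrtr_ge0//.
  exact: ltW.
have Dkl k l : \sum_j D k j * D l j <= sigma ^+ 2.
  apply: (@le_trans _ _ (\sum_j (D k j ^+ 2 + D l j ^+ 2) / 2)).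
    apply: ler_sum => j _.
    by have := sqr_ge0 (D k j - D l j); rewrite sqrrB; lra.
  rewrite -mulr_suml big_split/=.
  by have := Dk k; have := Dk l; lra.
have -> : \sum_j (invmx Rf *m D) i j ^+ 2 =
    \sum_k \sum_l r k * r l * \sum_j D k j * D l j.
  under [RHS]eq_bigr do under eq_bigr do rewrite mulr_sumr.
  under [RHS]eq_bigr do rewrite exchange_big.
  rewrite [RHS]exchange_big; apply: eq_bigr => j _.
  rewrite mxE expr2 mulr_suml; apply: eq_bigr => k _.
  rewrite mulr_sumr; apply: eq_bigr => l _.
  by rewrite -/(r k) -/(r l); ring.
apply: (@le_trans _ _ (\sum_k \sum_l r k * r l * sigma ^+ 2)).
  apply: ler_sum => k _; apply: ler_sum => l _.
  by rewrite ler_wpM2l// mulr_ge0.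
have -> : \sum_k \sum_l r k * r l * sigma ^+ 2 = (sigma * \sum_k r k) ^+ 2.
  transitivity ((\sum_k r k) * (\sum_k r k) * sigma ^+ 2); last by ring.
  rewrite !mulr_suml; apply: eq_bigr => k _.
  by rewrite mulr_sumr mulr_suml.
have S0 : 0 <= \sum_k r k by apply: sumr_ge0 => k _; exact: r0.
rewrite ler_sqr ?nnegrE.
- by rewrite -mulrA ler_wpM2l// ltW.
- by rewrite mulr_ge0// ltW.
- by rewrite divr_ge0 ?mulr_ge0 ?(ltW sigma_gt0) ?(ltW (ws_gam_gt0 ws))// (le_trans ler01)// (ws_Ch_ge1 ws).
Qed.

Lemma excess_le_norm (del Del : R) (x : 'cV[R]_d) : 0 < del -> 0 < Del ->
  excess h gam Ch del Del (invmx Rf *m x) <= `|x| / gam.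
Proof.
move=> del0 Del0; have g0 := ws_gam_gt0 ws.
have xg : 0 <= `|x| / gam by rewrite divr_ge0// ltW.
rewrite /excess ge_max xg/= lerBlDr.
apply: (@le_trans _ _ (`|x| / gam)).
  by apply: (weighted_max_le (ws_h_ge1 ws) xg) => i; exact: invmx_le_norm.
rewrite lerDl; apply: mulr_ge0 (ltW Del0); apply: divr_ge0 (ltW g0).
by rewrite mulr_ge0// ltW// (step_rate_gt0 ws del0).
Qed.

End condition_consequences.

(** * Choice of the constants and the final estimate *)

Section constants.
Context (R : realType) (kappa beta gam Ch del th : R).
Hypothesis beta_gt0 : 0 < beta.
Hypothesis gam_gt0 : 0 < gam.
Hypothesis Ch_ge1 : 1 <= Ch.
Hypothesis del_gt0 : 0 < del.
Hypothesis th_gt0 : 0 < th.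
Local Notation c1 := (step_rate gam Ch del).
Local Notation lam := (exp_rate gam th).

(** The value for which [th * g = p * Del]. Then [rate2] satisfies [beta * t / (2 * Del) = 8 *
    (rate2 * t / ell)], and [offset * ell] is the level subtracted in [excess]. *)
Definition tilt_cost : R := th * gam * c1 / 8.
Local Notation p := tilt_cost.
Definition rate2 : R := beta / 8 * (p / 16 / 16).
Definition rate4 : R := lam * c1 / 8 / 8.
Definition offset : R := 16 * (16 * c1) / (gam * p).
(** The three summands guarantee, in turn, that [t] contains two blocks, that the initial excess is
    compensated by the elapsed time, and that [t] dominates the sup norm of the initial point. *)
Definition time_factor : R := 16 * (16 / p) + 16 / (gam * c1) + 1.
Definition const1 : R :=
  Num.sqrt kappa * (3 / rate2 + 3 * Ch * offset + 5 * Ch / lam).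
Definition const3 : R :=
  1 / rate4 + Ch * (2 * offset + c1 / (4 * rate4)) + 5 * Ch * (2 * offset + 2 / lam).

Lemma c1_gt0 : 0 < c1.
Proof. by rewrite /step_rate divr_gt0 ?mulr_gt0// (lt_le_trans ltr01). Qed.

Lemma lam_gt0 : 0 < lam.
Proof. by rewrite /exp_rate divr_gt0 ?mulr_gt0. Qed.

Lemma tilt_cost_gt0 : 0 < p.
Proof. by rewrite /p divr_gt0// mulr_gt0 ?c1_gt0// mulr_gt0. Qed.

Lemma rate2_gt0 : 0 < rate2.
Proof.
have p0 := tilt_cost_gt0.
by apply: mulr_gt0; [exact: divr_gt0|apply: divr_gt0 => //; exact: divr_gt0].
Qed.

Lemma rate4_gt0 : 0 < rate4.
Proof.
have l0 := lam_gt0; have c0 := c1_gt0.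
by do 2 apply: divr_gt0 => //; exact: mulr_gt0.
Qed.

Lemma offset_gt0 : 0 < offset.
Proof.
have p0 := tilt_cost_gt0; have c0 := c1_gt0.
apply: divr_gt0; last exact: mulr_gt0.
by apply: mulr_gt0 => //; exact: mulr_gt0.
Qed.

Lemma time_factor_ge : [/\ 1 <= time_factor, 16 * (16 / p) <= time_factor &
  16 / (gam * c1) <= time_factor].
Proof.
have p0 := tilt_cost_gt0; have c0 := c1_gt0.
have h1 : 0 <= 16 * (16 / p) by apply: mulr_ge0 => //; exact: divr_ge0 _ (ltW p0).
have h2 : 0 <= 16 / (gam * c1).
  by apply: divr_ge0 => //; exact: ltW (mulr_gt0 gam_gt0 c0).
by rewrite /time_factor; split; move: h1 h2; set u := 16 * _; set v := 16 / _; lra.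
Qed.

Lemma const1_ge0 : 0 <= const1.
Proof.
have r0 := ltW rate2_gt0; have o0 := ltW offset_gt0; have l0 := ltW lam_gt0.
have Ch0 : 0 <= Ch by exact: le_trans ler01 Ch_ge1.
apply: mulr_ge0; first exact: sqrtr_ge0.
apply: addr_ge0; last by apply: divr_ge0 => //; exact: mulr_ge0.
apply: addr_ge0; first exact: divr_ge0.
by apply: mulr_ge0 => //; exact: mulr_ge0.
Qed.

Lemma const3_ge0 : 0 <= const3.
Proof.
have r0 := ltW rate4_gt0; have o0 := ltW offset_gt0; have l0 := ltW lam_gt0.
have c0 := ltW c1_gt0.
have Ch0 : 0 <= Ch by exact: le_trans ler01 Ch_ge1.
have o2 : 0 <= 2 * offset by exact: mulr_ge0.
apply: addr_ge0; last first.
  apply: mulr_ge0; first exact: mulr_ge0.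
  by apply: addr_ge0 => //; exact: divr_ge0.
apply: addr_ge0; first exact: divr_ge0.
apply: mulr_ge0 => //; apply: addr_ge0 => //.
by apply: divr_ge0 => //; exact: mulr_ge0.
Qed.

Context (d : nat).
Hypothesis d_gt0 : (0 < d)%N.
Local Notation ell := (ln (2 * d%:R) : R).
(** With this length [th * g = 128 * ell] and [lam * a = 16 * ell], so the side conditions on the
    noise compare powers of [2 * d]. *)
Definition block_length : R := 16 * (8 * ell) / p.
Local Notation Del := block_length.
Local Notation a := (block_gain gam Ch del Del).
Local Notation g := (quiet_level gam Ch del Del).

Let le_of_eq (x y : R) : x = y -> x <= y. Proof. by move=> ->. Qed.

Let d_ge1 : 1 <= d%:R :> R. Proof. by rewrite ler1n. Qed.

Lemma expR_ell : expR ell = 2 * d%:R :> R.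
Proof. by rewrite lnK// posrE mulr_gt0// ltr0n. Qed.

Lemma ell_gt0 : 0 < ell.
Proof. by rewrite ln_gt0//; move: d_ge1; lra. Qed.

Lemma ell_le : ell <= 2 * d%:R.
Proof. by apply/ltW/ln_sublinear; rewrite mulr_gt0// ltr0n. Qed.

(** From [ln d = 2 * ln (sqrt d)]. Together with the [sqrt d] of [gap_factor], it keeps
    [d * ell * sqrt d] within a multiple of [d ^+ 2]. *)
Lemma ell_le_sqrt : ell <= 3 * Num.sqrt d%:R.
Proof.
have s1 : 1 <= Num.sqrt d%:R :> R by rewrite -{1}sqrtr1 ler_wsqrtr.
have s0 : 0 < Num.sqrt d%:R :> R by exact: lt_le_trans ltr01 s1.
have -> : 2 * d%:R = 2 * (Num.sqrt d%:R * Num.sqrt d%:R) :> R.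
  by rewrite -expr2 sqr_sqrtr.
rewrite !lnM ?posrE ?mulr_gt0//.
have := ln_sublinear s0; have : ln (1 + 1) <= 1 :> R by apply: le_ln1Dx; lra.
by rewrite -[1 + 1]/(2 : R); lra.
Qed.

Lemma block_length_gt0 : 0 < Del.
Proof. have p0 := tilt_cost_gt0; have L0 := ell_gt0.
by apply: divr_gt0 => //; apply: mulr_gt0 => //; exact: mulr_gt0. Qed.

Let pN0 : p != 0. Proof. by rewrite gt_eqF// tilt_cost_gt0. Qed.

Lemma th_quiet_level : th * g = 128 * ell.
Proof.
rewrite (_ : th * g = p * Del); last by rewrite /quiet_level /p; ring.
by rewrite /block_length; field.
Qed.

Lemma lam_gain : lam * a = 16 * ell.
Proof.
rewrite (_ : lam * a = p * Del / 8).
  by rewrite /block_length; field.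
by rewrite /block_gain /exp_rate /p; field.
Qed.

Let expN2 : expR (- (2 * ell)) = (2 * d%:R) ^- 2 :> R.
Proof. by rewrite expRN expRM_natl expR_ell. Qed.

Lemma quiet_cond : expR (- (th * g / 20)) <= 4^-1.
Proof.
rewrite th_quiet_level; apply: (@le_trans _ _ (expR (- (2 * ell)))).
  by rewrite ler_expR; have := ell_gt0; lra.
rewrite expN2 lef_pV2 ?posrE ?exprn_gt0 ?mulr_gt0 ?ltr0n//.
by rewrite exprMn; have := d_ge1 => d1; rewrite (_ : 2 ^+ 2 = 4) ?ler_peMr ?exprn_ege1// expr2; lra.
Qed.

Lemma union_cond :
  expR (2 * lam * a) * (4 * d%:R * expR (- (th * g / 2))) <= 1.
Proof.
rewrite -(mulrA 2) lam_gain th_quiet_level mulrCA -expRD.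
have d0 : 0 < d%:R :> R by rewrite ltr0n.
apply: (@le_trans _ _ (4 * d%:R * expR (- (2 * ell)))).
  by rewrite ler_wpM2l ?mulr_ge0// ler_expR; have := ell_gt0; lra.
rewrite expN2 ler_pdivrMr ?exprn_gt0 ?mulr_gt0// mul1r exprMn.
rewrite (_ : 2 ^+ 2 = 4); last by rewrite expr2; lra.
by rewrite ler_wpM2l// expr2 ler_peMr.
Qed.

Lemma gain_cond : 2 <= expR (lam * a / 16).
Proof.
rewrite lam_gain (_ : 16 * ell / 16 = ell); last by field.
by rewrite expR_ell ler_peMr.
Qed.

Let mul_expN (c x : R) : 0 < c -> x * expR (- (c * x)) <= c^-1.
Proof.
move=> c0; have := id_le_expR x c0; have e0 := expR_gt0 (c * x).
by rewrite expRN ler_pdivrMr// mulrC.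
Qed.

(** In the terms carrying a factor [t], the exponential is first obtained at twice the final rate,
    as [e2 * e2] or [e4 * e4]; one copy absorbs [t] through [mul_expN]. The initial norm enters as
    [d * t]. *)
Lemma gap_total_le (N1 Noo ex t G z0 E8 : R) (n : nat) :
  0 <= N1 -> N1 <= d%:R * Noo -> 0 <= Noo -> ex <= Noo / gam ->
  time_factor * Num.max Noo ell <= t ->
  n = Num.truncn (t / Del) ->
  G = gap_factor d kappa beta n -> z0 = 2 * c1 / gam * Del ->
  E8 = expR (- (lam * a * n%:R / 8)) ->
  N1 * G + d%:R * Ch * z0 * G +
  (N1 * expR (lam * ex / 2 - lam * a * n%:R / 4) +
   d%:R * Ch * (z0 + a * n%:R / 4) * E8) * 2 ^+ n +
  d%:R * Ch * (G / lam + (z0 + 2 / lam) * E8) * 5 <=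
  const1 * d%:R ^+ 2 * expR (- (rate2 * t / ell)) +
  const3 * d%:R ^+ 2 * expR (- (rate4 * t)).
Proof.
move=> N10 N1le Noo0 exle tge nE GE z0E E8E.
have c0 := c1_gt0; have l0 := lam_gt0; have p0 := tilt_cost_gt0.
have r2 := rate2_gt0; have r4 := rate4_gt0; have o0 := offset_gt0.
have L0 := ell_gt0; have D0 := block_length_gt0.
have Ch0 : 0 < Ch by exact: lt_le_trans ltr01 Ch_ge1.
have d0 : 0 < d%:R :> R by rewrite ltr0n.
have [tf1 tf2 tf3] := time_factor_ge.
have tf0 : 0 < time_factor by exact: lt_le_trans tf1.
have t_ell : time_factor * ell <= t.
  by apply: le_trans tge; rewrite ler_wpM2l ?(ltW tf0)// le_max lexx orbT.
have t_Noo : time_factor * Noo <= t.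
  by apply: le_trans tge; rewrite ler_wpM2l ?(ltW tf0)// le_max lexx.
have t0 : 0 < t by apply: lt_le_trans t_ell; rewrite mulr_gt0.
have Noo_t : Noo <= t by apply: le_trans t_Noo; rewrite ler_peMl.
have tD : 2 * Del <= t.
  apply: le_trans t_ell; rewrite (_ : 2 * Del = 16 * (16 / p) * ell).
    by rewrite ler_wpM2r// ltW.
  by rewrite /block_length; field.
have tDel0 : 0 <= t / Del by exact: divr_ge0 (ltW t0) (ltW D0).
have /andP[n_le n_gt] := truncn_itv tDel0; rewrite -nE in n_le n_gt.
have nD_le : n%:R * Del <= t by rewrite -ler_pdivlMr.
have nD_ge : t / 2 <= n%:R * Del.
  (* Rounding down loses less than one block, at most half of [t]. *)
  move: n_gt; rewrite ltr_pdivrMr// -natr1 mulrDl mul1r => H.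
  by lra.
pose u := rate2 * t / ell.
have u0 : 0 <= u by apply: divr_ge0 (ltW L0); exact: mulr_ge0 (ltW r2) (ltW t0).
have tE : t = u * ell / rate2.
  by rewrite /u; field; rewrite !gt_eqF.
have G_le : G <= Num.sqrt d%:R * Num.sqrt kappa * expR (- (2 * u)).
  rewrite GE /gap_factor sqrtrM// ler_wpM2l ?mulr_ge0 ?sqrtr_ge0// ler_expR.
  have : t / (2 * Del) <= n%:R.
    rewrite ler_pdivrMr; last exact: mulr_gt0.
    by move: nD_ge; lra.
  move=> /(ler_wpM2l (ltW beta_gt0)).
  have -> : beta * (t / (2 * Del)) = 8 * u.
    by rewrite /u /rate2 /block_length; field; rewrite !gt_eqF.
  by lra.
have G0 : 0 <= G by rewrite GE mulr_ge0 ?sqrtr_ge0 ?expR_ge0.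
pose sk := Num.sqrt kappa; pose sd : R := Num.sqrt d%:R.
have sk0 : 0 <= sk by exact: sqrtr_ge0.
have sd0 : 0 <= sd by exact: sqrtr_ge0.
have sdd : sd * sd = d%:R by rewrite -expr2 sqr_sqrtr// ltW.
have sd_d : sd <= d%:R.
  by rewrite -sdd ler_peMr// -sqrtr1 ler_wsqrtr.
pose e2 := expR (- u).
have e20 : 0 < e2 by exact: expR_gt0.
have ee : expR (- (2 * u)) = e2 * e2.
  by rewrite /e2 -expRD; congr expR; ring.
have e21 : e2 <= 1 by rewrite -[leRHS]expR0 ler_expR oppr_le0.
have G_le' : G <= sd * sk * e2.
  apply: le_trans G_le _; rewrite ee; apply: ler_wpM2l; first by rewrite mulr_ge0.
  by rewrite ler_piMl// ltW.
have ellsd : ell <= 3 * sd by exact: ell_le_sqrt.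
have dCh0 : 0 <= d%:R * Ch by exact: mulr_ge0 (ltW d0) (ltW Ch0).
have N1t : N1 <= d%:R * t by apply: le_trans N1le _; rewrite ler_wpM2l// ltW.

have T1 : N1 * G <= (sk * (3 / rate2)) * d%:R ^+ 2 * e2.
  apply: (@le_trans _ _ (d%:R * t * (sd * sk * (e2 * e2)))).
    by apply: ler_pM => //; rewrite -ee.
  have ue : u * e2 <= 1.
    by have := @mul_expN 1 u ltr01; rewrite invr1 mul1r.
  apply: (@le_trans _ _ (d%:R * (ell / rate2) * sd * sk * e2 * (u * e2))).
    rewrite {1}tE; apply: le_of_eq; by ring.
  have c_ge0 : 0 <= d%:R * (ell / rate2) * sd * sk * e2.
    apply: mulr_ge0 (ltW e20); apply: mulr_ge0 sk0; apply: mulr_ge0 sd0.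
    exact: mulr_ge0 (ltW d0) (divr_ge0 (ltW L0) (ltW r2)).
  apply: (@le_trans _ _ (d%:R * (ell / rate2) * sd * sk * e2)).
    by rewrite -[leRHS]mulr1 ler_wpM2l.
  have -> : sk * (3 / rate2) * d%:R ^+ 2 * e2 =
      d%:R * (3 * sd / rate2) * sd * sk * e2.
    by rewrite expr2 -{2}sdd; ring.
  apply: ler_wpM2r (ltW e20) _ _ _; apply: ler_wpM2r sk0 _ _ _.
  apply: ler_wpM2r sd0 _ _ _; apply: ler_wpM2l (ltW d0) _ _ _.
  by apply: ler_wpM2r ellsd; rewrite invr_ge0 ltW.
have z0E' : z0 = offset * ell.
  by rewrite z0E /offset /block_length; field; rewrite pN0 gt_eqF.
have z00 : 0 <= z0 by rewrite z0E'; exact: mulr_ge0 (ltW o0) (ltW L0).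
have T2 : d%:R * Ch * z0 * G <= sk * (3 * Ch * offset) * d%:R ^+ 2 * e2.
  apply: (@le_trans _ _ (d%:R * Ch * (offset * (3 * sd)) * (sd * sk * e2))).
    apply: ler_pM => //; first exact: mulr_ge0 (dCh0) z00.
    by rewrite z0E'; apply: ler_wpM2l dCh0 _ _ _; exact: ler_wpM2l (ltW o0) _ _ ellsd.
  by apply: le_of_eq; rewrite expr2 -{3}sdd; ring.
have T3 : d%:R * Ch * (G / lam) * 5 <= sk * (5 * Ch / lam) * d%:R ^+ 2 * e2.
  apply: (@le_trans _ _ (d%:R * Ch * (d%:R * sk * e2 / lam) * 5)).
    rewrite ler_wpM2r// ler_wpM2l ?mulr_ge0 ?(ltW Ch0)//.
    rewrite ler_wpM2r ?invr_ge0 ?(ltW l0)//; apply: le_trans G_le' _.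
    by rewrite ler_wpM2r ?(ltW e20)// ler_wpM2r.
  by apply: le_of_eq; ring.

pose s := lam * a * n%:R.
have sE : s = lam * c1 * (n%:R * Del) by rewrite /s /block_gain; ring.
have s_ge : 32 * (rate4 * t) <= s.
  have -> : 32 * (rate4 * t) = lam * c1 * (t / 2) by rewrite /rate4; field.
  by rewrite sE ler_wpM2l// mulr_ge0 ?ltW.
have two_n : 2 ^+ n <= expR (s / 16).
  have -> : s / 16 = n%:R * (lam * a / 16) by rewrite /s; ring.
  by rewrite expRM_natl lerXn2r ?nnegrE ?expR_ge0// gain_cond.
pose e4 := expR (- (rate4 * t)).
have e40 : 0 < e4 by exact: expR_gt0.
have rt0 : 0 <= rate4 * t by rewrite mulr_ge0 ?ltW.
have te4 : t * e4 <= rate4^-1 by exact: mul_expN.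
have d_d2 : d%:R <= d%:R ^+ 2 :> R by rewrite expr2 ler_peMr// ltW.
have T4 : N1 * expR (lam * ex / 2 - lam * a * n%:R / 4) * 2 ^+ n <=
    1 / rate4 * d%:R ^+ 2 * e4.
  (* The exponent gains [s / 4 - s / 16], at least [6 * (rate4 * t)], of which the initial excess
     consumes at most 2 units and [e4 * e4] needs 2. *)
  have ex_t : lam * ex / 2 <= 2 * (rate4 * t).
    have : lam * ex <= lam * (c1 * t / 16).
      rewrite ler_wpM2l ?(ltW l0)//; apply: le_trans exle _.
      rewrite ler_pdivrMr//.
      have := ler_wpM2r Noo0 tf3 => /le_trans/(_ t_Noo) H.
      rewrite (_ : Noo = 16 / (gam * c1) * Noo * (c1 * gam / 16)); last first.
        by field; rewrite !gt_eqF.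
      rewrite (_ : c1 * t / 16 * gam = t * (c1 * gam / 16)); last by ring.
      apply: ler_wpM2r H; apply: divr_ge0 => //.
      exact: mulr_ge0 (ltW c0) (ltW gam_gt0).
    by rewrite /rate4; lra.
  rewrite -mulrA.
  apply: (@le_trans _ _ (d%:R * t * (e4 * e4))).
    apply: ler_pM => //.
    apply: (@le_trans _ _ (expR (lam * ex / 2 - s / 4) * expR (s / 16))).
      by rewrite ler_wpM2l ?expR_ge0.
    by rewrite -!expRD ler_expR; lra.
  have -> : d%:R * t * (e4 * e4) = d%:R * (t * e4) * e4 by ring.
  rewrite ler_wpM2r ?(ltW e40)// mul1r mulrC.
  by apply: ler_pM => //; rewrite ?mulr_ge0 ?ltW.
have E82 : E8 * 2 ^+ n <= e4 * e4.
  apply: (@le_trans _ _ (E8 * expR (s / 16))).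
    by rewrite ler_wpM2l// E8E expR_ge0.
  by rewrite E8E -!expRD ler_expR -/s; lra.
have E8_le : E8 <= e4 by rewrite E8E ler_expR -/s; lra.
have e41 : e4 <= 1 by rewrite -[leRHS]expR0 ler_expR oppr_le0.
have z0d : z0 <= 2 * offset * d%:R.
  rewrite z0E' (_ : 2 * offset * d%:R = offset * (2 * d%:R)); last by ring.
  exact: ler_wpM2l (ltW o0) _ _ ell_le.
have an : a * n%:R <= c1 * t.
  rewrite /block_gain -mulrA; apply: ler_wpM2l (ltW c0) _ _ _.
  by rewrite mulrC.
have T5 : d%:R * Ch * (z0 + a * n%:R / 4) * E8 * 2 ^+ n <=
    Ch * (2 * offset + c1 / (4 * rate4)) * d%:R ^+ 2 * e4.
  rewrite -mulrA.
  apply: (@le_trans _ _ (d%:R * Ch * (2 * offset * d%:R + c1 * t / 4) * (e4 * e4))).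
    apply: ler_pM => //.
    - apply: mulr_ge0 dCh0 (addr_ge0 z00 _); apply: divr_ge0 => //.
      exact: mulr_ge0 (ltW (mulr_gt0 c0 D0)) _.
    - by apply: mulr_ge0; rewrite ?exprn_ge0// E8E; exact: expR_ge0.
    - apply: ler_wpM2l dCh0 _ _ _; apply: lerD z0d _.
      by apply: ler_wpM2r an; rewrite invr_ge0.
  have -> : d%:R * Ch * (2 * offset * d%:R + c1 * t / 4) * (e4 * e4) =
     d%:R * Ch * e4 * (2 * offset * d%:R * e4 + c1 / 4 * (t * e4)) by ring.
  have -> : Ch * (2 * offset + c1 / (4 * rate4)) * d%:R ^+ 2 * e4 =
     d%:R * Ch * e4 * (2 * offset * d%:R * 1 + c1 / 4 * (rate4^-1 * d%:R)).
    by rewrite expr2; field; rewrite gt_eqF.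
  apply: ler_wpM2l (mulr_ge0 dCh0 (ltW e40)) _ _ _.
  apply: lerD; first by apply: ler_wpM2l e41; apply: mulr_ge0 => //; exact: mulr_ge0 _ (ltW o0).
  apply: ler_wpM2l (divr_ge0 (ltW c0) _) _ _ _ => //.
  by apply: le_trans te4 _; rewrite ler_peMr// invr_ge0 ltW.
have T6 : d%:R * Ch * ((z0 + 2 / lam) * E8) * 5 <=
    5 * Ch * (2 * offset + 2 / lam) * d%:R ^+ 2 * e4.
  have -> : 5 * Ch * (2 * offset + 2 / lam) * d%:R ^+ 2 * e4 =
    d%:R * Ch * ((2 * offset * d%:R + 2 / lam * d%:R) * e4) * 5.
    by rewrite expr2; ring.
  apply: ler_wpM2r => //; apply: ler_wpM2l dCh0 _ _ _.
  have l20 : 0 <= 2 / lam by exact: divr_ge0 _ (ltW l0).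
  apply: ler_pM => //; first by rewrite addr_ge0.
    by rewrite E8E; exact: expR_ge0.
  by apply: lerD => //; rewrite ler_peMr.
rewrite -/u -/e2 -/e4 /const1 /const3 -/sk.
by lra.
Qed.

End constants.

(** * Wasserstein distance under the synchronous coupling, and the theorem *)

Lemma wasserstein1_le_expectation (R : realType) (d : nat)
    (disp : measure_display) (Omega : measurableType disp)
    (P : probability Omega R) (X Y : {RV P >-> 'cV[R]_d})
    (pi : probability 'cV[R]_d R) :
  has_law Y pi ->
  (wasserstein1 (distribution P X) pi <=
   \int[P]_w (norm1 (X w - Y w))%:E)%E.
Proof.
move=> Ypi.
have mZ : measurable_fun setT (fun w => (X w, Y w)) by exact: measurable_fun_pair.
pose Z : {RV P >-> ('cV[R]_d * 'cV[R]_d)%type} :=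
  HB.pack_for {RV P >-> ('cV[R]_d * 'cV[R]_d)%type}
    (fun w => (X w, Y w)) (isMeasurableFun.Build _ _ _ _ _ mZ).
apply: ereal_inf_lbound; exists (distribution P Z).
  move=> A mA; split.
    by congr (P _); apply/seteqP; split => w /=; [case|].
  by rewrite -(Ypi A mA); congr (P _); apply/seteqP; split => w /=; [case|].
rewrite (ge0_integral_distribution Z (f := fun z => (norm1 (z.1 - z.2))%:E))//.
- by apply/measurable_EFinP; exact: measurable_norm1B.
- by move=> z; rewrite lee_fin norm1_ge0.
Qed.

Lemma mul_expRN_le8 (R : realType) (A x : R) :
  0 < A -> ln (8 * A) <= x -> A * expR (- x) <= 8^-1.
Proof.
move=> A0 Ax; have A80 : 0 < 8 * A by exact: mulr_gt0.
apply: (@le_trans _ _ (A * expR (- ln (8 * A)))).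
  by rewrite ler_wpM2l ?(ltW A0)// ler_expR lerN2.
by rewrite expRN lnK ?posrE// invfM mulrCA mulfV ?mulr1// gt_eqF.
Qed.

(** The three terms are at most 2/8, 1/8 and 1/8. As each [A] is at least 1, the logarithms are
    nonnegative, so [T] dominates each summand of its lower bound separately. *)
Lemma decay_le_half (R : realType) (A1 A2 A3 E2 E4 L T : R) :
  1 <= A1 -> 1 <= A2 -> 1 <= A3 -> 0 < E2 -> 0 < E4 -> 0 < L ->
  E2^-1 * ln (8 * A1) * L + E4^-1 * (2 * ln (8 * A2) + ln (8 * A3)) <= T ->
  2 * A1 * expR (- (E2 * T / L)) + A2 * expR (- (E4 * T / 2)) +
    A3 * expR (- (E4 * T)) <= 2^-1.
Proof.
move=> A11 A21 A31 E20 E40 L0 TE.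
have ln0 A : 1 <= A -> 0 <= ln (8 * A) :> R by move=> A1_; apply: ln_ge0; lra.
have [l1 l2 l3] := And3 (ln0 _ A11) (ln0 _ A21) (ln0 _ A31).
have pos A : 1 <= A -> 0 < A :> R by exact: lt_le_trans.
have first0 : 0 <= E2^-1 * ln (8 * A1) * L.
  by apply: mulr_ge0 (ltW L0); apply: mulr_ge0 l1; rewrite invr_ge0 ltW.
have second0 : 0 <= E4^-1 * (2 * ln (8 * A2) + ln (8 * A3)).
  by apply: mulr_ge0; rewrite ?invr_ge0 ?(ltW E40)//; lra.
have T4 : 2 * ln (8 * A2) + ln (8 * A3) <= E4 * T.
  by rewrite -ler_pdivrMl//; lra.
have T2 : ln (8 * A1) <= E2 * T / L.
  by rewrite -mulrA -ler_pdivrMl// ler_pdivlMr//; lra.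
have b1 := mul_expRN_le8 (pos _ A11) T2.
have b2 : A2 * expR (- (E4 * T / 2)) <= 8^-1 by apply: mul_expRN_le8 (pos _ A21) _; lra.
have b3 : A3 * expR (- (E4 * T)) <= 8^-1 by apply: mul_expRN_le8 (pos _ A31) _; lra.
by rewrite -mulrA; lra.
Qed.
Theorem theorem3 (R : realType) (kappa beta delta sigma : R)
    (hkappa : 0 < kappa) (hbeta0 : 0 < beta) (hbeta1 : beta < 1)
    (hdelta : 0 < delta) (hsigma : 0 < sigma) :
  exists E1 E2 E3 E4 t1 : R,
    [/\ 0 < E1, 0 < E2, 0 < E3, 0 < E4 & 0 < t1] /\
    forall (d : nat) (mu : 'cV[R]_d) (D Rf : 'M[R]_d),
      (0 < d)%N ->
      standing_assumptions mu (D *m D^T) Rf ->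
      BC kappa beta delta sigma mu (D *m D^T) Rf ->
    forall (pi : probability 'cV[R]_d R),
      stationary_distribution D mu Rf pi ->
    forall (disp : measure_display) (Omega : measurableType disp)
      (P : probability Omega R) (B : R -> {RV P >-> 'cV[R]_d}),
      brownian_motion B ->
    forall (Xinf : {RV P >-> 'cV[R]_d}) (Y : R -> {RV P >-> 'cV[R]_d}),
      has_law Xinf pi -> independent_of_process Xinf B ->
      is_RBM D mu Rf B Xinf Y ->
    forall (x : 'cV[R]_d) (X : R -> {RV P >-> 'cV[R]_d}),
      orthant x -> is_RBM D mu Rf B (cst x) X ->
    let log2d := ln (2 * d%:R) in
    let d2 : R := d%:R ^+ 2 in
    (forall t : R, t1 * Num.max `|x| log2d <= t ->
      ('E_P[fun w => norm1 (X t w - Y t w)] <=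
        (2 * (2 * norm1 x + E1 * d2) * expR (- (E2 * t / log2d))
         + (4 * norm1 x + E1 * d2) * expR (- (E4 * t / 2))
         + E3 * d2 * expR (- (E4 * t)))%:E)%E) /\
    (relaxation_time (fun t => distribution P (X t)) pi <=
      (Num.max
        (E2^-1 * ln (8 * (2 * norm1 x + E1 * d2)) * log2d
         + E4^-1 * (2 * ln (8 * (4 * norm1 x + E1 * d2)) + ln (8 * E3 * d2)))
        (t1 * Num.max `|x| log2d))%:E)%E.
Proof.
pose gam := beta / 2; pose q := (1 - beta) / (1 - beta / 2).
have gam0 : 0 < gam by rewrite /gam; lra.
have q0 : 0 <= q by rewrite /q; apply: divr_ge0; lra.
have q1 : q < 1 by rewrite /q ltr_pdivrMr; lra.
have [n0 n00 kq] : exists2 n0 : nat, (0 < n0)%N & kappa * q ^+ n0 <= 1.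
  have qc : (q ^+ n @[n --> \oo]) --> (0 : R).
    by apply: cvg_expr; rewrite ger0_norm.
  have kV : 0 < kappa^-1 by rewrite invr_gt0.
  have /cvgrPdist_lt/(_ _ kV)[N _ HN] := qc.
  exists N.+1 => //; have := HN N.+1 (leqnSn N).
  rewrite /= sub0r normrN ger0_norm ?exprn_ge0// => /ltW.
  by move=> /(ler_wpM2l (ltW hkappa)); rewrite mulfV// gt_eqF.
pose Ch := 1 + `|\sum_(n < n0) kappa * q ^+ n|.
have Ch1 : 1 <= Ch by rewrite /Ch lerDl.
have Ch0 : 0 < Ch by exact: lt_le_trans Ch1.
pose c1 := step_rate gam Ch delta.
have c10 : 0 < c1 by exact: c1_gt0.
pose v := sigma * Ch / gam.
have v0 : 0 < v by apply: divr_gt0 gam0; exact: mulr_gt0.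
(* This value gives equality in the variance condition
   [2 * th ^+ 2 * v ^+ 2 * Del <= th * g / 2]. *)
pose th := gam * c1 / (32 * v ^+ 2).
have th0 : 0 < th.
  by apply: divr_gt0; apply: mulr_gt0 => //; exact: exprn_gt0.
have thv : 2 * th * v ^+ 2 = gam * c1 / 16 by rewrite /th; field; rewrite gt_eqF.
have c3 := const3_ge0 gam0 Ch1 hdelta th0.
have cc1 := @const1_ge0 R kappa _ _ _ _ _ hbeta0 gam0 Ch1 hdelta th0.
(* The added 1, here and in [E3], makes the arguments passed to [decay_le_half] at least 1. *)
pose E1 := 1 + const1 kappa beta gam Ch delta th.
pose E3 := 1 + const3 gam Ch delta th.
pose E2 := rate2 beta gam Ch delta th; pose E4 := rate4 gam Ch delta th.
pose t1 := time_factor gam Ch delta th.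
have E11 : 1 <= E1 by rewrite /E1; lra.
have E31 : 1 <= E3 by rewrite /E3; lra.
have E20 : 0 < E2 by exact: rate2_gt0.
have E40 : 0 < E4 by exact: rate4_gt0.
have t10 : 0 < t1 by have [+ _ _] := time_factor_ge gam0 Ch1 hdelta th0; exact: lt_le_trans.
exists E1, E2, E3, E4, t1; split; first by split => //; exact: lt_le_trans ltr01 _.
move=> d mu D Rf d0 std bc pi [_ pi_stat] disp Omega P B bm Xinf Y Xinf_law
  Xinf_indep Y_rbm x X x0 X_rbm log2d d2.
have [h ws] := BC_weight_exists hbeta0 hbeta1 bc n00 kq.
pose Del := block_length gam Ch delta th d.
have Del0 : 0 < Del by exact: block_length_gt0.
have Y_law : forall t : R, 0 <= t -> has_law (Y t) pi.
  by apply: (pi_stat _ _ _ B Xinf).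
have log0 : 0 < log2d by exact: ell_gt0.
have d21 : 1 <= d2 by rewrite /d2 -natrX ler1n expn_gt0 d0.
have N0 := norm1_ge0 x.
have bound t : t1 * Num.max `|x| log2d <= t ->
    (\int[P]_w (norm1 (X t w - Y t w))%:E <=
        (2 * (2 * norm1 x + E1 * d2) * expR (- (E2 * t / log2d))
         + (4 * norm1 x + E1 * d2) * expR (- (E4 * t / 2))
         + E3 * d2 * expR (- (E4 * t)))%:E)%E.
  move=> tge.
  have t0 : 0 <= t.
    by apply: le_trans tge; apply: mulr_ge0 (ltW t10) _; rewrite le_max normr_ge0.
  pose n := Num.truncn (t / Del).
  have nt : n%:R * Del <= t.
    have /truncn_itv/andP[+ _] : 0 <= t / Del by exact: divr_ge0 _ (ltW Del0).
    by rewrite ler_pdivlMr.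
  apply: (le_trans (expectation_gap_le d0 ws hdelta th0 Del0 (BC2 bc) hkappa
    hbeta0 hbeta1 (BC_decay bc) (noise_row_le hsigma d0 bc ws) _
    (quiet_cond gam0 Ch1 hdelta th0 d0) (union_cond gam0 Ch1 hdelta th0 d0)
    (gain_cond gam0 Ch1 hdelta th0 d0) bm Xinf_law Y_law (is_RBM_path bm Y_rbm)
    x0 (is_RBM_path bm X_rbm) nt erefl erefl erefl)).
    rewrite /quiet_level -/c1 (_ : 2 * th ^+ 2 * v ^+ 2 = th * (2 * th * v ^+ 2)).
      by rewrite thv -/gam; lra.
    by ring.
  rewrite lee_fin; apply: le_trans (gap_total_le hbeta0 gam0 Ch1 hdelta th0 d0 N0
    (norm1_le_norm x) (normr_ge0 x) (excess_le_norm ws x hdelta Del0) tge erefl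
    erefl erefl erefl) _.
  rewrite -/E2 -/E4 -/d2 -/log2d /E1 /E3.
  set e2 := expR (- (E2 * t / log2d)); set e4 := expR (- (E4 * t)).
  set e4' := expR _; have e20 : 0 < e2 by exact: expR_gt0.
  have e40 : 0 < e4 by exact: expR_gt0.
  have e4'0 : 0 < e4' by exact: expR_gt0.
  have N2 : 0 <= norm1 x * e2 by exact: mulr_ge0 N0 (ltW e20).
  have d20 : 0 < d2 by exact: lt_le_trans ltr01 d21.
  have k2 := mulr_ge0 cc1 (ltW (mulr_gt0 d20 e20)).
  have h1 := mulr_gt0 d20 e20; have h2 := mulr_gt0 d20 e40.
  have h3 : 0 <= (4 * norm1 x + (1 + const1 kappa beta gam Ch delta th) * d2) * e4'.
    apply: mulr_ge0 _ (ltW e4'0); apply: addr_ge0; first exact: mulr_ge0.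
    by apply: mulr_ge0 (ltW d20); lra.
  by lra.
have [A11 A21 A31] : [/\ 1 <= 2 * norm1 x + E1 * d2, 1 <= 4 * norm1 x + E1 * d2 & 1 <= E3 * d2].
  have Ed : 1 <= E1 * d2 by rewrite -[leLHS]mulr1 ler_pM.
  by split; [lra|lra|rewrite -[leLHS]mulr1 ler_pM].
split; first by move=> t /bound; rewrite unlock.
set T := Num.max _ _; apply: ereal_inf_lbound; exists T => //.
have T1 : t1 * Num.max `|x| log2d <= T by rewrite /T le_max lexx orbT.
split.
  by apply: le_trans T1; apply: mulr_ge0 (ltW t10) _; rewrite le_max normr_ge0.
have T0 : 0 <= T by apply: le_trans T1; apply: mulr_ge0 (ltW t10) _; rewrite le_max normr_ge0.
apply: le_trans (wasserstein1_le_expectation (X T) (Y_law _ T0)) _.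
apply: (le_trans (bound _ T1)); rewrite lee_fin.
by apply: decay_le_half => //; rewrite mulrA le_max lexx.
Qed.
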